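(* Let $g\ge 2$ be an integer and let $d\in\{2g+1,2g+2\}$. Let $\alpha$ be a nonzero algebraic integer and let $F=\mathbb{Q}(\alpha)$. Then for every prime $p>P^+(d)$ with $p\nmid N_{F/\mathbb{Q}}(\alpha)$, the family $\mathcal{C}_\alpha\to\mathcal{S}^\circ$ of genus-$g$ curves $y^2=x^d+\alpha x+t$ is generically ordinary at each prime $\mathfrak{p}\mid p$ of $F$.
   Context: $P^+(d)=d^2-4d+2$ if $d=2g+1$, and $P^+(d)=(d^2-3d+2)/2$ if $d=2g+2$. $\mathcal{O}_F$ is the ring of integers of $F=\mathbb{Q}(\alpha)$, $D_\alpha(t)=\mathrm{disc}_x(x^d+\alpha x+t)$, and $\mathcal{S}^\circ=\mathrm{Spec}\,\mathcal{O}_F[1/2,t,D_\alpha(t)^{-1}]$. The family $\mathcal{C}_\alpha\to\mathcal{S}^\circ$ is the family of smooth projective hyperelliptic curves of genus $g$ with affine equation $y^2=x^d+\alpha x+t$. A smooth projective curve of genus $g$ over a field of characteristic $p>0$ is ordinary if its Jacobian is an ordinary abelian variety, i.e. its Newton polygon has only slopes $0$ and $1$. For a prime $\mathfrak{p}\mid p$ of $\mathcal{O}_F$ with residue field $\kappa(\mathfrak{p})=\mathcal{O}_F/\mathfrak{p}$, put $\mathcal{S}^\circ_{\mathfrak{p}}=\mathcal{S}^\circ\times_{\mathrm{Spec}\,\mathcal{O}_F}\mathrm{Spec}\,\kappa(\mathfrak{p})$, a nonempty open subscheme of $\mathbb{A}^1_{\kappa(\mathfrak{p})}$ (the $t$-line).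 The family is generically ordinary at $\mathfrak{p}$ if its restriction to $\mathcal{S}^\circ_{\mathfrak{p}}$ has ordinary generic fiber, i.e. the curve $y^2=x^d+\bar\alpha x+t$ over the rational function field $\kappa(\mathfrak{p})(t)$ is ordinary, where $\bar\alpha=\alpha\bmod\mathfrak{p}$; equivalently, the ordinary locus in $\mathcal{S}^\circ_{\mathfrak{p}}$ is a nonempty open subset. *)

(* Defs.v *)
From HB Require Import structures.
From mathcomp Require Import all_boot all_order all_algebra all_field.
From mathcomp Require Import boolp.

Set Implicit Arguments.
Unset Strict Implicit.
Unset Printing Implicit Defensive.

Import GRing.Theory.
Local Open Scope ring_scope.
Local Open Scope quotient_scope.

Definition Pplus (d : nat) : nat :=
  if odd d then (d ^ 2 - 4 * d + 2)%N else ((d ^ 2 - 3 * d + 2) %/ 2)%N.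

(* A number field is a [fieldExtType rat]. *)

Definition integral_pred (F : fieldExtType rat) : {pred F} :=
  fun x => `[< integralOver (intr : int -> F) x >].

Lemma integral_subring_closed (F : fieldExtType rat) :
  subring_closed (@integral_pred F).
Proof.
split=> [|x y|x y]; first by apply/asboolP; exact: integral1.
  by move=> /asboolP ix /asboolP iy; apply/asboolP; exact: integral_sub.
by move=> /asboolP ix /asboolP iy; apply/asboolP; exact: integral_mul.
Qed.

Record ring_of_integers (F : fieldExtType rat) := RingOfIntegers {
  roi_val : F;
  _ : integral_pred roi_val
}.

HB.instance Definition _ (F : fieldExtType rat) :=
  [isSub for @roi_val F].
HB.instance Definition _ (F : fieldExtType rat) :=
  [Choice of ring_of_integers F by <:].
HB.instance Definition _ (F : fieldExtType rat) :=
  GRing.SubChoice_isSubComNzRing.Build F (@integral_pred F)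
    (ring_of_integers F) (@integral_subring_closed F).

(* N_{F/Q}(a) = det of multiplication by a on the Q-vector space F. *)
Definition field_norm (F : fieldExtType rat) (a : F) : rat :=
  \det (passmx.mxof (vbasis {:F}) (vbasis {:F}) (amull a)).

(* x^d + a x + t *)
Definition trinomial (R : comNzRingType) (d : nat) (a t : R) : {poly R} :=
  'X^d + a *: 'X + t%:P.

(* Discriminant of a monic polynomial f of degree (size f).-1. *)
Definition disc (R : comNzRingType) (f : {poly R}) : R :=
  (-1) ^+ 'C((size f).-1, 2) * resultant f f^`().

(* D_a(t) = disc_x (x^d + a x + t), an element of R[t]. *)
Definition disc_family (R : comNzRingType) (d : nat) (a : R) : {poly R} :=
  disc (trinomial d a%:P 'X).

(* Number of K-points of the smooth projective model of y^2 = f(x), for f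
   squarefree over a finite field K of odd characteristic: the points of the
   (smooth) affine curve, plus those at infinity, namely one rational point if
   deg f is odd, and one for each square root of the leading coefficient in K
   if deg f is even. *)
Definition hyp_npoints (K : finFieldType) (f : {poly K}) : nat :=
  (#|[set P : K * K | P.2 ^+ 2 == f.[P.1]]| +
   (if odd (size f).-1 then 1
    else #|[set z : K | z ^+ 2 == lead_coef f]|))%N.

Definition hyp_genus (K : fieldType) (f : {poly K}) : nat :=
  ((size f).-1.-1./2)%N.

(* L(T) = det (1 - T Frob_q | T_l J) for the Jacobian J of y^2 = f(x) over
   K = F_q.  It has degree 2g, and its reciprocal roots z_i are characterised by
   #C(F_{q^n}) = q^n + 1 - \sum_i z_i^n for all n >= 1; this determines L, as
   in characteristic zero the power sums determine the z_i.  (n = 0 is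
   excluded since #|E| > 1.) *)
Definition is_Lpoly (K : finFieldType) (f : {poly K}) (L : {poly int}) : Prop :=
  size L = (hyp_genus f).*2.+1 /\
  exists z : (hyp_genus f).*2.-tuple algC,
    map_poly (intr : int -> algC) L = \prod_(x <- z) (1 - x *: 'X) /\
    forall (E : finFieldType) (iota : {rmorphism K -> E}) (n : nat),
      #|E| = (#|K| ^ n)%N ->
      (hyp_npoints (map_poly iota f))%:R =
        (#|K| ^ n)%:R + 1 - \sum_(x <- z) x ^+ n :> algC.

(* The q-adic valuation of a nonzero integer, normalised by v(q) = 1, for q a
   prime power. *)
Definition val_q (q : nat) (a : int) : rat :=
  (logn (pdiv q) `|a|%N)%:R / (logn (pdiv q) q)%:R.

(* s is the slope of a segment of the q-adic Newton polygon of L, i.e. of the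
   lower convex hull of the points (k, v(L_k)) with L_k <> 0: two of these
   points lie on a line of slope s below which there are none of them. *)
Definition newton_slope (q : nat) (L : {poly int}) (s : rat) : Prop :=
  exists i j : nat,
    [/\ (i < j)%N, L`_i != 0, L`_j != 0,
        val_q q L`_j = val_q q L`_i + s * (j%:R - i%:R) &
        forall k : nat, L`_k != 0 ->
          val_q q L`_i + s * (k%:R - i%:R) <= val_q q L`_k].

(* The Newton polygon of an abelian variety over F_q is the q-adic Newton
   polygon of det (1 - T Frob_q). *)
Definition ordinary_hyp (K : finFieldType) (f : {poly K}) : Prop :=
  exists2 L : {poly int}, is_Lpoly f L &
    forall s : rat, newton_slope #|K| L s -> s = 0 \/ s = 1.

Section Family.

Variables (F : fieldExtType rat) (alpha : ring_of_integers F) (d : nat).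
Variable P : prime_idealr (ring_of_integers F).

Section Point.

(* A point of the affine t-line over the residue field, with values in a finite
   field K: an embedding iota of the residue field in K, and t0 in K.  As every
   finite extension of the residue field is such a K, these give all the closed
   points of the t-line. *)
Variables (K : finFieldType) (iota : {rmorphism {ideal_quot P} -> K}) (t0 : K).

Definition red (x : ring_of_integers F) : K := iota (\pi_{ideal_quot P} x).

Definition in_base : Prop :=
  (2%:R : K) != 0 /\ (map_poly red (disc_family d alpha)).[t0] != 0.

Definition in_ordinary_locus : Prop :=
  in_base /\ ordinary_hyp (trinomial d (red alpha) t0).

End Point.

(* The ordinary locus in the fibre at P of the base of the family is a nonempty
   open subset: it is nonempty, and cut out in the base by the nonvanishing of
   some h over the residue field. *)
Definition generically_ordinary : Prop :=
  (exists (K : finFieldType) (iota : {rmorphism {ideal_quot P} -> K}) (t0 : K),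
     in_ordinary_locus iota t0) /\
  (exists h : {poly {ideal_quot P}},
     forall (K : finFieldType) (iota : {rmorphism {ideal_quot P} -> K}) (t0 : K),
       in_ordinary_locus iota t0 <->
       in_base iota t0 /\ (map_poly iota h).[t0] != 0).

End Family.

(* Main.v *)
(* Let K be a finite field of odd characteristic p, and q = #|K|.  For a monic
   squarefree f of degree d, the point counts of y^2 = f(x) are power sums of
   an Euler product over monic polynomials, whose character is the quadratic
   symbol h |-> (f / h).  This symbol depends only on h modulo f, up to a sign
   depending on the degree of h, so that Gauss sums modulo f give the functional
   equation of the L-polynomial L.  By the functional equation, the curve is
   ordinary if and only if p does not divide L_g.  Writing the quadratic
   character of K as a power, the power sums are modulo p the opposites of the
   traces of the powers of the q-Hasse-Witt matrix; hence L_g is modulo p, up to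
   sign, its determinant, and this vanishes with the determinant of the
   p-Hasse-Witt matrix H.
     For f = x^d + a x + t, the lowest terms in t of the entries of H form a
   matrix of binomial coefficients C(m - A_i, k_i - j'), with m = (p - 1)/2.
   Modulo p, m - A_i - k_i is an affine function of k_i, so up to factors that
   depend on one index only, the entry (i, j) is the value at k_i of a polynomial
   P_j of degree less than g which is a product of linear factors.  The P_j are
   linearly independent and the k_i are distinct modulo p as soon as p > P^+(d),
   so det H is a nonzero polynomial in t.
     Finally a divides in O_F an integer which is, up to sign, its norm, so that
   it is nonzero in the residue field; and a polynomial over a finite field has a
   non-root in some finite extension. *)

From HB Require Import structures.
Require Import Defs.
From mathcomp Require Import all_boot all_order all_algebra all_field.
From mathcomp Require Import boolp.
From mathcomp Require Import fingroup cyclic classfun character.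
From mathcomp Require Import zify ring lra.
Set Implicit Arguments.
Unset Strict Implicit.
Unset Printing Implicit Defensive.
Import Order.TTheory GRing.Theory Num.Theory FinRing.Theory.
Local Open Scope ring_scope.
Local Open Scope quotient_scope.

(** * Euler products over monic polynomials *)

(** [is_Lpoly] characterises L by point counts alone, so an integer polynomial of degree exactly 2g
    with these counts has to be produced: the Euler product gives integrality, the Gauss sums the
    degree and the functional equation. The latter is kept in the form L_n L_2g = q^n L_(2g-n),
    where the Gauss sum has been eliminated through the case n = 0; it yields v(L_n) = v(L_(2g-n)) +
    n - g. Comparing L_g with a determinant modulo p uses Newton's identities in characteristic p,
    which divide by 1, ..., g and so require g < p. The constant P^+(d) comes from the linear
    factors of the final determinant. Cleared of the denominator 2(d-1), they are, up to sign,
    integers that must be prime to p. For odd d the largest is P^+(d); for even d all are even and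
    the largest half is P^+(d). The one exception is the value (2g-1)(2g+1), respectively twice
    (2g+1)(g+1), which splits into factors smaller than p. *)

Section EulerProduct.

Variable K : finFieldType.

(** Monic polynomials of degree [n] are indexed by the finite type of their lower coefficients, so
    that sums over them are big operators. *)
Definition monicp n (v : 'rV[K]_n) : {poly K} := 'X^n + rVpoly v.

Lemma size_rVpoly n (v : 'rV[K]_n) : (size (rVpoly v) <= n)%N.
Proof. exact: size_poly. Qed.

Lemma size_monicp n (v : 'rV[K]_n) : size (monicp v) = n.+1.
Proof. by rewrite size_polyDl size_polyXn // ltnS size_rVpoly. Qed.

Lemma monicp_monic n (v : 'rV[K]_n) : monicp v \is monic.
Proof.
by rewrite monicE lead_coefDl ?lead_coefXn // size_polyXn ltnS size_rVpoly.
Qed.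

Definition monic_rV n (h : {poly K}) : 'rV[K]_n := poly_rV (h - 'X^n).

Lemma monicpK n : cancel (@monicp n) (monic_rV n).
Proof. by move=> v; rewrite /monic_rV /monicp addrAC subrr add0r rVpolyK. Qed.

Lemma monic_rVK n (h : {poly K}) :
  h \is monic -> size h = n.+1 -> monicp (monic_rV n h) = h.
Proof.
move=> hm sh; rewrite /monicp /monic_rV poly_rV_K ?subrKC //.
apply/leq_sizeP => j; rewrite leq_eqVlt coefB coefXn => /orP[/eqP <-|lt_nj].
  by rewrite eqxx; move: hm; rewrite monicE lead_coefE sh => /eqP ->; rewrite subrr.
by rewrite nth_default ?sh // (gtn_eqF lt_nj) subrr.
Qed.

Lemma sum_monic_dvd (R : nzRingType) n s (Q : {poly K}) (F : {poly K} -> R) :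
  Q \is monic -> size Q = s.+1 ->
  \sum_(v : 'rV[K]_n | Q %| monicp v) F (monicp v) =
  (if (s <= n)%N then \sum_(u : 'rV[K]_(n - s)) F (Q * monicp u) else 0).
Proof.
move=> Qm sQ; case: leqP => [le_sn|lt_ns]; last first.
  rewrite big_pred0 // => v; apply: contraTF lt_ns => dvQ.
  rewrite -leqNgt -ltnS -sQ -(size_monicp v) dvdp_leq //.
  by rewrite monic_neq0 ?monicp_monic.
have sM (u : 'rV[K]_(n - s)) : size (Q * monicp u) = n.+1.
  rewrite size_Mmonic ?monic_neq0 // ?monicp_monic // sQ size_monicp.
  by rewrite addSn /= addnS subnKC.
have QM (u : 'rV[K]_(n - s)) : Q * monicp u \is monic.
  by rewrite monicMl ?monicp_monic.
rewrite (reindex_onto (fun u => monic_rV n (Q * monicp u))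
   (fun v => monic_rV (n - s) (monicp v %/ Q))) /=; last first.
  move=> v dvQ; set k := monicp v %/ Q.
  have def_k : Q * k = monicp v by rewrite mulrC divpK.
  have km : k \is monic by rewrite -(monicMl _ Qm) def_k monicp_monic.
  have sk : size k = (n - s).+1.
    have := size_monicp v; rewrite -def_k size_Mmonic ?monic_neq0 // sQ.
    by rewrite addSn /= => e; rewrite -subSn // -e addKn.
  by rewrite monic_rVK // def_k monicpK.
apply: eq_big => [u|u _]; last by rewrite monic_rVK.
by rewrite monic_rVK // dvdp_mulr //= mulKp ?monic_neq0 // monicpK eqxx.
Qed.

Definition irrp n (v : 'rV[K]_n) := irreducibleb (monicp v).

Lemma irr_factor (h : {poly K}) : (1 < size h)%N ->
  exists2 P : {poly K}, P \is monic & irreducible_poly P /\ P %| h.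
Proof.
have [m] := ubnP (size h); elim: m h => // m IHm h; rewrite ltnS => le_hm sh.
have h0 : h != 0 by rewrite -size_poly_gt0 ltnW.
have [/irreducibleP irr_h|nirr] := boolP (irreducibleb h).
  have lc0 : (lead_coef h)^-1 != 0 by rewrite invr_eq0 lead_coef_eq0.
  exists ((lead_coef h)^-1 *: h).
    by rewrite monicE lead_coefZ mulVf ?lead_coef_eq0.
  split; last by rewrite dvdpZl.
  split; first by rewrite size_scale.
  move=> q sq; rewrite dvdpZr // => /(irr_h _ sq) qh.
  by apply: eqp_trans qh _; rewrite eqp_sym; apply: eqp_scale.
have [q [sq qh nqh]] :
  exists q : {poly K}, [/\ size q != 1%N, q %| h & ~~ (q %= h)].
  move/irreducibleP: nirr => nirr; apply: contrapT => nex; apply: nirr.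
  split=> // q sq qh; apply: contrapT => /negP nqh; apply: nex.
  by exists q.
have q0 : q != 0 by apply: contraTneq qh => ->; rewrite dvd0p.
have lt_qh : (size q < size h)%N.
  by rewrite ltn_neqAle dvdp_leq // andbT dvdp_size_eqp.
have [|P Pm [irrP Pq]] := IHm q (leq_trans lt_qh le_hm).
  by rewrite ltn_neqAle eq_sym sq size_poly_gt0.
by exists P => //; split=> //; apply: dvdp_trans Pq qh.
Qed.

Lemma irr_monic_eq (P Q : {poly K}) : P \is monic -> Q \is monic ->
  irreducible_poly P -> irreducible_poly Q -> P %| Q -> P = Q.
Proof.
move=> Pm Qm [sP _] irrQ PQ; apply/eqP; rewrite -eqp_monic //.
by apply: irrQ => //; rewrite gtn_eqF.
Qed.

Lemma size_monicX (P : {poly K}) j :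
  P \is monic -> size (P ^+ j) = ((size P).-1 * j).+1.
Proof.
move=> Pm; rewrite -size_exp prednK // size_poly_gt0.
by rewrite monic_neq0 ?monic_exp.
Qed.

(** The sum over [j] is the multiplicity of [Q], cut off at [N]. As [m < N], the multiplicity of [P]
    in [P * h] is at most [N], so the cut-off loses nothing. *)
Lemma sum_count_dvd (N m : nat) (P Q h : {poly K}) :
  P \is monic -> irreducible_poly P -> Q \is monic -> irreducible_poly Q ->
  h \is monic -> size h = m.+1 -> (m < N)%N ->
  (\sum_(1 <= j < N.+1) (Q ^+ j %| P * h)%R =
   \sum_(1 <= j < N.+1) (Q ^+ j %| h)%R + (Q == P))%N.
Proof.
move=> Pm irrP Qm irrQ hm sh lt_mN; case: eqVneq => [->|neqQP]; last first.
    rewrite addn0; apply: eq_big_nat => j /andP[j_gt0 _].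
  rewrite mulrC Gauss_dvdpl // coprimep_pexpl // irreducible_poly_coprime //.
  by apply: contra neqQP => QP; apply/eqP/irr_monic_eq.
have P0 : P != 0 by rewrite monic_neq0.
rewrite big_nat_recl; last by lia.
rewrite expr1 dvdp_mulr // [in RHS]big_nat_recr /=; last by lia.
have -> : (P ^+ N %| h) = false.
  apply: contraTF (lt_mN) => PNh; rewrite -leqNgt -ltnS -sh.
  apply: leq_trans (dvdp_leq (monic_neq0 hm) PNh).
  rewrite size_monicX // ltnS leq_pmull //.
  by case: irrP => /=; case: (size P) => [|[|]].
rewrite addn0 addn1 add1n; congr _.+1.
by apply: eq_bigr => j _; rewrite exprS dvdp_mul2l.
Qed.

(** Unique factorisation, read on degrees. The induction strips one irreducible factor [P] from [h];
    [N] is independent of [n] so that the ranges stay the same for the cofactor. *)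
Lemma sum_irr_dvd (n N : nat) (h : {poly K}) :
  h \is monic -> size h = n.+1 -> (n <= N)%N ->
  (\sum_(1 <= r < N.+1) \sum_(v : 'rV[K]_r | irrp v)
     \sum_(1 <= j < N.+1) r * (monicp v ^+ j %| h)%R = n)%N.
Proof.
elim/ltn_ind: n h => -[|n] IHn h hm sh le_nN.
  apply: big1_seq => r /andP[_]; rewrite mem_index_iota => /andP[r_gt0 _].
  apply: big1 => v /irreducibleP irrv.
  apply: big1_seq => j /andP[_]; rewrite mem_index_iota => /andP[j_gt0 _].
  apply/eqP; rewrite muln_eq0 eqb0 orbC; apply/orP; left.
  apply/negP => /(dvdp_leq (monic_neq0 hm)).
  rewrite sh size_monicX ?monicp_monic // size_monicp /= ltnS leqn0 muln_eq0.
  by rewrite !gtn_eqF.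
have [|P Pm [irrP Ph]] := @irr_factor h; first by rewrite sh.
have [k def_h] : exists k : {poly K}, h = P * k.
  by have [k ->] := dvdpP _ _ Ph; exists k; rewrite mulrC.
have km : k \is monic by move: hm; rewrite def_h monicMl.
have [s sP] : {s | size P = s.+2}.
  by case: irrP => + _; case: (size P) => [|[|s]] // _; exists s.
have sk : (size k = (n - s).+1 /\ s <= n)%N.
  have := sh; rewrite def_h size_Mmonic ?monic_neq0 // sP !addSn /=.
  have : (0 < size k)%N by rewrite size_poly_gt0 monic_neq0.
  move: (size k) => m; by lia.
have [{}sk le_sn] := sk.
have Ps : monicp (monic_rV s.+1 P) = P by rewrite monic_rVK.
transitivity (\sum_(1 <= r < N.+1) \sum_(v : 'rV[K]_r | irrp v)
  (\sum_(1 <= j < N.+1) r * (monicp v ^+ j %| k)%R + r * (monicp v == P)))%N.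
  apply: eq_bigr => r _; apply: eq_bigr => v /irreducibleP irrv.
  rewrite -!big_distrr /= -mulnDr def_h.
  congr (_ * _)%N; apply: (@sum_count_dvd _ (n - s)) => //.
    exact: monicp_monic.
  by lia.
under eq_bigr do rewrite big_split.
rewrite big_split /= (IHn _ _ k km sk); try by lia.
rewrite (bigD1_seq s.+1) ?mem_index_iota ?iota_uniq //=; last by lia.
rewrite (bigD1 (monic_rV s.+1 P)) /=; last by apply/irreducibleP; rewrite Ps.
rewrite Ps eqxx muln1 !big1 ?addn0; first by lia.
- move=> r ner; apply: big1 => v _; case: eqP => [e|]; last by rewrite muln0.
  by move: ner; have := size_monicp v; rewrite e sP => -[->]; rewrite eqxx.
- move=> v /andP[_ nev]; case: eqP => [e|]; last by rewrite muln0.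
  by move: nev; rewrite -e monicpK eqxx.
Qed.

Lemma sum_multiples (R : nzRingType) (n r : nat) (G : nat -> R) : (0 < r)%N ->
  \sum_(1 <= k < n.+1 | (r %| k)%N) G k =
  \sum_(1 <= j < n.+1) (if (j * r <= n)%N then G (j * r)%N else 0).
Proof.
move=> r_gt0.
transitivity (\sum_(1 <= j < n.+1) \sum_(1 <= k < n.+1 | k == (j * r)%N) G k).
  under [RHS]eq_bigr do rewrite big_mkcond.
  rewrite exchange_big /= big_mkcond; apply: eq_big_nat => k /andP[k_gt0 le_kn].
  case: dvdnP => [[j def_k]|nd].
    rewrite (bigD1_seq j) ?mem_index_iota ?iota_uniq //=; last by nia.
    rewrite def_k eqxx big1 ?addr0 // => i ne_ij.
    by rewrite eqn_pmul2r // eq_sym (negPf ne_ij).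
  by rewrite big1 // => j _; case: eqP => // e; case: nd; exists j.
apply: eq_big_nat => j /andP[j_gt0 _]; case: leqP => le_jn.
  by rewrite -big_filter filter_pred1_uniq ?mem_index_iota ?iota_uniq ?big_seq1 //; nia.
rewrite big_nat_cond big_pred0 // => k; apply/negP => /andP[+ /eqP].
by lia.
Qed.

Variables (R : comNzRingType) (w : {poly K} -> R).
Hypothesis w1 : w 1 = 1.
Hypothesis wM : forall g h, g \is monic -> h \is monic -> w (g * h) = w g * w h.

Definition wcoef n := \sum_(v : 'rV[K]_n) w (monicp v).

(** The coefficient of T^n in T d/dT log of the product over P of 1 / (1 - w(P) T^deg P), a series
    whose own coefficients are the [wcoef]. *)
Definition wpsum n := \sum_(1 <= r < n.+1 | (r %| n)%N)
  \sum_(v : 'rV[K]_r | irrp v) r%:R * w (monicp v) ^+ (n %/ r).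

Lemma wX h j : h \is monic -> w (h ^+ j) = w h ^+ j.
Proof.
move=> hm; elim: j => [|j IHj]; first by rewrite !expr0 w1.
by rewrite !exprS wM ?monic_exp // IHj.
Qed.

(* The logarithmic derivative of the Euler product: weigh
   [deg h = \sum_(P, j) (deg P) [P ^ j | h]] by [w h] and sum over [h]. *)
Lemma wcoef_newton n :
  n%:R * wcoef n = \sum_(1 <= k < n.+1) wpsum k * wcoef (n - k).
Proof.
transitivity (\sum_(1 <= r < n.+1) \sum_(v : 'rV[K]_r | irrp v)
  \sum_(1 <= j < n.+1) if (j * r <= n)%N then
    r%:R * w (monicp v) ^+ (j * r %/ r) * wcoef (n - j * r) else 0).
  transitivity (\sum_(u : 'rV[K]_n) \sum_(1 <= r < n.+1)
     \sum_(v : 'rV[K]_r | irrp v) \sum_(1 <= j < n.+1)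
       r%:R * ((monicp v ^+ j %| monicp u)%R%:R * w (monicp u))).
    rewrite mulr_sumr; apply: eq_bigr => u _.
    rewrite -{1}(sum_irr_dvd (monicp_monic u) (size_monicp u) (leqnn n)).
    rewrite natr_sum mulr_suml; apply: eq_bigr => r _.
    rewrite natr_sum mulr_suml; apply: eq_bigr => v _.
    rewrite natr_sum mulr_suml; apply: eq_bigr => j _.
    by rewrite natrM mulrA.
  rewrite exchange_big; apply: eq_big_nat => r /andP[r_gt0 _].
  rewrite exchange_big; apply: eq_bigr => v irrv.
  rewrite exchange_big; apply: eq_big_nat => j /andP[j_gt0 _].
  rewrite -mulr_sumr.
  under eq_bigr do rewrite mulr_natl mulrb.
  rewrite -big_mkcond (@sum_monic_dvd _ n (r * j)%N) ?monic_exp ?monicp_monic //;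
    last by rewrite size_monicX ?monicp_monic // size_monicp.
  rewrite mulnC mulnK //; case: ifP => _; last by rewrite mulr0.
  rewrite -mulrA; congr (_ * _); rewrite mulr_sumr; apply: eq_bigr => u _.
  by rewrite wM ?monic_exp ?monicp_monic // wX ?monicp_monic.
transitivity (\sum_(1 <= r < n.+1) \sum_(1 <= k < n.+1 | (r %| k)%N)
  \sum_(v : 'rV[K]_r | irrp v) r%:R * w (monicp v) ^+ (k %/ r) * wcoef (n - k)).
  apply: eq_big_nat => r /andP[r_gt0 _]; rewrite [RHS]exchange_big /=.
  by apply: eq_bigr => v _; rewrite sum_multiples.
rewrite (exchange_big_dep_nat predT) //=; apply: eq_big_nat => k /andP[k_gt0 le_kn].
rewrite /wpsum mulr_suml (@big_cat_nat _ _ _ k.+1) //= [X in _ + X]big1_seq ?addr0.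
  by apply: eq_bigr => r _; rewrite mulr_suml.
move=> r /andP[r_dvd]; rewrite mem_index_iota => /andP[lt_kr _].
by have := dvdn_leq k_gt0 r_dvd; rewrite leqNgt lt_kr.
Qed.

End EulerProduct.

(** * Finite fields *)

Section QuadraticCharacter.

Variable K : finFieldType.

(** Integer-valued, so that it can be read in [K], where it is a power, as well as in [algC], where
    the Gauss sums live. *)
Definition qchar (a : K) : int :=
  if a == 0 then 0 else if a ^+ #|K|.-1./2 == 1 then 1 else -1.

Lemma finField_generator : exists g : K,
  [/\ g != 0, forall a, a != 0 -> exists i, a = g ^+ i
    & forall i, (g ^+ i == 1) = (#|K|.-1 %| i)%N].
Proof.
have /cyclicP[u def_u] := field_unit_group_cyclic [set: {unit K}]%G.
exists (FinRing.uval u); split=> [|a nz_a|i].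
- by rewrite -unitfE; apply: (valP u).
- have: finField_unit nz_a \in <[u]>%g by rewrite -def_u inE.
  case/cycleP=> i e; exists i; rewrite -val_unitX -e //.
- rewrite -val_unitX -val_unit1 val_eqE -order_dvdn.
  by rewrite orderE -def_u card_finField_unit.
Qed.

Lemma qchar0 : qchar 0 = 0. Proof. by rewrite /qchar eqxx. Qed.

Lemma qchar1 : qchar 1 = 1.
Proof. by rewrite /qchar oner_eq0 expr1n eqxx. Qed.

Hypothesis K2 : (2%:R : K) != 0.

Lemma odd_card : odd #|K|.
Proof.
have [p pr_p pK] := finPcharP K.
rewrite (card_pprimeChar pK) oddX orbC -[odd p]negbK.
case: (even_prime pr_p) => [p2|->//].
by move: K2; rewrite -p2 (pcharf0 pK) eqxx.
Qed.

Lemma card_predE : #|K|.-1 = (#|K|.-1./2).*2.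
Proof.
rewrite -[LHS]odd_double_half; suff -> : odd #|K|.-1 = false by [].
by move: odd_card (finNzRing_gt1 K); case: #|K| => //= n /negPf.
Qed.

Lemma half_card_gt0 : (0 < #|K|.-1./2)%N.
Proof.
by move: card_predE (finNzRing_gt1 K); case: #|K| => [|[|n]] //=; lia.
Qed.

Lemma half_card_sqr (a : K) : a != 0 -> (a ^+ #|K|.-1./2) ^+ 2 = 1.
Proof.
move=> nz_a; rewrite -exprM muln2 -card_predE; apply: (mulfI nz_a).
by rewrite -exprS prednK ?expf_card ?mulr1 // ltnW ?finNzRing_gt1.
Qed.

Lemma qcharE (a : K) : (qchar a)%:~R = a ^+ #|K|.-1./2.
Proof.
rewrite /qchar; have [->|nz_a] := eqVneq a 0.
  by rewrite expr0n gtn_eqF ?half_card_gt0.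
case: eqP => [->//|/eqP n1].
by have := half_card_sqr nz_a; move/eqP; rewrite sqrf_eq1 (negPf n1) => /eqP ->.
Qed.

(** Identities between signs can thus be checked in [K], where [qchar] is a power of its
    argument. *)
Lemma qchar_inj (x y : int) : x \in [:: 0; 1; -1] -> y \in [:: 0; 1; -1] ->
  x%:~R = y%:~R :> K -> x = y.
Proof.
have N1 : (1 : K) != -1 by rewrite -addr_eq0.
rewrite !inE => /or3P[] /eqP -> /or3P[] /eqP -> // /eqP;
rewrite ?rmorphN ?rmorph1 ?rmorph0 ?(negPf N1) ?[_ == 1]eq_sym ?(negPf N1) //
  ?oppr_eq0 ?oner_eq0 ?[0 == _]eq_sym ?oppr_eq0 ?oner_eq0 //.
Qed.

Lemma qchar_dom a : qchar a \in [:: 0; 1; -1].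
Proof. by rewrite /qchar; case: ifP => // _; case: ifP. Qed.

Lemma qcharM : {morph qchar : a b / a * b}.
Proof.
move=> a b; apply: qchar_inj; rewrite ?qchar_dom //.
  move: (qchar_dom a) (qchar_dom b).
  by rewrite !inE => /or3P[] /eqP -> /or3P[] /eqP ->.
by rewrite intrM !qcharE exprMn.
Qed.

Lemma qcharX a n : qchar (a ^+ n) = qchar a ^+ n.
Proof.
elim: n => [|n IHn]; first by rewrite !expr0 qchar1.
by rewrite !exprS qcharM IHn.
Qed.

Lemma qchar_eq0 a : (qchar a == 0) = (a == 0).
Proof. by rewrite /qchar; case: (a == 0) => //; case: ifP. Qed.

Lemma qchar_sqr1 a : a != 0 -> qchar a ^+ 2 = 1.
Proof. by rewrite /qchar => /negPf ->; case: ifP. Qed.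

Lemma card_sqrt (a : K) : #|[set z : K | z ^+ 2 == a]|%:R = 1 + qchar a.
Proof.
have [->|nz_a] := eqVneq a 0.
  rewrite qchar0 addr0 -[1]/1%:R; congr _%:R; apply/eqP/cards1P; exists 0.
  by apply/setP=> z; rewrite !inE sqrf_eq0.
have [g [nz_g gen_g ord_g]] := finField_generator.
rewrite /qchar (negPf nz_a); case: eqP => [ah|nah].
  have [z def_z] : exists z, a = z ^+ 2.
    have [i def_a] := gen_g a nz_a; move/eqP: ah; rewrite def_a -exprM ord_g.
    rewrite [in X in (X %| _)%N]card_predE -muln2 mulnC dvdn_pmul2r ?half_card_gt0 //.
    by case/dvdnP=> j ->; exists (g ^+ j); rewrite exprM.
  have nz_z : z != 0 by apply: contraNneq nz_a => z0; rewrite def_z z0 expr0n.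
  suff -> : [set z0 | z0 ^+ 2 == a] = [set z; - z].
    rewrite cards2 -addr_eq0 -mulr2n -[z *+ 2]mulr_natl mulf_eq0 (negPf K2) (negPf nz_z).
    by [].
  by apply/setP=> y; rewrite !inE def_z eqf_sqr.
rewrite subrr -[0]/0%:R; congr _%:R; apply/eqP; rewrite cards_eq0; apply/eqP/setP=> z.
rewrite !inE; apply/eqP=> def_a; apply: nah; rewrite -def_a -exprM mulnC exprM half_card_sqr //.
by apply: contraNneq nz_a => z0; rewrite -def_a z0 expr0n.
Qed.

Lemma exists_nonsquare : exists a, qchar a = -1.
Proof.
have [g [nz_g _ ord_g]] := finField_generator; exists g.
rewrite /qchar (negPf nz_g) ord_g gtnNdvd ?half_card_gt0 //.
by rewrite [X in (_ < X)%N]card_predE -addnn -addn1 leq_add2l half_card_gt0.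
Qed.

End QuadraticCharacter.

Section AdditiveCharacter.

Variable K : finFieldType.

(** A nontrivial irreducible character of the additive group, linear because the group is abelian.
    Translation by some [c] with [psi c != 1] multiplies its sum by [psi c], so the sum vanishes. *)
Lemma exists_additive_character : exists psi : K -> algC,
  [/\ psi 0 = 1, {morph psi : a b / a + b >-> a * b}
    & forall b, \sum_a psi (b * a) = if b == 0 then #|K|%:R else 0].
Proof.
have abG : abelian [set: K] by apply/centsP=> x _ y _; apply: addrC.
have [i nz_i] : exists i : Iirr [set: K], i != 0.
  have lt1 : (1 < Nirr [set: K])%N.
    by rewrite NirrE classes_gt1 finNzRing_nontrivial.
  by exists (Ordinal lt1).
have lin_i : 'chi_i \is a linear_char by apply/char_abelianP.
pose psi a := 'chi_i a.
have psiM : {morph psi : a b / a + b >-> a * b}.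
  by move=> a b; rewrite /psi -lin_charM ?inE.
have psi0 : psi 0 = 1 by apply: lin_char1.
exists psi; split=> // b; have [->|nz_b] := eqVneq b 0.
  under eq_bigr do rewrite mul0r psi0.
  by rewrite sumr_const.
rewrite -[LHS](reindex_inj (P := predT) (F := psi) (mulfI nz_b)).
have [c neq1] : exists c, psi c != 1.
  apply/existsP; apply: contraR nz_i => /existsPn all1; apply/eqP.
  apply: irr_inj; rewrite irr0; apply/cfunP=> x; rewrite cfun1E inE.
  by apply/eqP; move: (all1 x); rewrite negbK.
have: (psi c - 1) * (\sum_a psi a) = 0.
  rewrite mulrBl mul1r; apply/eqP; rewrite subr_eq0 mulr_sumr.
  rewrite [X in _ == X](reindex_inj (addrI c)); apply/eqP.
  by apply: eq_bigr => a _; rewrite psiM.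
by move/eqP; rewrite mulf_eq0 subr_eq0 (negPf neq1) => /eqP.
Qed.

End AdditiveCharacter.

Section FiniteFieldExtensions.

Variable K : finFieldType.

Lemma exists_splitting (f : {poly K}) : f != 0 ->
  exists (E : finFieldType) (iota : {rmorphism K -> E}) (s : seq E),
    map_poly iota f %= \prod_(x <- s) ('X - x%:P).
Proof.
move=> nz_f; have [L [rs def_f _]] := FinSplittingFieldFor nz_f.
by exists (FinFieldExtType L), (in_alg L), rs.
Qed.

(** The splitting field of X^(q^n) - X. The n-th power of Frobenius fixes the roots, which generate
    the field, so every element is a root; and the roots are distinct, as the derivative is -1. Each
    fact gives one inequality. *)
Lemma exists_ext_card n : (0 < n)%N ->
  exists (E : finFieldType) (iota : {rmorphism K -> E}), #|E| = (#|K| ^ n)%N.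
Proof.
move=> n_gt0; set q := #|K|; have q_gt1 : (1 < q)%N := finNzRing_gt1 K.
have qn_gt1 : (1 < q ^ n)%N by rewrite -(exp1n n) ltn_exp2r.
have nzf : 'X^(q ^ n) - 'X != 0 :> {poly K}.
  by rewrite -size_poly_gt0 size_polyDl size_polyXn // size_polyN size_polyX.
have [L [rs def_f gen_rs]] := FinSplittingFieldFor nzf.
exists (FinFieldExtType L), (in_alg L).
have [alpha _ def_alpha] := finField_galois_generator (sub1v {:L}%AS).
have alphaX m x : (alpha ^+ m)%g x = x ^+ (q ^ m).
  elim: m => [|m IHm]; first by rewrite gal_id.
  by rewrite expgSr galM ?memvf // IHm def_alpha ?memvf // dimv1 expn1 -exprM expnSr.
have fixL (x : L) : x ^+ (q ^ n) = x.
  have: x \in fixedField [set (alpha ^+ n)%g].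
    apply/subvP: (memvf x); rewrite -gen_rs; apply/Fadjoin_seqP; split; first exact: sub1v.
    move=> y rs_y; apply/fixedFieldP; rewrite ?memvf // => _ /set1P->.
    rewrite alphaX; apply/eqP; rewrite -subr_eq0.
    have: root (\prod_(z <- rs) ('X - z%:P)) y by rewrite root_prod_XsubC.
    rewrite -(eqp_root def_f) rmorphB rmorphXn /= map_polyX rootE.
    by rewrite hornerD hornerN hornerXn hornerX.
  by move/fixedFieldP => /(_ (memvf _)) /(_ _ (set11 _)); rewrite alphaX.
set E := FinFieldExtType L.
have size_f : size ('X^(q ^ n) - 'X : {poly E}) = (q ^ n).+1.
  by rewrite size_polyDl size_polyXn // size_polyN size_polyX.
apply/eqP; rewrite eqn_leq -ltnS -size_f; apply/andP; split.
  rewrite cardE max_poly_roots ?enum_uniq // -?size_poly_gt0 ?size_f //.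
  apply/allP=> x _; rewrite rootE hornerD hornerN hornerXn hornerX.
  by rewrite (fixL x) subrr.
have def_fE : ('X^(q ^ n) - 'X : {poly E}) %= \prod_(z <- rs) ('X - z%:P).
  apply: eqp_trans def_f; rewrite rmorphB rmorphXn /= map_polyX; exact: eqpxx.
have size_rs : size rs = (q ^ n)%N.
  by have := eqp_size def_fE; rewrite size_f size_prod_XsubC => -[].
have : separable_poly (\prod_(z <- rs) ('X - z%:P) : {poly E}).
  rewrite -(eqp_separable def_fE) separable_poly.unlock derivB derivXn derivX.
  have qE : (q%:R : E) = 0.
    have [p pr_p pK] := finPcharP K.
    have pE : p \in [pchar E] by rewrite (fmorph_pchar (in_alg L : {rmorphism K -> E})).
    move: q_gt1; rewrite /q (card_pprimeChar pK) natrX (pcharf0 pE) expr0n.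
    by case: (logn _ _).
  rewrite -mulr_natl natrX -polyC_natr qE -rmorphXn /= expr0n gtn_eqF // mul0r sub0r.
  by apply/Bezout_eq1_coprimepP; exists (0, -1); rewrite mul0r add0r mulrNN mul1r.
rewrite separable_prod_XsubC => uniq_rs.
by rewrite -size_rs -(@card_uniqP E _ uniq_rs) max_card.
Qed.

End FiniteFieldExtensions.

Section Conjugates.

Variables (K E : finFieldType) (iota : {rmorphism K -> E}).

(* [iota] is an argument since it makes the map additive. *)
Definition frobq of {rmorphism K -> E} := fun y : E => y ^+ #|K|.

Lemma frobq_zmod : zmod_morphism (frobq iota).
Proof.
have [p pr_p pK] := finPcharP K.
have pE : p \in [pchar E] by rewrite (fmorph_pchar iota).
have qp : [pchar E].-nat #|K|.
  by rewrite (card_pprimeChar pK) (eq_pnat _ (pcharf_eq pE)) pnatX pnat_id.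
by move=> x y; rewrite /frobq exprDn_pchar // exprNn_pchar.
Qed.

Lemma frobq_monoid : monoid_morphism (frobq iota).
Proof. by split=> [|x y]; rewrite /frobq ?expr1n ?exprMn. Qed.

HB.instance Definition _ :=
  GRing.isZmodMorphism.Build E E (frobq iota) frobq_zmod.
HB.instance Definition _ :=
  GRing.isMonoidMorphism.Build E E (frobq iota) frobq_monoid.

Local Notation phi := (frobq iota).

Lemma iter_frobq n y : iter n phi y = y ^+ (#|K| ^ n).
Proof. by elim: n => //= n ->; rewrite /frobq -exprM expnSr. Qed.

Lemma frobq_iota a : phi (iota a) = iota a.
Proof. by rewrite /frobq -rmorphXn /= expf_card. Qed.

Lemma frobq_fix y : phi y = y -> exists a, y = iota a.
Proof.
move=> fix_y; have: root (map_poly iota ('X^#|K| - 'X)) y.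
  rewrite rmorphB /= map_polyXn map_polyX rootE !hornerE.
  by rewrite -[y ^+ _]/(phi y) fix_y subrr.
rewrite finField_genPoly rmorph_prod /=.
under eq_bigr do rewrite rmorphB /= map_polyX map_polyC /=.
rewrite -(big_map iota predT (fun z => 'X - z%:P)) root_prod_XsubC.
by case/mapP=> a _ ->; exists a.
Qed.

Lemma frobq_fix_poly (g : {poly E}) :
  map_poly phi g = g -> exists h, g = map_poly iota h.
Proof.
move=> fix_g; have /choice[h def_h] (i : nat) : exists a, g`_i = iota a.
  by apply: frobq_fix; rewrite -[in RHS]fix_g coef_map.
exists (\poly_(i < size g) h i); apply/polyP=> i; rewrite coef_map coef_poly.
case: ltnP => [_|le_i] /=; first exact: def_h.
by rewrite rmorph0 nth_default.
Qed.

Lemma horner_frobX (f : {poly K}) x i :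
  (map_poly iota f).[x] ^+ (#|K| ^ i) = (map_poly iota f).[x ^+ (#|K| ^ i)].
Proof.
elim: i => [|i IHi]; first by rewrite !expr1.
rewrite expnSr !exprM IHi -![_ ^+ #|K|]/(phi _) -horner_map -map_poly_comp.
by congr (_.[_]); apply: eq_map_poly => a /=; rewrite frobq_iota.
Qed.

(** The product of the X - y over the Frobenius orbit of [x] has fixed coefficients, so it comes
    from [K]. It divides the irreducible [P], hence equals it, and the orbit has length [r]. *)
Lemma irr_conj (P : {poly K}) (x : E) (r : nat) :
  P \is monic -> irreducible_poly P -> size P = r.+1 -> root (map_poly iota P) x ->
  [/\ map_poly iota P = \prod_(i < r) ('X - (x ^+ (#|K| ^ i))%:P),
      injective (fun i : 'I_r => x ^+ (#|K| ^ i)),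
      x ^+ (#|K| ^ r) = x
    & forall n, x ^+ (#|K| ^ n) = x -> (r %| n)%N].
Proof.
move=> Pm irrP sP rootPx.
have phi_inj : injective phi by apply: fmorph_inj.
have phi_root (y : E) : root (map_poly iota P) y -> root (map_poly iota P) (phi y).
  rewrite !rootE => /eqP Py0.
  have -> : map_poly iota P = map_poly phi (map_poly iota P).
    by rewrite -map_poly_comp; apply: eq_map_poly => a /=; rewrite frobq_iota.
  by rewrite horner_map Py0 rmorph0.
set s := orbit phi x; set Q := \prod_(y <- s) ('X - y%:P).
have [g def_Q] : exists g, Q = map_poly iota g.
  apply: frobq_fix_poly; rewrite rmorph_prod /=.
  under eq_bigr do rewrite rmorphB /= map_polyX map_polyC /=.
  rewrite -(big_map phi predT (fun z => 'X - z%:P)); apply: perm_big.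
  have uniq_ps : uniq (map phi s) by rewrite map_inj_uniq ?orbit_uniq.
  have sub_ps : {subset map phi s <= s} by move=> _ /mapP[z s_z ->]; apply: mem_orbit.
  have [|_ eq_s] := uniq_min_size uniq_ps sub_ps; first by rewrite size_map.
  by apply: uniq_perm; rewrite ?orbit_uniq.
have rootQx : root Q x by rewrite root_prod_XsubC in_orbit.
have gm : g \is monic by rewrite -(map_monic iota) -def_Q monic_prod_XsubC.
have Qd : Q %| map_poly iota P.
  have rootP_iter n : root (map_poly iota P) (iter n phi x).
    by elim: n => //= n; apply: phi_root.
  apply: uniq_roots_dvdp; last by rewrite uniq_rootsE orbit_uniq.
  by apply/allP=> y; rewrite -fconnect_orbit => /iter_findex <-.
have def_P : g = P.
  have gP : g %| P by rewrite -(dvdp_map iota) -def_Q.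
  apply/eqP; rewrite -eqp_monic //; apply: irrP => //.
  rewrite -(size_map_poly iota) -def_Q size_prod_XsubC eqSS.
  by rewrite size_orbit -lt0n fingraph.order_gt0.
have {}def_Q : map_poly iota P = Q by rewrite def_Q def_P.
have ord_x : fingraph.order phi x = r.
  have := congr1 (size \o polyseq) def_Q; rewrite /= size_map_poly sP.
  by rewrite size_prod_XsubC size_orbit => -[->].
have r_gt0 : (0 < r)%N by rewrite -ord_x fingraph.order_gt0.
have nth_s i : (i < r)%N -> nth x s i = x ^+ (#|K| ^ i).
  by move=> lt_ir; rewrite /s /orbit ord_x nth_traject // iter_frobq.
have sz_s : size s = r by rewrite size_orbit.
have injx : injective (fun i : 'I_r => x ^+ (#|K| ^ i)).
  move=> i j /=; rewrite -!nth_s // => /eqP.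
  by rewrite nth_uniq ?orbit_uniq ?sz_s // => /eqP /val_inj.
have xr : x ^+ (#|K| ^ r) = x by rewrite -iter_frobq -ord_x iter_order.
split=> //.
  rewrite def_Q /Q (big_nth x) sz_s big_mkord.
  by apply: eq_bigr => i _; rewrite nth_s.
move=> n xn; have xmul m : x ^+ (#|K| ^ (m * r)) = x.
  elim: m => [|m IHm]; first by rewrite mul0n.
  by rewrite mulSn expnD exprM xr.
move: xn; rewrite {1}(divn_eq n r) expnD exprM xmul => xn.
have := @injx (Ordinal (ltn_pmod n r_gt0)) (Ordinal r_gt0).
by rewrite /= xn expr1 => /(_ erefl) [] /eqP.
Qed.

End Conjugates.

(** * The quadratic symbol and point counts *)

Lemma root_dvdp (F : fieldType) (p q : {poly F}) x :
  p %| q -> root p x -> root q x.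
Proof. by rewrite -!dvdp_XsubCl => pq xp; apply: dvdp_trans xp pq. Qed.

Lemma dvdp_prod_XsubC_root (F : fieldType) (p : {poly F}) (s : seq F) :
  p %| \prod_(x <- s) ('X - x%:P) -> (1 < size p)%N ->
  exists2 x, x \in s & root p x.
Proof.
move=> /dvdp_prod_XsubC[m def_p] sp; case def_m: (mask m s) def_p => [|x t] def_p.
  by move: sp; rewrite (eqp_size def_p) big_nil size_poly1.
exists x; first by rewrite (mem_mask (m := m)) // def_m mem_head.
by rewrite (eqp_root def_p) root_prod_XsubC mem_head.
Qed.

(** * Norms modulo a squarefree polynomial *)

Section PolyNorm.

Variable K : finFieldType.

(* The norm of [h] from [K[X] / (f)] to [K]. *)
Definition pnorm (f h : {poly K}) : K :=
  \det (\matrix_(i < (size f).-1, j < (size f).-1) (('X^i * h) %% f)`_j).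

(** At distinct roots the Vandermonde matrix is invertible and diagonalises the multiplication by
    [h], with the values of [h] as eigenvalues. *)
Lemma pnorm_roots (E : finFieldType) (iota : {rmorphism K -> E}) (s : seq E)
    (f h : {poly K}) :
  uniq s -> map_poly iota f = \prod_(x <- s) ('X - x%:P) ->
  iota (pnorm f h) = \prod_(x <- s) (map_poly iota h).[x].
Proof.
move=> uniq_s def_f; have sf : size f = (size s).+1.
  by rewrite -(size_map_poly iota) def_f size_prod_XsubC.
rewrite /pnorm sf /= -det_map_mx.
set M := map_mx _ _; pose V := Vandermonde (size s) (\row_(j < size s) s`_j).
have V0 : \det V != 0.
  rewrite det_Vandermonde; apply/prodf_neq0 => i _; apply/prodf_neq0 => j lt_ij.
  by rewrite !mxE subr_eq0 nth_uniq // gtn_eqF.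
have MV : M *m V = V *m diag_mx (\row_(j < size s) (map_poly iota h).[s`_j]).
  apply/matrixP=> i j; rewrite mul_mx_diag !mxE.
  have rj : root (map_poly iota f) s`_j by rewrite def_f root_prod_XsubC mem_nth.
  transitivity (map_poly iota ('X^i * h %% f)).[s`_j].
    rewrite (@horner_coef_wide _ (size s)).
      by apply: eq_bigr => k _; rewrite !mxE coef_map.
    by rewrite size_map_poly -ltnS -sf ltn_modp -size_poly_gt0 sf.
  rewrite map_modp; have := divp_eq (map_poly iota ('X^i * h)) (map_poly iota f).
  move/(congr1 (fun p => p.[s`_j])); rewrite hornerD hornerM (eqP rj) mulr0 add0r.
  by move <-; rewrite rmorphM /= map_polyXn hornerM hornerXn.
have := congr1 determinant MV; rewrite !det_mulmx det_diag mulrC.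
move/(mulfI V0) ->; rewrite (big_nth 0) big_mkord.
by apply: eq_bigr => j _; rewrite mxE.
Qed.

Lemma squarefree_splitting (f : {poly K}) : f \is monic -> coprimep f f^`() ->
  exists (E : finFieldType) (iota : {rmorphism K -> E}) (s : seq E),
    uniq s /\ map_poly iota f = \prod_(x <- s) ('X - x%:P).
Proof.
move=> fm sepf; have [E [iota [s def_f]]] := exists_splitting (monic_neq0 fm).
have {}def_f : map_poly iota f = \prod_(x <- s) ('X - x%:P).
  by apply/eqP; rewrite -eqp_monic ?map_monic ?monic_prod_XsubC.
exists E, iota, s; split=> //; rewrite -separable_prod_XsubC -def_f.
by rewrite separable_poly.unlock deriv_map coprimep_map.
Qed.

End PolyNorm.

Section SquarefreeNorm.

Variables (K : finFieldType) (f : {poly K}).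
Hypotheses (fm : f \is monic) (sepf : coprimep f f^`()).

Lemma pnormM h1 h2 : pnorm f (h1 * h2) = pnorm f h1 * pnorm f h2.
Proof.
have [E [iota [s [uniq_s def_f]]]] := squarefree_splitting fm sepf.
apply: (fmorph_inj iota); rewrite rmorphM /= !(pnorm_roots _ uniq_s def_f).
by rewrite -big_split; apply: eq_bigr => x _; rewrite rmorphM hornerM.
Qed.

Lemma pnormC c : pnorm f c%:P = c ^+ (size f).-1.
Proof.
have [E [iota [s [uniq_s def_f]]]] := squarefree_splitting fm sepf.
apply: (fmorph_inj iota); rewrite rmorphXn /= (pnorm_roots _ uniq_s def_f).
under eq_bigr do rewrite map_polyC hornerC.
rewrite big_const_seq count_predT iter_mulr_1 -(size_map_poly iota) def_f.
by rewrite size_prod_XsubC.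
Qed.

Lemma pnorm_mod h1 h2 : f %| h1 - h2 -> pnorm f h1 = pnorm f h2.
Proof.
have [E [iota [s [uniq_s def_f]]]] := squarefree_splitting fm sepf.
move=> dvf; apply: (fmorph_inj iota); rewrite !(pnorm_roots _ uniq_s def_f).
apply: eq_big_seq => x s_x; apply/eqP; rewrite -subr_eq0 -hornerN -hornerD -rmorphB.
have : map_poly iota f %| map_poly iota (h1 - h2) by rewrite dvdp_map.
by move/root_dvdp; apply; rewrite def_f root_prod_XsubC.
Qed.

Lemma pnorm_common_factor (P h : {poly K}) :
  (1 < size P)%N -> P %| f -> P %| h -> pnorm f h = 0.
Proof.
move=> sP Pf Ph.
have [E [iota [s [uniq_s def_f]]]] := squarefree_splitting fm sepf.
apply: (fmorph_inj iota); rewrite (pnorm_roots _ uniq_s def_f) rmorph0.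
have [||x s_x rPx] := @dvdp_prod_XsubC_root _ (map_poly iota P) s.
- by rewrite -def_f dvdp_map.
- by rewrite size_map_poly.
have : root (map_poly iota h) x.
  by apply: root_dvdp rPx; rewrite dvdp_map.
by rewrite rootE => /eqP hx0; rewrite (big_rem x s_x) /= hx0 mul0r.
Qed.

(** Reciprocity of resultants: both sides are the product of all differences between a root of [P]
    and a root of [f], and the sign reverses each of them. The roots of [P] are the conjugates of
    [x]. *)
Lemma pnorm_irr (E : finFieldType) (iota : {rmorphism K -> E}) (x : E)
    (P : {poly K}) (r : nat) :
  P \is monic -> irreducible_poly P -> size P = r.+1 ->
  root (map_poly iota P) x ->
  iota ((-1) ^+ ((size f).-1 * r) * pnorm f P) =
    \prod_(i < r) (map_poly iota f).[x] ^+ (#|K| ^ i).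
Proof.
move=> Pm irrP sP rootPx; have [def_P injx xr _] := irr_conj Pm irrP sP rootPx.
have [||L [jota [s [uniq_s def_f]]]] := @squarefree_splitting E (map_poly iota f).
- by rewrite map_monic.
- by rewrite deriv_map coprimep_map.
have def_fL : map_poly (jota \o iota) f = \prod_(y <- s) ('X - y%:P).
  by rewrite map_poly_comp.
have sf : (size f).-1 = size s.
  by rewrite -(size_map_poly (jota \o iota)) def_fL size_prod_XsubC.
pose q := #|K|.
apply: (fmorph_inj jota); rewrite rmorphM rmorphXn rmorphN1 /=.
rewrite rmorphM rmorphXn rmorphN1 /= -[X in _ * X]/((jota \o iota) _).
rewrite (pnorm_roots _ uniq_s def_fL) map_poly_comp /= def_P rmorph_prod /=.
transitivity (\prod_(i < r) \prod_(y <- s) (jota (x ^+ (q ^ i)) - y)); last first.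
  rewrite rmorph_prod; apply: eq_bigr => i _; rewrite horner_frobX -horner_map def_f.
  by rewrite horner_prod; apply: eq_bigr => y _; rewrite hornerXsubC.
have toI (G : L -> L) : \prod_(y <- s) G y = \prod_(j < size s) G s`_j.
  by rewrite (big_nth 0) big_mkord.
rewrite exchange_big /= !toI sf exprM.
have -> : ((-1) ^+ size s) ^+ r = \prod_(j < size s) ((-1) ^+ r : L).
  by rewrite prodr_const card_ord exprAC.
rewrite -big_split; apply: eq_bigr => j _ /=.
rewrite horner_prod -{1}(card_ord r) -prodr_const -big_split /=.
by apply: eq_bigr => i _; rewrite rmorphB /= map_polyX map_polyC /= hornerXsubC mulN1r opprB.
Qed.

End SquarefreeNorm.

(** For m = q this says that the quadratic character of the extension of degree [j] is that of the
    base field composed with the norm. *)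
Lemma half_predX m j : odd m ->
  ((m ^ j).-1./2 = m.-1./2 * \sum_(i < j) m ^ i)%N.
Proof.
rewrite predn_exp; case: m => //= m /even_halfK {1}<-.
by rewrite -doubleMl doubleK.
Qed.

Section PointCount.

Variables (K E : finFieldType) (iota : {rmorphism K -> E}).

Lemma irr_root_eq (P Q : {poly K}) (x : E) :
  P \is monic -> Q \is monic -> irreducible_poly P -> irreducible_poly Q ->
  root (map_poly iota P) x -> root (map_poly iota Q) x -> P = Q.
Proof.
move=> Pm Qm irrP irrQ rPx rQx; apply: irr_monic_eq => //.
apply: contraLR rQx; rewrite -irreducible_poly_coprime // -(coprimep_map iota).
by move/coprimep_root/(_ rPx); rewrite rootE.
Qed.

Lemma exists_minpoly (h : {poly K}) (x : E) :
  h != 0 -> root (map_poly iota h) x ->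
  exists P : {poly K}, [/\ P \is monic, irreducible_poly P & root (map_poly iota P) x].
Proof.
have [m] := ubnP (size h); elim: m h => // m IHm h; rewrite ltnS => le_hm nz_h rhx.
have [|P Pm [irrP Ph]] := @irr_factor _ h.
  rewrite ltnNge; apply/negP => /size1_polyC def_h; move: nz_h rhx.
  by rewrite def_h map_polyC rootC !fmorph_eq0 => /negPf ->.
have [|nPx] := boolP (root (map_poly iota P) x); first by exists P.
have [k def_h] : exists k : {poly K}, h = P * k.
  by have [k ->] := dvdpP _ _ Ph; exists k; rewrite mulrC.
move: nz_h rhx le_hm; rewrite def_h rmorphM rootM (negPf nPx) /= => nz_Pk rkx.
have nz_k : k != 0 by apply: contraNneq nz_Pk => ->; rewrite mulr0.
rewrite size_mul ?(monic_neq0 Pm) // => le_m; apply: (IHm k) => //.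
apply: leq_trans le_m; case: irrP => + _; case: (size P) => [|[|s]] // _.
by rewrite !addSn /= ltnS leq_addl.
Qed.

End PointCount.

Section CharacterSum.

Variables (K : finFieldType) (f : {poly K}).
Hypotheses (K2 : (2%:R : K) != 0) (fm : f \is monic) (sepf : coprimep f f^`()).

(* The Jacobi symbol [(f / h)] for monic [h]: the sign turns the norm of [h]
   modulo [f] into the product of the values of [f] at the roots of [h]. *)
Definition fchar (h : {poly K}) : int :=
  qchar ((-1) ^+ ((size f).-1 * (size h).-1) * pnorm f h).

Lemma fchar1 : fchar 1 = 1.
Proof.
by rewrite /fchar size_poly1 muln0 mul1r -polyC1 pnormC // expr1n qchar1.
Qed.

Lemma fcharM g h : g \is monic -> h \is monic ->
  fchar (g * h) = fchar g * fchar h.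
Proof.
move=> gm hm; rewrite /fchar -qcharM // pnormM // mulrACA -exprD -mulnDr.
congr (qchar (_ ^+ (_ * _) * _)).
rewrite size_Mmonic ?monic_neq0 //.
have : (0 < size g)%N /\ (0 < size h)%N by rewrite !size_poly_gt0 !monic_neq0.
by lia.
Qed.

Variables (E : finFieldType) (iota : {rmorphism K -> E}) (n : nat).
Hypothesis cardE : #|E| = (#|K| ^ n)%N.

Let q := #|K|.
Let n_gt0 : (0 < n)%N.
Proof. by move: (finNzRing_gt1 E); rewrite cardE; case: (n). Qed.
Let E2 : (2%:R : E) != 0.
Proof. by rewrite -(rmorph_nat iota) fmorph_eq0. Qed.

Lemma expqn (x : E) : x ^+ (q ^ n) = x.
Proof. by rewrite /q -cardE expf_card. Qed.

(** A root of [P] in any extension satisfies x^(q^n) = x because r divides n. So the irreducible [P]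
    divides X^(q^n) - X, which splits over [E]. *)
Lemma irr_has_root (P : {poly K}) r : P \is monic -> irreducible_poly P ->
  size P = r.+1 -> (r %| n)%N -> exists x, root (map_poly iota P) x.
Proof.
move=> Pm irrP sP /dvdnP[m def_n].
have [L [jota [s def_s]]] := exists_splitting (monic_neq0 Pm).
have sP1 : (1 < size P)%N by case: irrP.
have [||x s_x rPx] := @dvdp_prod_XsubC_root _ (map_poly jota P) s.
- by case/andP: def_s.
- by rewrite size_map_poly.
have [_ _ xr _] := irr_conj Pm irrP sP rPx.
have xn : x ^+ (q ^ n) = x.
  by rewrite def_n; elim: (m) => [//|k IHk]; rewrite mulSn expnD exprM xr.
have PX : P %| 'X^(q ^ n) - 'X.
  rewrite -[P %| _]negbK -irreducible_poly_coprime // -(coprimep_map jota).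
  apply/negP => /coprimep_root/(_ rPx)/negP; apply.
  by rewrite rmorphB /= map_polyXn map_polyX !hornerE xn subrr.
have [||y _ rPy] := @dvdp_prod_XsubC_root _ (map_poly iota P) (index_enum E).
- rewrite -finField_genPoly cardE.
  by move: PX; rewrite -(dvdp_map iota) rmorphB /= map_polyXn map_polyX.
- by rewrite size_map_poly.
by exists y.
Qed.

Lemma qchar_root (P : {poly K}) r (x : E) : P \is monic -> irreducible_poly P ->
  size P = r.+1 -> (r %| n)%N -> root (map_poly iota P) x ->
  qchar (map_poly iota f).[x] = fchar P ^+ (n %/ r).
Proof.
move=> Pm irrP sP r_n rPx; set a := (map_poly iota f).[x].
have [_ _ xr _] := irr_conj Pm irrP sP rPx.
have ar : a ^+ (q ^ r) = a by rewrite horner_frobX xr.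
have q_gt0 : (0 < q)%N by rewrite ltnW ?finNzRing_gt1.
have r_gt0 : (0 < r)%N by rewrite -ltnS -sP; case: irrP.
have odd_q : odd q by apply: odd_card.
have odd_qr : odd (q ^ r) by rewrite oddX odd_q orbT.
(* [a] lies in the field of q^r elements and [b] is its quadratic symbol there, which is [fchar P]
   by reciprocity. The symbol of [a] in [E] is then a product of n / r copies of [b]. *)
pose b := a ^+ (q ^ r).-1./2.
have bE j : b ^+ ((q ^ r) ^ j) = b.
  elim: j => [|j IHj]; first by rewrite expn0.
  by rewrite expnSr exprM IHj /b exprAC ar.
have def_b : b = (fchar P)%:~R.
  rewrite -(rmorph_int iota) qcharE // rmorphXn /= sP.
  rewrite (pnorm_irr fm sepf Pm irrP sP rPx) -expr_sum -exprM mulnC.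
  by rewrite -half_predX.
apply: (qchar_inj E2); rewrite ?qchar_dom //.
  by rewrite /fchar -qcharX ?qchar_dom.
rewrite qcharE // rmorphXn /= -def_b cardE -(divnK r_n) mulnC expnM half_predX //.
rewrite exprM -/b expr_sum mulKn //.
by under eq_bigr do rewrite bE; rewrite prodr_const card_ord.
Qed.

(** The elements of [E] are sorted by their minimal polynomial over [K]: an irreducible polynomial
    of degree r dividing n has r roots in [E], each contributing its [fchar] to the power n / r. *)
Lemma psum_points :
  \sum_(x : E) qchar (map_poly iota f).[x] = wpsum fchar n.
Proof.
pose T (P : {poly K}) (x : E) := root (map_poly iota P) x.
transitivity (\sum_(x : E) \sum_(1 <= r < n.+1) \sum_(v : 'rV[K]_r | irrp v)
    (if T (monicp v) x then qchar (map_poly iota f).[x] else 0)).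
  apply: eq_bigr => x _.
  have [P [Pm irrP rPx]] : exists P : {poly K},
      [/\ P \is monic, irreducible_poly P & T P x].
    apply: (@exists_minpoly _ _ _ ('X^(q ^ n) - 'X)).
      rewrite -size_poly_gt0 size_polyDl size_polyXn // size_polyN size_polyX ltnS.
      by rewrite /q -cardE finNzRing_gt1.
    by rewrite rmorphB /= map_polyXn map_polyX rootE !hornerE expqn subrr.
  have [r sP] : exists r, size P = r.+1.
    by case: irrP; case: (size P) => // r; exists r.
  have r_gt0 : (0 < r)%N by rewrite -ltnS -sP; case: irrP.
  have [_ _ _ /(_ n (expqn x)) r_n] := irr_conj Pm irrP sP rPx.
  have le_rn := dvdn_leq n_gt0 r_n.
  have def_P : monicp (monic_rV r P) = P by rewrite monic_rVK.
  rewrite (bigD1_seq r) ?mem_index_iota ?iota_uniq ?r_gt0 //=.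
  rewrite (bigD1 (monic_rV r P)) /=; last by apply/irreducibleP; rewrite def_P.
  rewrite def_P rPx !big1 ?addr0 //.
  - move=> r' ne_r; apply: big1 => v /irreducibleP irrv; case: ifP => // rvx.
    have eqP := irr_root_eq Pm (monicp_monic v) irrP irrv rPx rvx.
    by move: sP ne_r; rewrite eqP size_monicp => -[->]; rewrite eqxx.
  - move=> v /andP[/irreducibleP irrv ne_v]; case: ifP => // rvx.
    have eqP := irr_root_eq Pm (monicp_monic v) irrP irrv rPx rvx.
    by rewrite eqP monicpK eqxx in ne_v.
rewrite exchange_big /wpsum /= [RHS]big_mkcond; apply: eq_big_nat => r /andP[r_gt0 _].
rewrite exchange_big /=.
case: ifPn => r_n; last first.
  apply: big1 => v /irreducibleP irrv; apply: big1 => x _; case: ifP => // rvx.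
  have [_ _ _ /(_ n (expqn x))] := irr_conj (monicp_monic v) irrv (size_monicp v) rvx.
  by rewrite (negPf r_n).
apply: eq_bigr => v /irreducibleP irrv.
have vm := monicp_monic v; have sv := size_monicp v.
have [x rvx] := irr_has_root vm irrv sv r_n.
have [def_v injx _ _] := irr_conj vm irrv sv rvx.
rewrite -big_mkcond (eq_bigr (fun=> fchar (monicp v) ^+ (n %/ r))) /=; last first.
  by move=> y rvy; apply: qchar_root vm irrv sv r_n rvy.
have card_r : #|[pred y | T (monicp v) y]| = r.
  rewrite -[RHS]card_ord -(card_imset _ injx); apply: eq_card => y.
  rewrite inE /T def_v -(big_map (fun i : 'I_r => x ^+ (#|K| ^ i)) predT
    (fun z => 'X - z%:P)) root_prod_XsubC.
  by apply/mapP/imsetP => -[i _ ->]; exists i; rewrite // mem_index_enum.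
by rewrite sumr_const mulr_natl; congr (_ *+ _); exact: card_r.
Qed.

End CharacterSum.

(** * The quadratic symbol as a primitive character modulo f *)

Section JacobiCharacter.

Variables (K : finFieldType) (f : {poly K}) (d : nat).
Hypotheses (K2 : (2%:R : K) != 0) (fm : f \is monic) (sepf : coprimep f f^`()).
Hypothesis sf : size f = d.+1.

Local Notation q := #|K|.

(** [fchar] without the sign that depends on the degree: this is the factor that is periodic modulo
    [f]. *)
Definition chi (h : {poly K}) : int := qchar (pnorm f h).

Lemma chiM g h : chi (g * h) = chi g * chi h.
Proof. by rewrite /chi pnormM // qcharM. Qed.

Lemma chiC c : chi c%:P = qchar c ^+ d.
Proof. by rewrite /chi pnormC // qcharX // sf. Qed.

Lemma chi1 : chi 1 = 1.
Proof. by rewrite -polyC1 chiC qchar1 expr1n. Qed.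

Lemma chi_mod g h : f %| g - h -> chi g = chi h.
Proof. by move=> fgh; rewrite /chi (pnorm_mod fm sepf fgh). Qed.

Lemma coprimep_or_factor h : coprimep f h \/
  exists P : {poly K}, [/\ P \is monic, irreducible_poly P, P %| f & P %| h].
Proof.
have [cop|ncop] := boolP (coprimep f h); [by left | right].
have [|P Pm [irrP Pg]] := @irr_factor _ (gcdp f h).
  rewrite ltn_neqAle eq_sym size_poly_gt0 gcdp_eq0 negb_and (monic_neq0 fm).
  by rewrite andbT; move: ncop; rewrite coprimep_def.
exists P; split=> //; first exact: dvdp_trans Pg (dvdp_gcdl _ _).
exact: dvdp_trans Pg (dvdp_gcdr _ _).
Qed.

Lemma exists_inverse_mod c : coprimep f c -> exists c', f %| c * c' - 1.
Proof.
move=> /Bezout_eq1_coprimepP[[u v] /= e]; exists v.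
by rewrite -e mulrC opprD addrA addrAC subrr add0r -mulNr dvdp_mull.
Qed.

Lemma sum_residues_mul c (R : nzRingType) (F : {poly K} -> R) : coprimep f c ->
  \sum_(b : 'rV[K]_d) F (rVpoly b) =
  \sum_(b : 'rV[K]_d) F ((c * rVpoly b) %% f).
Proof.
move=> cop_fc; have szm (h : {poly K}) : (size (h %% f)%R <= d)%N.
  by rewrite -ltnS -sf ltn_modp monic_neq0.
rewrite (reindex_inj (h := fun b => poly_rV ((c * rVpoly b) %% f))) /=.
  by apply: eq_bigr => b _; rewrite poly_rV_K.
move=> b1 b2 /(congr1 rVpoly); rewrite !poly_rV_K // => /eqP.
rewrite -subr_eq0 -modpN -modpD -mulrBr => /eqP/modp_eq0P.
rewrite Gauss_dvdpr // -linearB => fb; apply/eqP; rewrite -subr_eq0.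
rewrite -(can_eq (@rVpolyK _ _)) linear0; apply: contraTT fb => nz_b.
by apply/negP => /(dvdp_leq nz_b); rewrite sf ltnNge size_rVpoly.
Qed.

(** Primitivity of [chi]: it is not induced from the modulus f / P. This is what makes the Gauss sum
    vanish at the multiples of [P]. *)
Lemma irr_nonresidue (P : {poly K}) : P \is monic -> irreducible_poly P ->
  P %| f -> exists c : {poly K}, chi c = -1 /\ f %/ P %| c - 1.
Proof.
move=> Pm irrP Pf; set W := f %/ P; have def_f : f = P * W by rewrite mulrC divpK.
have [r sP] : exists r, size P = r.+1.
  by case: irrP; case: (size P) => // r; exists r.
have r_gt0 : (0 < r)%N by rewrite -ltnS -sP; case: irrP.
have cop_PW : coprimep P W.
  rewrite irreducible_poly_coprime //; apply: contraTN sepf => PW.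
  have P2f : P %| f^`() by rewrite def_f derivM dvdp_add ?dvdp_mulIl // dvdp_mull.
  apply/negP => /coprimepP/(_ P Pf P2f); rewrite -size_poly_eq1.
  by case: irrP => /gtn_eqF ->.
have [E [iota cardE]] := exists_ext_card K r_gt0.
have [x rPx] := irr_has_root iota cardE Pm irrP sP (dvdnn r).
have [def_P injx xr _] := irr_conj Pm irrP sP rPx.
have conjP i : root (map_poly iota P) (x ^+ (q ^ i)).
  have q_gt0 : (0 < q)%N by rewrite ltnW ?finNzRing_gt1.
  by rewrite rootE -horner_frobX (eqP rPx) expr0n expn_eq0 (gtn_eqF q_gt0).
have E2 : (2%:R : E) != 0 by rewrite -(rmorph_nat iota) fmorph_eq0.
have [eps qeps] := exists_nonsquare E2.
have [e def_eps] : exists e : {poly K}, (map_poly iota e).[x] = eps.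
  pose ev (v : 'rV[K]_r) := (map_poly iota (rVpoly v)).[x].
  have inj_ev : injective ev.
    move=> u v /eqP; rewrite -subr_eq0 -hornerN -hornerD -rmorphB -linearB /= => uv.
    apply/eqP; rewrite -subr_eq0 -(can_eq (@rVpolyK _ _)) linear0.
    apply: contraTT uv => nz_uv.
    apply: (coprimep_root _ rPx); rewrite coprimep_map irreducible_poly_coprime //.
    by apply/negP => /(dvdp_leq nz_uv); rewrite sP ltnNge size_rVpoly.
  have : eps \in codom ev.
    by rewrite inj_card_onto //= cardE card_mx mul1n.
  by case/codomP => v ->; exists (rVpoly v).
have [[u v] /= uv1] := Bezout_eq1_coprimepP _ _ cop_PW.
(* By the Chinese remainder theorem [c] is [e] modulo [P] and 1 modulo [W]. Only the roots of [P]
   count in its norm, and they give the norm of the nonsquare [eps]. *)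
pose c := e * (v * W) + u * P.
have cW : W %| c - 1.
  have -> : c - 1 = (e * v - v) * W by rewrite -uv1 /c; ring.
  by rewrite dvdp_mulIr.
have cP (y : E) : root (map_poly iota P) y ->
    (map_poly iota c).[y] = (map_poly iota e).[y].
  move/eqP=> Py0; have := congr1 (fun h => (map_poly iota h).[y]) uv1.
  rewrite /c !(rmorphM, rmorphD, rmorph1) /= !(hornerM, hornerD, hornerC) Py0.
  by rewrite !mulr0 add0r addr0 => ->; rewrite mulr1.
exists c; split=> //.
have [||L [jota [s [uniq_s def_s]]]] := @squarefree_splitting E (map_poly iota f).
- by rewrite map_monic.
- by rewrite deriv_map coprimep_map.
have def_fL : map_poly (jota \o iota) f = \prod_(y <- s) ('X - y%:P).
  by rewrite map_poly_comp.
have Nc : iota (pnorm f c) = eps ^+ (\sum_(i < r) q ^ i).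
  apply: (fmorph_inj jota); rewrite -[LHS]/((jota \o iota) _).
  rewrite (pnorm_roots _ uniq_s def_fL) (bigID (root (map_poly (jota \o iota) P))) /=.
  rewrite [X in _ * X]big1_seq ?mulr1 => [|y /andP[nPy s_y]]; last first.
    have : root (map_poly (jota \o iota) f) y by rewrite def_fL root_prod_XsubC.
    rewrite {1}def_f rmorphM rootM (negPf nPy) /= => rWy.
    have : root (map_poly (jota \o iota) (c - 1)) y.
      by apply: root_dvdp rWy; rewrite dvdp_map.
    by rewrite rmorphB rmorph1 /= rootE !hornerE subr_eq0 => /eqP.
  transitivity (\prod_(y <- [seq jota (x ^+ (q ^ (i : 'I_r))) | i : 'I_r <- index_enum 'I_r])
     (map_poly (jota \o iota) c).[y]).
    rewrite -big_filter; apply: perm_big; apply: uniq_perm; first exact: filter_uniq.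
      rewrite map_inj_uniq ?index_enum_uniq // => i j /fmorph_inj /injx //.
    move=> y; rewrite mem_filter.
    have -> : root (map_poly (jota \o iota) P) y =
        (y \in [seq jota (x ^+ (q ^ (i : 'I_r))) | i : 'I_r <- index_enum 'I_r]).
      rewrite map_poly_comp def_P rmorph_prod /= -root_prod_XsubC big_map.
      by under eq_bigr do rewrite rmorphB /= map_polyX map_polyC /=.
    apply: andb_idr => /mapP[i _ ->].
    rewrite -root_prod_XsubC -def_s rootE horner_map fmorph_eq0.
    by apply: root_dvdp (conjP i); rewrite dvdp_map.
  rewrite big_map expr_sum rmorph_prod; apply: eq_bigr => i _.
  rewrite map_poly_comp horner_map cP //.
  by rewrite -horner_frobX def_eps.
rewrite -qeps; apply: (qchar_inj E2); rewrite ?qchar_dom //.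
rewrite /chi -(rmorph_int iota) qcharE // rmorphXn /= Nc qcharE // cardE.
by rewrite half_predX ?odd_card // mulnC exprM.
Qed.

End JacobiCharacter.

(** * The functional equation *)

Lemma sum_rV_lead (K : finFieldType) (R : nmodType) (F : {poly K} -> R) m :
  \sum_(b : 'rV[K]_m.+1) F (rVpoly b) =
  \sum_(u : 'rV[K]_m) F (rVpoly u) +
  \sum_(l : K | l != 0) \sum_(v : 'rV[K]_m) F (l *: monicp v).
Proof.
have szp l (u : 'rV[K]_m) : (size (l *: 'X^m + rVpoly u)%R <= m.+1)%N.
  rewrite (leq_trans (size_polyD _ _)) // geq_max (leq_trans (size_scale_leq _ _)).
    by rewrite (leq_trans (size_rVpoly u)).
  by rewrite size_polyXn.
transitivity (\sum_(p : K * 'rV[K]_m) F (p.1 *: 'X^m + rVpoly p.2)).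
  rewrite (reindex (fun p : K * 'rV[K]_m => poly_rV (p.1 *: 'X^m + rVpoly p.2))) /=.
    by apply: eq_bigr => p _; rewrite poly_rV_K.
  exists (fun b : 'rV[K]_m.+1 => ((rVpoly b)`_m, poly_rV (rVpoly b))) => [[l u] _|b _] /=.
    rewrite poly_rV_K // coefD coefZ coefXn eqxx mulr1.
    rewrite [(rVpoly u)`_m]nth_default ?size_rVpoly // addr0; congr (_, _).
    apply/rowP => i; rewrite mxE coefD coefZ coefXn ltn_eqF ?ltn_ord // mulr0 add0r.
    by rewrite coef_rVpoly_ord.
  apply/rowP => i; rewrite mxE coefD coefZ coefXn.
  have [e|ne_im] := eqVneq (i : nat) m.
    rewrite mulr1 e [(rVpoly (poly_rV _))`_m]nth_default ?size_rVpoly // addr0.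
    by have := coef_rVpoly_ord b i; rewrite e.
  have lt_im : (i < m)%N by rewrite ltn_neqAle ne_im -ltnS ltn_ord.
  by rewrite mulr0 add0r -[X in _`_X]/(val (Ordinal lt_im)) coef_rVpoly_ord mxE coef_rVpoly_ord.
rewrite -(pair_bigA _ (fun l u => F (l *: 'X^m + rVpoly u))) /= (bigD1 0) //=.
congr (_ + _); first by apply: eq_bigr => u _; rewrite scale0r add0r.
apply: eq_bigr => l nz_l; rewrite (reindex (fun v => l *: v)) /=.
  by apply: eq_bigr => v _; rewrite linearZ /= scalerDr.
by exists (fun v => l^-1 *: v) => v _; rewrite scalerA ?mulfV ?mulVf ?scale1r.
Qed.

Section GaussSums.

Variables (K : finFieldType) (f : {poly K}) (d : nat).
Hypotheses (K2 : (2%:R : K) != 0) (fm : f \is monic) (sepf : coprimep f f^`()).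
Hypotheses (sf : size f = d.+1) (d_gt0 : (0 < d)%N).

Local Notation q := #|K|.
Local Notation chi := (chi f).

Lemma chi_factor (P h : {poly K}) : irreducible_poly P -> P %| f -> P %| h -> chi h = 0.
Proof. by move=> [sP _] Pf Ph; rewrite /chi (pnorm_common_factor fm sepf sP) ?qchar0. Qed.

Lemma chi_coprime_sqr h : coprimep f h -> chi h ^+ 2 = 1.
Proof.
case/(exists_inverse_mod)=> h' fhh'; apply: qchar_sqr1; rewrite -qchar_eq0.
have : chi h * chi h' = 1.
  by rewrite -chiM // (chi_mod fm sepf fhh') (chi1 K2 fm sepf sf).
by apply: contra_eq_neq; rewrite /chi => ->; rewrite mul0r eq_sym oner_eq0.
Qed.

Lemma nonresidue_coprime c : chi c = -1 -> coprimep f c.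
Proof.
move=> chic; have [//|[P [Pm irrP Pf Pc]]] := coprimep_or_factor fm c.
by move: chic; rewrite (chi_factor irrP Pf Pc).
Qed.

Lemma chi0 : chi 0 = 0.
Proof. by rewrite -polyC0 (chiC K2 fm sepf sf) qchar0 expr0n gtn_eqF. Qed.

Variable psi : K -> algC.
Hypotheses (psi0 : psi 0 = 1) (psiD : {morph psi : a b / a + b >-> a * b}).
Hypothesis psi_sum :
  forall b, \sum_a psi (b * a) = if b == 0 then q%:R else 0.

(** The Gauss sum of [chi] over K[X] / (f). The additive character is [psi] applied to the
    coefficient of X^(d-1) of the residue of h, which is the coefficient of 1 / X in the expansion
    of h / f at infinity. *)
Definition gsum (a : {poly K}) : algC :=
  \sum_(b : 'rV[K]_d) (chi (rVpoly b))%:~R * psi ((a * rVpoly b) %% f)`_d.-1.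

Lemma chi_modp h : chi (h %% f) = chi h.
Proof.
apply: (chi_mod fm sepf); apply/modp_eq0P.
by rewrite modpD modpN modp_id subrr.
Qed.

(** If [a] is prime to [f], substitute a b for b and use that [chi] is quadratic. Otherwise take [c]
    from [irr_nonresidue]: a c is congruent to a modulo [f] while [chi c] is -1, so substituting c b
    for b shows that the sum is its own opposite. *)
Lemma gsum_chi a : gsum a = (chi a)%:~R * gsum 1.
Proof.
have [cop|[P [Pm irrP Pf Pa]]] := coprimep_or_factor fm a.
  rewrite {2}/gsum (sum_residues_mul fm sf (fun h => (chi h)%:~R *
    psi ((1 * h) %% f)`_d.-1) cop) mulr_sumr; apply: eq_bigr => b _.
  rewrite mul1r modp_id chi_modp chiM // rmorphM /= !mulrA -rmorphM -expr2.
  by rewrite chi_coprime_sqr // mul1r.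
have [c [chic Wc]] := irr_nonresidue K2 fm sepf Pm irrP Pf.
rewrite (chi_factor irrP Pf Pa) mul0r; apply/eqP.
suff : gsum a = - gsum a.
  by move/eqP; rewrite -addr_eq0 -mulr2n mulrn_eq0.
rewrite {1}/gsum (sum_residues_mul fm sf (fun h => (chi h)%:~R *
  psi ((a * h) %% f)`_d.-1) (nonresidue_coprime chic)) -sumrN.
apply: eq_bigr => b _; rewrite modp_mul chi_modp chiM // chic.
rewrite rmorphM /= rmorphN1 mulN1r mulNr; congr (- (_ * psi (_ : {poly K})`_ _)).
apply/eqP; rewrite -subr_eq0 -modpN -modpD; apply/eqP/modp_eq0P.
have -> : a * (c * rVpoly b) - a * rVpoly b = a * (c - 1) * rVpoly b by ring.
by rewrite -(divpK Pf) [_ * P]mulrC dvdp_mulr // dvdp_mul.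
Qed.

Definition csum n : int := \sum_(v : 'rV[K]_n) chi (monicp v).
Definition tsum n : int := \sum_(v : 'rV[K]_n) chi (rVpoly v).

Lemma tsum0 : tsum 0 = 0.
Proof.
rewrite /tsum big1 // => v _; have -> : rVpoly v = 0; last exact: chi0.
by apply/eqP; rewrite -size_poly_leq0 size_rVpoly.
Qed.

Lemma tsumS n :
  tsum n.+1 = tsum n + (\sum_(l : K | l != 0) qchar l ^+ d) * csum n.
Proof.
rewrite /tsum sum_rV_lead; congr (_ + _); rewrite mulr_suml.
apply: eq_bigr => l _; rewrite mulr_sumr; apply: eq_bigr => v _.
by rewrite -mul_polyC chiM // (chiC K2 fm sepf sf).
Qed.

(** At [a = 0] the Gauss sum is the plain sum of [chi] over all residues, and [gsum_chi] makes it a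
    multiple of [chi 0 = 0]. *)
Lemma tsum_residues : tsum d = 0.
Proof.
apply/eqP; rewrite -(intr_eq0 algC); apply/eqP.
have := gsum_chi 0; rewrite chi0 mul0r => <-.
rewrite /gsum rmorph_sum; apply: eq_bigr => b _.
by rewrite mul0r mod0p coef0 psi0 mulr1.
Qed.

Lemma csum0 : csum 0 = 1.
Proof.
rewrite /csum (big_pred1 0) => [|v]; last by rewrite /= [v]thinmx0 eqxx.
by rewrite /monicp linear0 addr0 expr0 (chi1 K2 fm sepf sf).
Qed.

(** By Euclidean division the monic polynomials of degree n >= d are equidistributed modulo [f], and
    each full system of residues contributes 0. Hence the L-series is a polynomial. *)
Lemma csum_eq0 n : (d <= n)%N -> csum n = 0.
Proof.
move=> le_dn; pose h (p : 'rV[K]_(n - d) * 'rV[K]_d) := f * monicp p.1 + rVpoly p.2.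
have szb (b : 'rV[K]_d) : (size (rVpoly b) < size f)%N by rewrite sf ltnS size_rVpoly.
have sfm (w : 'rV[K]_(n - d)) : size (f * monicp w) = n.+1.
  by rewrite size_Mmonic ?monic_neq0 ?monicp_monic // sf size_monicp addSn /= addnS subnKC.
have lt_b (p : 'rV[K]_(n - d) * 'rV[K]_d) :
    (size (rVpoly p.2) < size (f * monicp p.1)%R)%N.
  by apply: leq_trans (szb p.2) _; rewrite sf sfm ltnS.
have hm p : h p \is monic.
  by rewrite monicE lead_coefDl // -monicE monicMl ?monicp_monic.
have sh p : size (h p) = n.+1 by rewrite size_polyDl.
rewrite /csum (reindex (fun p => monic_rV n (h p))) /=.
  transitivity (\sum_(p : 'rV[K]_(n - d) * 'rV[K]_d) chi (rVpoly p.2)).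
    apply: eq_bigr => p _; rewrite monic_rVK //; apply: (chi_mod fm sepf).
    by rewrite /h addrK dvdp_mulr.
  rewrite -(pair_bigA _ (fun _ b => chi (rVpoly b))) /= big1 // => w _.
  exact: tsum_residues.
exists (fun v => (monic_rV (n - d) (monicp v %/ f), poly_rV (monicp v %% f))) => [[w b] _|v _] /=.
  rewrite monic_rVK // /h /= mulrC divp_addl_mul_small // modp_addl_mul_small //.
  by rewrite monicpK rVpolyK.
have vm := monicp_monic v; have sv := size_monicp v.
have f0 := monic_neq0 fm.
have kn : size (monicp v %/ f) = (n - d).+1.
  by rewrite size_divp // sv sf /= subSn.
have km : monicp v %/ f \is monic.
  have k0 : monicp v %/ f != 0 by rewrite -size_poly_gt0 kn.
  move: vm; rewrite monicE {1}(divp_eq (monicp v) f) lead_coefDl.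
    by rewrite lead_coefM (monicP fm) mulr1.
  apply: leq_trans (_ : (size (monicp v %% f)%R < size f)%N) _; first by rewrite ltn_modp.
  by rewrite size_mul // kn sf addSn /= leq_addl.
rewrite /h /= monic_rVK // poly_rV_K; last by rewrite -ltnS -sf ltn_modp.
by rewrite mulrC -divp_eq monicpK.
Qed.

(** If deg b < d - n the product needs no reduction modulo [f], and its coefficient of degree d - 1
    does not depend on [v]. Otherwise a shift of [v] by a multiple of a suitable monomial multiplies
    the sum by an arbitrary value of [psi], so it vanishes. *)
Lemma inner_sum n (b : {poly K}) : (n < d)%N -> (size b <= d)%N ->
  \sum_(v : 'rV[K]_n) psi ((monicp v * b) %% f)`_d.-1 =
  if (size b <= d - n)%N then (q ^ n)%:R * psi b`_(d.-1 - n) else 0.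
Proof.
move=> lt_nd sb; case: leqP => [le_b|lt_b].
  have term (v : 'rV[K]_n) : ((monicp v * b) %% f)`_d.-1 = b`_(d.-1 - n).
    have sMb : (size (monicp v * b)%R <= d)%N.
      by rewrite (leq_trans (size_polyMleq _ _)) // size_monicp; lia.
    rewrite modp_small ?sf // mulrDl coefD coefXnM ltnNge.
    have -> : (n <= d.-1)%N by lia.
    rewrite /= [X in _ + X]nth_default ?addr0 //.
    rewrite (leq_trans (size_polyMleq _ _)) //.
    have := size_rVpoly v; lia.
  by under eq_bigr do rewrite term; rewrite sumr_const card_mx mul1n mulr_natl.
have [s def_s] : exists s, size b = s.+1 by case: (size b) lt_b => // s; exists s.
(* The exponent [d.-1 - s] is the one for which X^j b has degree exactly d - 1. *)
have lt_jn : (d.-1 - s < n)%N by lia.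
pose j := Ordinal lt_jn; pose D : 'rV[K]_n := delta_mx 0 j.
have bs0 : b`_s != 0.
  by have : lead_coef b != 0; [rewrite lead_coef_eq0 -size_poly_gt0 def_s | rewrite lead_coefE def_s].
have shift l (v : 'rV[K]_n) : ((monicp (v + l *: D) * b) %% f)`_d.-1 =
    b`_s * l + ((monicp v * b) %% f)`_d.-1.
  rewrite /monicp linearD linearZ /= rVpoly_delta addrA mulrDl modpD coefD [RHS]addrC.
  congr (_ + _); rewrite modp_small -?scalerAl.
    by rewrite coefZ coefXnM ltnNge /= leq_subr /= subKn 1?mulrC //; lia.
  rewrite sf ltnS (leq_trans (size_scale_leq _ _)) //.
  by rewrite (leq_trans (size_polyMleq _ _)) // size_polyXn def_s /=; lia.
set S := \sum_(v : _) _.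
have shiftS l : S = psi (b`_s * l) * S.
  rewrite {1}/S (reindex_inj (addIr (l *: D))) /= mulr_sumr.
  by apply: eq_bigr => v _; rewrite shift psiD.
have : q%:R * S = 0.
  rewrite mulr_natl -sumr_const.
  under eq_bigr => l _ do rewrite (shiftS l).
  by rewrite -mulr_suml psi_sum (negPf bs0) mul0r.
move/eqP; rewrite mulf_eq0 pnatr_eq0 gtn_eqF /=; first by move/eqP.
by rewrite ltnW ?finNzRing_gt1.
Qed.

(** Poisson summation. Writing [chi] through Gauss sums and exchanging the sums, [inner_sum] retains
    only the b of degree at most m = d - 1 - n. Those of lower degree give [tsum]; those of degree m
    are l times a monic polynomial and give the sum over [l]. *)
Lemma csum_poisson n : (n < d)%N ->
  (csum n)%:~R * gsum 1 = (q ^ n)%:R * ((tsum (d.-1 - n))%:~R +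
     (\sum_(l | l != 0) (qchar l ^+ d)%:~R * psi l) * (csum (d.-1 - n))%:~R).
Proof.
move=> lt_nd; set m := (d.-1 - n)%N.
transitivity (\sum_(v : 'rV[K]_n) gsum (monicp v)).
  by rewrite rmorph_sum mulr_suml; apply: eq_bigr => v _; rewrite [RHS]gsum_chi.
rewrite exchange_big /=.
have szm : (m.+1 <= d)%N by rewrite /m; lia.
transitivity (\sum_(b : 'rV[K]_d | (size (rVpoly b) <= m.+1)%N)
   (chi (rVpoly b))%:~R * ((q ^ n)%:R * psi (rVpoly b)`_m)).
  rewrite [RHS]big_mkcond; apply: eq_bigr => b _; rewrite -mulr_sumr.
  rewrite inner_sum ?size_rVpoly //; have -> : (d - n = m.+1)%N by rewrite /m; lia.
  by case: ifP => // _; rewrite mulr0.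
transitivity (\sum_(b : 'rV[K]_m.+1)
   (chi (rVpoly b))%:~R * ((q ^ n)%:R * psi (rVpoly b)`_m)).
  have szd (b : 'rV[K]_m.+1) : (size (rVpoly b) <= d)%N.
    by rewrite (leq_trans (size_rVpoly b)).
  rewrite (reindex_onto (fun b : 'rV[K]_m.+1 => poly_rV (rVpoly b) : 'rV[K]_d)
     (fun b => poly_rV (rVpoly b))) /=; last first.
    by move=> b sb; rewrite poly_rV_K // rVpolyK.
  by apply: eq_big => b; rewrite poly_rV_K // rVpolyK eqxx size_rVpoly.
rewrite (sum_rV_lead (fun h => (chi h)%:~R * ((q ^ n)%:R * psi h`_m))) mulrDr.
congr (_ + _).
  rewrite rmorph_sum mulr_sumr; apply: eq_bigr => u _.
  by rewrite nth_default ?size_rVpoly // psi0 mulr1 mulrC.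
rewrite mulr_suml mulr_sumr; apply: eq_bigr => l _.
rewrite rmorph_sum !mulr_sumr; apply: eq_bigr => v _.
rewrite -mul_polyC chiM // (chiC K2 fm sepf sf) mul_polyC coefZ.
have -> : (monicp v)`_m = 1.
  by have := monicp_monic v; rewrite monicE lead_coefE size_monicp => /eqP.
by rewrite mulr1 rmorphM /=; ring.
Qed.

End GaussSums.

Section LPolynomial.

Variables (K : finFieldType) (f : {poly K}) (g d : nat).
Hypotheses (K2 : (2%:R : K) != 0) (fm : f \is monic) (sepf : coprimep f f^`()).
Hypotheses (sf : size f = d.+1) (hd : d = (2 * g + 1)%N \/ d = (2 * g + 2)%N).

Local Notation q := #|K|.

Let d_gt0 : (0 < d)%N. Proof. by lia. Qed.

(* If [d] is even, the monic [f] gives two rational points at infinity, and the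
   generating series of [wcoef] is [1 - T] times the L-polynomial. *)
Definition lcoef n : int :=
  if odd d then wcoef (fchar f) n else \sum_(0 <= k < n.+1) wcoef (fchar f) k.

(* Minus the power sums of the reciprocal roots of the L-polynomial. *)
Definition lsum n : int := wpsum (fchar f) n + (~~ odd d)%:R.

Lemma wcoef_csum n : wcoef (fchar f) n = qchar ((-1) ^+ d : K) ^+ n * csum f n.
Proof.
rewrite /wcoef /csum mulr_sumr; apply: eq_bigr => v _.
by rewrite /fchar sf size_monicp /= exprM qcharM // qcharX.
Qed.

Lemma wcoef0 : wcoef (fchar f) 0 = 1.
Proof. by rewrite wcoef_csum expr0 mul1r (csum0 K2 fm sepf sf). Qed.

Lemma lcoef0 : lcoef 0 = 1.
Proof. by rewrite /lcoef big_nat1 wcoef0; case: odd. Qed.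

(** For even [d] the series is divided by 1 - T, which adds T / (1 - T) to its logarithmic
    derivative, hence the 1 in [lsum]. The partial sums [e] carry this out on coefficients. *)
Lemma lcoef_newton n :
  n%:R * lcoef n = \sum_(1 <= k < n.+1) lsum k * lcoef (n - k).
Proof.
have newton m := wcoef_newton (fchar1 fm sepf) (fcharM K2 fm sepf) m.
rewrite /lcoef /lsum; case: (odd d) => /=.
  by rewrite newton; apply: eq_bigr => k _; rewrite addr0.
set c := wcoef (fchar f) in newton *; set S := wpsum _ in newton *.
pose e m : int := \sum_(0 <= k < m) c k.
rewrite -/(e n.+1).
have -> : \sum_(1 <= k < n.+1) (S k + 1%:R) * \sum_(0 <= k0 < (n - k).+1) c k0 =
   \sum_(1 <= k < n.+1) S k * e (n.+1 - k)%N + \sum_(0 <= k < n.+1) e k.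
  rewrite (big_ltn (ltn0Sn n)) [e 0]big_geq // add0r.
  rewrite [X in _ = _ + X]big_nat_rev /= -big_split /=.
  by apply: eq_big_nat => k /andP[k1 kn]; rewrite mulrDl mul1r -subSn.
elim: n => [|n IHn]; first by rewrite mul0r (big_geq (leqnn 1)) big_nat1 /e big_geq.
have eS m : e m.+1 = e m + c m by rewrite /e big_nat_recr.
rewrite eS big_nat_recr //= (big_nat_recr _ _ e) //=.
have -> : \sum_(1 <= k < n.+1) S k * e (n.+2 - k)%N =
  \sum_(1 <= k < n.+1) S k * e (n.+1 - k)%N + \sum_(1 <= k < n.+1) S k * c (n.+1 - k)%N.
  rewrite -big_split; apply: eq_big_nat => k /andP[k1 kn] /=.
  by rewrite -mulrDr -eS -subSn // ltnW.
have -> : e (n.+2 - n.+1)%N = c 0%N by rewrite subSn // subnn eS /e big_geq // add0r.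
have := newton n.+1; rewrite big_nat_recr //= subnn => newton_n.
rewrite mulrDr newton_n -natr1 mulrDl IHn; ring.
Qed.

Lemma sum_qchar : \sum_(a : K) qchar a = 0.
Proof.
have [e qe] := exists_nonsquare K2.
have nz_e : e != 0 by rewrite -qchar_eq0 qe.
suff : \sum_(a : K) qchar a = - \sum_(a : K) qchar a by lia.
rewrite {1}(reindex_inj (mulfI nz_e)) /= -sumrN.
by apply: eq_bigr => a _; rewrite qcharM // qe mulN1r.
Qed.

Lemma sum_qcharX :
  \sum_(l : K | l != 0) qchar l ^+ d = if odd d then 0 else q%:R - 1.
Proof.
case: ifPn => [odd_d|even_d].
  rewrite -[RHS]sum_qchar [RHS](bigD1 0) //= qchar0 add0r.
  apply: eq_bigr => l nz_l; rewrite -(odd_double_half d) odd_d -muln2 exprD mulnC.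
  by rewrite exprM qchar_sqr1 // expr1n mulr1.
rewrite (eq_bigr (fun=> 1)) => [|l nz_l]; last first.
  by rewrite -(odd_double_half d) (negPf even_d) -muln2 mulnC exprM qchar_sqr1 // expr1n.
rewrite sumr_const (eq_card (B := predC1 0)) // cardC1 -[q in RHS]prednK.
  by rewrite -natr1 addrK.
by rewrite ltnW ?finNzRing_gt1.
Qed.

(** If the sum were 0, so would be all its twists, that is, the Fourier transform of [qchar]; but
    Fourier inversion at 1 gives q. *)
Lemma quadratic_gauss_neq0 (psi : K -> algC) : psi 0 = 1 ->
  {morph psi : a b / a + b >-> a * b} ->
  (forall b, \sum_a psi (b * a) = if b == 0 then q%:R else 0) ->
  \sum_(l : K) (qchar l)%:~R * psi l != 0.
Proof.
move=> psi0 psiD psi_sum; apply/eqP => gam0.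
have twist b : \sum_(a : K) (qchar a)%:~R * psi (a * b) = 0.
  have [->|nz_b] := eqVneq b 0.
    under eq_bigr do rewrite mulr0 psi0 mulr1.
    by rewrite -rmorph_sum sum_qchar.
  have : (qchar b)%:~R * \sum_(a : K) (qchar a)%:~R * psi (a * b) = 0.
    rewrite mulr_sumr -[RHS]gam0 [RHS](reindex_inj (mulIf nz_b)) /=.
    by apply: eq_bigr => a _; rewrite mulrA -intrM -qcharM // [b * a]mulrC.
  by move/eqP; rewrite mulf_eq0 intr_eq0 qchar_eq0 (negPf nz_b) => /eqP.
have : \sum_(b : K) psi (- b) * \sum_(a : K) (qchar a)%:~R * psi (a * b) = q%:R.
  under eq_bigr do rewrite mulr_sumr.
  rewrite exchange_big /= (bigD1 1) //= [X in _ + X]big1 => [|a ne_a1].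
    rewrite addr0; transitivity (\sum_(b : K) (1 : algC)).
      apply: eq_bigr => b _; rewrite qchar1 mul1r mul1r -psiD addNr psi0 //.
    by rewrite sumr_const.
  transitivity (\sum_(b : K) (qchar a)%:~R * psi ((a - 1) * b)).
    by apply: eq_bigr => b _; rewrite mulrCA -psiD mulrBl mul1r addrC.
  by rewrite -mulr_sumr psi_sum subr_eq0 (negPf ne_a1) mulr0.
rewrite big1 => [|b _]; last by rewrite twist mulr0.
by move/esym/eqP; rewrite pnatr_eq0 gtn_eqF // ltnW ?finNzRing_gt1.
Qed.

Let odd_dE : odd d -> d = (2 * g + 1)%N.
Proof. by case: hd => // ->; rewrite oddD mul2n odd_double. Qed.

Let even_dE : ~~ odd d -> d = (2 * g + 2)%N.
Proof. by case: hd => // ->; rewrite oddD mul2n odd_double. Qed.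

Let wcoef_eq0 n : (d <= n)%N -> wcoef (fchar f) n = 0.
Proof.
move=> le_dn; rewrite wcoef_csum.
(* The vanishing of [csum] does not mention [psi], and the constant map 1 has the required value at
   0. *)
by rewrite (csum_eq0 K2 fm sepf sf d_gt0 (psi := fun=> 1) erefl le_dn) mulr0.
Qed.

Let wcoef_even n : ~~ odd d -> wcoef (fchar f) n = csum f n.
Proof.
move=> even_d; rewrite wcoef_csum -signr_odd (negPf even_d) expr0 qchar1.
by rewrite expr1n mul1r.
Qed.

Let tsum_even m : ~~ odd d ->
  tsum f m = (q%:R - 1) * \sum_(0 <= k < m) wcoef (fchar f) k.
Proof.
move=> even_d; elim: m => [|m IHm].
  by rewrite (tsum0 K2 fm sepf sf) // big_geq // mulr0.
rewrite (tsumS K2 fm sepf sf) sum_qcharX (negPf even_d) big_nat_recr //= IHm.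
by rewrite wcoef_even // mulrDr.
Qed.

Let tsum_odd m : odd d -> tsum f m = 0.
Proof.
move=> odd_d; elim: m => [|m IHm]; first by rewrite (tsum0 K2 fm sepf sf).
by rewrite (tsumS K2 fm sepf sf) sum_qcharX odd_d mul0r addr0.
Qed.

(** For even [d] the series of the [wcoef] vanishes at T = 1: the sum of its coefficients is
    [tsum f d] up to the nonzero factor q - 1. *)
Lemma lcoef_eq0 n : (2 * g < n)%N -> lcoef n = 0.
Proof.
move=> lt_gn; rewrite /lcoef; case: ifPn => [odd_d|even_d].
  by apply: wcoef_eq0; rewrite odd_dE // addn1.
rewrite (@big_cat_nat _ _ _ d) //=; last by rewrite even_dE //; lia.
rewrite [X in _ + X]big1_seq ?addr0; last first.
  by move=> k; rewrite mem_index_iota => /andP[_ /andP[? _]]; apply: wcoef_eq0.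
have := tsum_residues K2 fm sepf sf d_gt0 (psi := fun=> 1) erefl.
rewrite tsum_even // => /eqP; rewrite mulf_eq0 => /orP[|/eqP //].
by rewrite subr_eq0 pnatr_eq1 gtn_eqF // finNzRing_gt1.
Qed.

(** Poisson summation relates degrees n and d - 1 - n through the unknown Gauss sum [G]; its case n
    = 0 expresses [G] by the top coefficient. *)
Lemma lcoef_sym n : (n <= 2 * g)%N ->
  lcoef n * lcoef (2 * g) = (q ^ n)%:R * lcoef (2 * g - n).
Proof.
have [psi [psi0 psiD psi_sum]] := exists_additive_character K.
have poisson k := csum_poisson K2 fm sepf sf d_gt0 psi0 psiD psi_sum (n := k).
set G := gsum _ _ _ _ in poisson; set gam := \sum_(l | _) _ in poisson.
have q_gt0 : (0 < q)%N by rewrite ltnW ?finNzRing_gt1.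
have nz_q : q%:R != 0 :> algC by rewrite pnatr_eq0 -lt0n.
have [odd_d|even_d] := boolP (odd d).
  have def_d := odd_dE odd_d; have def_d1 : d.-1 = (2 * g)%N by lia.
  have gam0 : gam != 0.
    suff -> : gam = \sum_(l : K) (qchar l)%:~R * psi l.
      exact: quadratic_gauss_neq0.
    rewrite [RHS](bigD1 0) //= qchar0 mul0r add0r; apply: eq_bigr => l nz_l.
    rewrite -(odd_double_half d) odd_d -muln2 exprD mulnC exprM qchar_sqr1 //.
    by rewrite expr1n mulr1.
  have key k : (k <= 2 * g)%N ->
      csum f k * csum f (2 * g) = (q ^ k)%:R * csum f (2 * g - k).
    move=> le_kg; have Gk := poisson k; have G0 := poisson 0%N.
    rewrite !tsum_odd // !add0r def_d1 in Gk G0.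
    move: G0; rewrite (csum0 K2 fm sepf sf) subn0 mul1r mul1r => /(_ d_gt0) G0.
    apply/eqP; rewrite -(eqr_int algC) !rmorphM /= rmorph_nat.
    rewrite -(inj_eq (mulfI gam0)) mulrCA -G0 Gk //; last by lia.
    by apply/eqP; ring.
  move=> le_ng; rewrite /lcoef odd_d !wcoef_csum.
  set sg := qchar _; have sg2 : sg ^+ 2 = 1.
    by apply: qchar_sqr1; rewrite expf_neq0 // oppr_eq0 oner_neq0.
  rewrite mulrACA key // [in RHS]mulrCA; congr (_ * _).
  transitivity (sg ^+ (2 * g - n) * (sg ^+ 2) ^+ n).
    by rewrite -exprM -!exprD; congr (_ ^+ _); lia.
  by rewrite sg2 expr1n mulr1.
have def_d := even_dE even_d; have def_d1 : d.-1 = (2 * g).+1 by lia.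
pose e k : int := \sum_(0 <= j < k) wcoef (fchar f) j.
have eS k : e k.+1 = e k + csum f k by rewrite /e big_nat_recr //= wcoef_even.
have def_gam : gam = -1.
  have -> : gam = \sum_(l : K | l != 0) psi l.
    apply: eq_bigr => l nz_l; rewrite -(odd_double_half d) (negPf even_d) -muln2.
    by rewrite mulnC exprM qchar_sqr1 // expr1n mul1r.
  have := psi_sum 1; rewrite oner_eq0 (bigD1 0) //= mulr0 psi0.
  under eq_bigr do rewrite mul1r.
  by move/eqP; rewrite addrC addr_eq0 => /eqP.
have e_top : e (2 * g).+2 = 0.
  by have := lcoef_eq0 (ltnSn (2 * g)); rewrite /lcoef (negPf even_d).
have step k : (k <= 2 * g)%N -> (csum f k)%:~R * G =
    (q ^ k)%:R * (q%:R * (e (2 * g - k).+1)%:~R - (e (2 * g - k).+2)%:~R) :> algC.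
  move=> le_kg; rewrite poisson ?def_gam; last by lia.
  rewrite tsum_even // def_d1 subSn // -/(e _) [e (_ - _).+2]eS.
  by rewrite !rmorphM !rmorphD /= rmorphN1 rmorph_nat; ring.
(* Summing [step] over the degrees up to [k] telescopes, because [e_top] removes the first
   subtracted term. *)
have key k : (k <= 2 * g)%N ->
    (e k.+1)%:~R * G = (q ^ k.+1)%:R * (e (2 * g - k).+1)%:~R :> algC.
  elim: k => [|k IHk] le_kg.
    by rewrite eS {1}/e big_geq // add0r step // subn0 e_top subr0 expn0 mul1r expn1.
  rewrite eS rmorphD mulrDl /= IHk 1?ltnW // step //.
  have -> : (2 * g - k.+1).+1 = (2 * g - k)%N by lia.
  by rewrite [in RHS]expnSr natrM; ring.
move=> le_ng; rewrite /lcoef (negPf even_d) -!/(e _).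
have G0 := key 0%N (leq0n _); have Gn := key n le_ng.
rewrite eS {1}/e big_geq // add0r (csum0 K2 fm sepf sf) mul1r subn0 expn1 in G0.
apply/eqP; rewrite -(eqr_int algC) !rmorphM /= rmorph_nat.
rewrite -(inj_eq (mulfI nz_q)) mulrCA -G0 Gn expnS natrM.
by apply/eqP; ring.
Qed.

End LPolynomial.

(** * The L-polynomial and its Newton polygon *)

Lemma newton_prod (C : comNzRingType) (z : seq C) n :
  n.+1%:R * (\prod_(x <- z) (1 - x *: 'X))`_n.+1 =
  - \sum_(0 <= k < n.+1)
      (\sum_(x <- z) x ^+ k.+1) * (\prod_(x <- z) (1 - x *: 'X))`_(n - k).
Proof.
elim: z n => [|x z IHz] n.
  by rewrite !big_nil coef1 mulr0 big1 ?oppr0 // => k _; rewrite big_nil mul0r.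
set M := \prod_(y <- z) _ in IHz; set N := \prod_(y <- x :: z) _.
have {}def_N : N = (1 - x *: 'X) * M by rewrite /N big_cons.
pose s k := \sum_(y <- z) y ^+ k.
have NS m : N`_m.+1 = M`_m.+1 - x * M`_m.
  by rewrite def_N mulrBl mul1r -scalerAl coefB coefZ coefXM.
have N0 : N`_0 = M`_0.
  by rewrite def_N mulrBl mul1r -scalerAl coefB coefZ coefXM mulr0 subr0.
have tel m : \sum_(0 <= k < m.+1) x ^+ k.+1 * N`_(m - k) = x * M`_m.
  elim: m => [|m IHm]; first by rewrite big_nat1 N0.
  rewrite big_nat_recl //= NS.
  transitivity (x * (M`_m.+1 - x * M`_m) + x * (x * M`_m)); last by ring.
  congr (_ + _); rewrite -IHm mulr_sumr; apply: eq_bigr => k _.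
  by rewrite mulrA -exprS.
have -> : \sum_(0 <= k < n.+1) (\sum_(y <- x :: z) y ^+ k.+1) * N`_(n - k) =
  \sum_(0 <= k < n.+1) s k.+1 * N`_(n - k) + x * M`_n.
  rewrite -tel -big_split; apply: eq_bigr => k _ /=.
  by rewrite big_cons mulrDl addrC.
have -> : \sum_(0 <= k < n.+1) s k.+1 * N`_(n - k) =
  \sum_(0 <= k < n.+1) s k.+1 * M`_(n - k)
    - x * \sum_(0 <= k < n) s k.+1 * M`_(n.-1 - k).
  rewrite !big_nat_recr //= subnn N0 mulr_sumr [RHS]addrAC -sumrB; congr (_ + _).
  apply: eq_big_nat => k /= lt_kn; have [m ->] : exists m, n = (k + m).+1.
    by exists (n - k.+1)%N; lia.
  by rewrite /= -addnS addKn addKn NS; ring.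
rewrite -(opprK (\sum_(0 <= k < n.+1) _)) -IHz NS.
case: n => [|n]; first by rewrite big_geq //; ring.
by rewrite /= -(opprK (\sum_(0 <= k < n.+1) _)) -IHz -!natr1; ring.
Qed.

(** Newton's identities up to [N] divide only by 1, ..., N; so this applies in characteristic p when
    N < p. *)
Lemma newton_eq (C : idomainType) (N : nat) (l l' s : nat -> C) :
  l 0%N = l' 0%N -> (forall n, (n < N)%N -> n.+1%:R != 0 :> C) ->
  (forall n, (n < N)%N ->
    n.+1%:R * l n.+1 = - \sum_(0 <= k < n.+1) s k.+1 * l (n - k)%N) ->
  (forall n, (n < N)%N ->
    n.+1%:R * l' n.+1 = - \sum_(0 <= k < n.+1) s k.+1 * l' (n - k)%N) ->
  forall n, (n <= N)%N -> l n = l' n.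
Proof.
move=> l0 nz newton newton'; elim/ltn_ind => -[|n] IHn // lt_nN.
apply: (mulfI (nz n lt_nN)); rewrite newton // newton' //; congr (- _).
by apply: eq_big_nat => k lt_kn; rewrite IHn //; lia.
Qed.

Section PowerSums.

Variable C : numClosedFieldType.

Lemma newton_unique (l s l' s' : nat -> C) : l 0%N = l' 0%N -> l 0%N != 0 ->
  (forall n, n.+1%:R * l n.+1 = - \sum_(0 <= k < n.+1) s k.+1 * l (n - k)%N) ->
  (forall n, n.+1%:R * l' n.+1 = - \sum_(0 <= k < n.+1) s' k.+1 * l' (n - k)%N) ->
  (l =1 l' <-> (forall n, s n.+1 = s' n.+1)).
Proof.
move=> l0 nz_l newton newton'; split=> [eq_l n|eq_s n].
  elim/ltn_ind: n => n IHn; have := newton n; rewrite !eq_l newton'.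
  move/oppr_inj; rewrite !big_nat_recr //= subnn -l0.
  have -> : \sum_(0 <= k < n) s k.+1 * l (n - k)%N =
      \sum_(0 <= k < n) s' k.+1 * l' (n - k)%N.
    by apply: eq_big_nat => k lt_kn; rewrite eq_l IHn.
  by move/addrI/(mulIf nz_l).
apply: (@newton_eq C n l l' s') => // m _; first by rewrite pnatr_eq0.
by rewrite newton; congr (- _); apply: eq_bigr => k _; rewrite eq_s.
Qed.

Lemma prod_reciprocal_roots (p : {poly C}) n : p`_0 = 1 -> size p = n.+1 ->
  exists z : n.-tuple C, p = \prod_(x <- z) (1 - x *: 'X).
Proof.
move=> p0 sp; have [r def_p] := closed_field_poly_normal p.
have lc0 : lead_coef p != 0 by rewrite lead_coef_eq0 -size_poly_gt0 sp.
have sr : size r == n.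
  by have := sp; rewrite {1}def_p size_scale // size_prod_XsubC => -[->].
have nz_r x : x \in r -> x != 0.
  apply: contraTneq => ->; rewrite -root_prod_XsubC -(rootZ _ _ lc0) -def_p.
  by rewrite rootE horner_coef0 p0 oner_neq0.
exists (map_tuple (fun x => x^-1) (Tuple sr)); rewrite big_map /=.
have fact : \prod_(x <- r) ('X - x%:P) =
    (\prod_(x <- r) - x) *: \prod_(x <- r) (1 - x^-1 *: 'X).
  rewrite -mul_polyC rmorph_prod -big_split; apply: eq_big_seq => x r_x /=.
  rewrite mulrBr mulr1 -[x^-1 *: 'X]mul_polyC mulrA -polyCM mulNr mulfV ?nz_r //.
  by rewrite !polyCN mulNr mul1r opprK addrC.
rewrite {1}def_p fact scalerA; have := p0; rewrite {1}def_p fact scalerA coefZ.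
have -> : (\prod_(x <- r) (1 - x^-1 *: 'X))`_0 = 1.
  rewrite -horner_coef0 horner_prod big1 // => x _.
  by rewrite !hornerE subr0.
by rewrite mulr1 => ->; rewrite scale1r.
Qed.

End PowerSums.

Section LpolyExistence.

Variables (K : finFieldType) (f : {poly K}) (g d : nat).
Hypotheses (K2 : (2%:R : K) != 0) (fm : f \is monic) (sepf : coprimep f f^`()).
Hypotheses (sf : size f = d.+1) (hd : d = (2 * g + 1)%N \/ d = (2 * g + 2)%N).

Local Notation q := #|K|.
Local Notation l := (lcoef f d).

(** Above each x lie 1 + [qchar] (f x) points. The summand q^n + 1 takes care of one point at
    infinity; for even [d] the second one is in [lsum]. *)
Lemma npoints_lsum (E : finFieldType) (iota : {rmorphism K -> E}) n :
  #|E| = (q ^ n)%N ->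
  (hyp_npoints (map_poly iota f))%:R = (q ^ n)%:R + 1 + lsum f d n :> int.
Proof.
move=> cardE; have E2 : (2%:R : E) != 0 by rewrite -(rmorph_nat iota) fmorph_eq0.
rewrite /hyp_npoints size_map_poly sf /= lead_coef_map (monicP fm) rmorph1.
rewrite natrD -sum1dep_card -(pair_big_dep predT
  (fun x y => y ^+ 2 == (map_poly iota f).[x]) (fun _ _ => 1%N)) /= natr_sum.
under eq_bigr => x _ do rewrite sum1dep_card card_sqrt //.
rewrite big_split /= sumr_const cardE (psum_points K2 fm sepf iota cardE) /lsum.
case: ifP => _ /=; first by rewrite addr0; ring.
by rewrite card_sqrt // qchar1; ring.
Qed.

Lemma hyp_genusE : hyp_genus f = g.
Proof. by rewrite /hyp_genus sf /=; case: hd => ->; lia. Qed.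

Let lC n : algC := (l n)%:~R.
Let sC n : algC := - (lsum f d n)%:~R.

Let newton_lC n : n.+1%:R * lC n.+1 = - \sum_(0 <= k < n.+1) sC k.+1 * lC (n - k)%N.
Proof.
have := lcoef_newton d K2 fm sepf n.+1; move/(congr1 (intr : int -> algC)).
rewrite big_add1 rmorphM rmorph_nat rmorph_sum -sumrN /= /lC => ->.
by apply: eq_bigr => k _; rewrite subSS rmorphM /sC mulNr opprK.
Qed.

(** Since [K] has an extension of every degree, the point counts fix all power sums, and Newton's
    identities then fix the coefficients. *)
Lemma Lpoly_unique (L : {poly int}) : is_Lpoly f L -> forall n, L`_n = l n.
Proof.
rewrite /is_Lpoly hyp_genusE => -[sL [z [def_L points]]] n.
apply/eqP; rewrite -(eqr_int algC) -/(lC n) -[_%:~R]coef_map /= def_L; apply/eqP.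
move: n; apply/(newton_unique (s := fun k => \sum_(x <- z) x ^+ k) (l' := lC) (s' := sC) _ _ (newton_prod z) newton_lC).
- rewrite -horner_coef0 horner_prod big1 => [|x _]; last by rewrite !hornerE subr0.
  by rewrite /lC (lcoef0 K2 fm sepf sf).
- rewrite -horner_coef0 horner_prod big1 ?oner_neq0 // => x _.
  by rewrite !hornerE subr0.
move=> n; have [E [iota cardE]] := exists_ext_card K (ltn0Sn n).
have := points E iota n.+1 cardE.
rewrite -(rmorph_nat (intr : {rmorphism int -> algC})) (npoints_lsum iota cardE).
rewrite 2!rmorphD rmorph1 rmorph_nat /= => /addrI e.
by rewrite /sC e opprK.
Qed.

Lemma lcoef_top_sqr : l (2 * g) ^+ 2 = (q ^ (2 * g))%:R.
Proof.
by rewrite expr2 (lcoef_sym K2 fm sepf sf hd) // subnn (lcoef0 K2 fm sepf sf) mulr1.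
Qed.

Lemma Lpoly_exists : exists L : {poly int}, is_Lpoly f L.
Proof.
rewrite /is_Lpoly hyp_genusE; set N := g.*2; have NE : N = (2 * g)%N by rewrite /N; lia.
pose L := \poly_(k < N.+1) l k.
have l_top : l N != 0.
  rewrite -sqrf_eq0 NE lcoef_top_sqr pnatr_eq0 expn_eq0 gtn_eqF //.
  by rewrite ltnW ?finNzRing_gt1.
have LE k : L`_k = l k.
  rewrite coef_poly ltnS; case: leqP => // lt_Nk.
  by rewrite (lcoef_eq0 K2 fm sepf sf hd) // -NE.
have sL : size L = N.+1 by rewrite size_poly_eq.
have sLC : size (map_poly (intr : int -> algC) L) = N.+1.
  by rewrite size_map_inj_poly //; apply: intr_inj.
have [|z def_L] := prod_reciprocal_roots _ sLC.
  by rewrite coef_map /= LE (lcoef0 K2 fm sepf sf).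
exists L; split=> //; exists z; split=> // E iota n cardE.
rewrite -(rmorph_nat (intr : {rmorphism int -> algC})) (npoints_lsum iota cardE).
rewrite 2!rmorphD rmorph1 rmorph_nat /=; congr (_ + _).
have eq_l k : (\prod_(x <- z) (1 - x *: 'X))`_k = lC k.
  by rewrite -def_L coef_map /= LE.
have l0 : lC 0%N = 1 by rewrite /lC (lcoef0 K2 fm sepf sf).
have [|| + _] := newton_unique (s := fun k => \sum_(x <- z) x ^+ k) (l' := lC) (s' := sC) _ _ (newton_prod z) newton_lC.
- by rewrite eq_l.
- by rewrite eq_l l0 oner_neq0.
move/(_ eq_l) => eq_s; case: n cardE => [|n] cardE; last by rewrite eq_s /sC opprK.
by have := finNzRing_gt1 E; rewrite cardE.
Qed.

End LpolyExistence.

(** * Slopes and the middle coefficient *)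

Section NewtonPolygon.

Variables (p a g : nat) (L : {poly int}).
Hypotheses (pr_p : prime p) (a_gt0 : (0 < a)%N).
Let q := (p ^ a)%N.
Hypotheses (L0 : L`_0 = 1) (L_eq0 : forall n, (2 * g < n)%N -> L`_n = 0).
Hypothesis L_top : L`_(2 * g) ^+ 2 = (q ^ (2 * g))%:R.
Hypothesis L_sym : forall n, (n <= 2 * g)%N ->
  L`_n * L`_(2 * g) = (q ^ n)%:R * L`_(2 * g - n).

Let p_gt0 : (0 < p)%N := prime_gt0 pr_p.
Let V n : rat := val_q q L`_n.

Let VE n : V n = (logn p (absz L`_n))%:R / a%:R.
Proof.
rewrite /V /val_q /q; have -> : pdiv (p ^ a) = p by case: (a) a_gt0 => // b _; apply: pdiv_pfactor.
by rewrite pfactorK.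
Qed.

Let V_ge0 n : 0 <= V n. Proof. by rewrite VE divr_ge0 ?ler0n. Qed.

Let V0 : V 0 = 0. Proof. by rewrite VE L0 logn1 mul0r. Qed.

Let absL_top : absz L`_(2 * g) = (q ^ g)%N.
Proof.
apply/eqP; rewrite -(@eqn_exp2r _ _ 2) // -expnM (mulnC g 2) -abszX L_top.
by rewrite natz absz_nat.
Qed.

Let L_le n : L`_n != 0 -> (n <= 2 * g)%N.
Proof. by apply: contraNT; rewrite -ltnNge => /L_eq0 ->. Qed.

Let a_neq0 : a%:R != 0 :> rat. Proof. by rewrite pnatr_eq0 -lt0n. Qed.

Let nz_top : L`_(2 * g) != 0.
Proof. by rewrite -absz_gt0 absL_top !expn_gt0 p_gt0. Qed.

Let V_top : V (2 * g) = g%:R.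
Proof. by rewrite VE absL_top -expnM pfactorK // natrM mulrC mulKf. Qed.

(** The functional equation gives V n = V (2g - n) + n - g. With [V_ge0], the points lie on or above
    the ordinary polygon, the graph of max(0, n - g). *)
Let V_ge n : L`_n != 0 -> n%:R - g%:R <= V n.
Proof.
move=> nz; have le_n := L_le nz.
have := congr1 absz (L_sym le_n); rewrite !abszM absL_top natz absz_nat => e.
have nz' : L`_(2 * g - n) != 0.
  apply: contraNneq nz => L'0; move: (L_sym le_n); rewrite L'0 mulr0 => /eqP.
  by rewrite mulf_eq0 (negPf nz_top) orbF.
have := congr1 (logn p) e.
rewrite !lognM ?expn_gt0 ?p_gt0 ?absz_gt0 //.
rewrite -!expnM !pfactorK // => {}e.
rewrite VE lerBlDr -(ler_pM2r (_ : 0 < a%:R)) ?ltr0n // mulrDl mulfVK //.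
by rewrite -!natrM -natrD ler_nat; lia.
Qed.

(** The points (0, 0), (g, 0) and (2g, g) are then all present. A supporting segment from i < g to j
    > g would pass strictly above (g, 0); one on the left of g must have slope 0, one on the right
    slope 1. *)
Lemma slopes_of_unit : ~~ (p %| L`_g)%Z ->
  forall s, newton_slope q L s -> s = 0 \/ s = 1.
Proof.
move=> ndvd s [i [j [lt_ij nzi nzj Vj below]]].
have nzg : L`_g != 0 by apply: contraNneq ndvd => ->; rewrite dvdz0.
have Vg : V g = 0.
  rewrite VE; have := ndvd; rewrite dvdzE /= => nd.
  have /eqP -> : logn p (absz L`_g) == 0%N.
    by rewrite -leqn0 leqNgt logn_gt0 mem_primes pr_p absz_gt0 nzg.
  by rewrite mul0r.
have := below 0%N; rewrite -/(V i) -/(V 0) V0 L0 oner_neq0 => /(_ erefl) b0.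
have := below g nzg; rewrite -/(V i) -/(V g) Vg => bg.
have := below (2 * g)%N nz_top; rewrite -/(V i) -/(V _) V_top natrM => bt.
rewrite -/(V i) -/(V j) in Vj.
have := V_ge nzi; have := V_ge nzj; have := V_ge0 i; have := V_ge0 j.
have le_i := L_le nzi; have le_j := L_le nzj.
have lij : (i%:R : rat) < j%:R by rewrite ltr_nat.
have i0 : 0 <= (i%:R : rat) by rewrite ler0n.
have jt : (j%:R : rat) <= 2 * g%:R by rewrite -natrM ler_nat.
rewrite Vj; move: (V i) b0 bg bt => v b0 bg bt vj0 vi0 vj1 vi1.
have [le_jg|lt_gj] := leqP j g.
  have {}le_jg : (j%:R : rat) <= g%:R by rewrite ler_nat.
  left; nra.
have [le_gi|lt_ig] := leqP g i.
  have {}le_gi : (g%:R : rat) <= i%:R by rewrite ler_nat.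
  right; nra.
have {}lt_gj : (g%:R : rat) < j%:R by rewrite ltr_nat.
have {}lt_ig : (i%:R : rat) < g%:R by rewrite ltr_nat.
exfalso; nra.
Qed.

(** If p divides L_g, the last index m of valuation 0 is less than g. The segment that leaves (m, 0)
    with least slope has positive slope by the choice of m, and slope at most g / (2g - m) < 1
    because of the end point (2g, g). *)
Lemma unit_of_slopes : (0 < g)%N ->
  (forall s, newton_slope q L s -> s = 0 \/ s = 1) -> ~~ (p %| L`_g)%Z.
Proof.
move=> g_gt0 slopes; apply/negP => p_dvd.
have V_eq0 n : L`_n != 0 -> V n = 0 -> (n < g)%N.
  move=> nz Vn; rewrite ltnNge leq_eqVlt; apply/negP => /orP[/eqP e|lt_gn].
    move: Vn; rewrite VE => /eqP; rewrite mulf_eq0 invr_eq0 (negPf a_neq0) orbF.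
    rewrite pnatr_eq0 -leqn0 leqNgt logn_gt0 mem_primes pr_p absz_gt0 nz -e /=.
    by rewrite -[p]absz_nat -dvdzE p_dvd.
  by have := V_ge nz; rewrite Vn subr_le0 ler_nat leqNgt lt_gn.
pose good (n : 'I_(2 * g).+1) := (L`_n != 0) && (V n == 0).
have good0 : good ord0 by rewrite /good L0 oner_neq0 -[X in V X]/0%N V0 eqxx.
case: (arg_maxnP (fun n : 'I__ => n : nat) good0) => m /andP[nz_m /eqP Vm] max_m.
have lt_mg := V_eq0 _ nz_m Vm.
pose cand (k : 'I_(2 * g).+1) := (L`_k != 0) && (m < k)%N.
pose slope (k : 'I_(2 * g).+1) : rat := V k / (k%:R - m%:R).
have cand_top : cand ord_max by rewrite /cand nz_top /=; lia.
case: (Order.TotalTheory.arg_minP slope cand_top) => k /andP[nz_k lt_mk] min_k.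
have pos (n : 'I_(2 * g).+1) : (m < n)%N -> 0 < (n%:R - m%:R : rat).
  by move=> lt_mn; rewrite subr_gt0 ltr_nat.
have slope_gt0 : 0 < slope k.
  rewrite divr_gt0 ?pos // lt_neqAle V_ge0 andbT eq_sym; apply/negP => Vk.
  by have := max_m k; rewrite /good nz_k Vk => /(_ erefl) /=; rewrite leqNgt lt_mk.
have slope_lt1 : slope k < 1.
  apply: le_lt_trans (min_k _ cand_top) _; rewrite /slope /= V_top natrM.
  have {}lt_mg : (m%:R : rat) < g%:R by rewrite ltr_nat.
  have : (0 : rat) < g%:R by rewrite ltr0n.
  by move=> ?; rewrite ltr_pdivrMr; lra.
have [] := slopes (slope k).
- exists m, k; split=> // [|n nz_n].
    by rewrite -/(V m) -/(V k) Vm add0r mulfVK // gt_eqF ?pos.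
  rewrite -/(V m) -/(V n) Vm add0r.
  have lt_n : (n < (2 * g).+1)%N by rewrite ltnS L_le.
  have [lt_mn|le_nm] := ltnP m n.
    have := min_k (Ordinal lt_n); rewrite /cand /= nz_n lt_mn => /(_ erefl) le_s.
    rewrite -ler_pdivlMr //; exact: (pos (Ordinal lt_n)).
  apply: le_trans (V_ge0 n); rewrite pmulr_rle0 // subr_le0 ler_nat //.
- by move=> s0; rewrite s0 ltxx in slope_gt0.
- by move=> s1; rewrite s1 ltxx in slope_lt1.
Qed.

End NewtonPolygon.

(** * The Hasse-Witt matrix *)

(** The tuple lists the eigenvalues with multiplicity. Completing a left eigenvector to a basis
    makes [A] block triangular, and the induction continues with the lower block. *)
Lemma closed_field_spectrum (C : closedFieldType) n (A : 'M[C]_n) :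
  exists s : n.-tuple C, (forall k, \tr (A ^+ k) = \sum_(x <- s) x ^+ k) /\
    \det A = \prod_(x <- s) x.
Proof.
elim: n A => [|n IHn] A.
  exists [tuple]; rewrite !big_nil det_mx00; split=> // k.
  by rewrite big_nil /mxtrace big_ord0.
have [a rA] : exists a, root (char_poly A) a.
  by apply/closed_rootP; rewrite size_char_poly.
have /eigenvalueP[v vA nz_v] : eigenvalue A a by rewrite eigenvalue_root_char.
pose R := row_ebase v; have Ru : R \in unitmx by apply: row_ebase_unit.
have [c nz_c def_v] : exists2 c, c != 0 & v = c *: row 0 R.
  have rk1 : \rank v = 1%N by rewrite rank_rV nz_v.
  exists (col_ebase v 0 0).
    by have := col_ebase_unit v; rewrite unitmxE det_mx11 unitfE.
  rewrite -{1}(mulmx_ebase v) rk1 -mulmxA [col_ebase v]mx11_scalar mul_scalar_mx.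
  congr (_ *: _); first by rewrite mxE mulr1n.
  apply/rowP=> j; rewrite !mxE (bigD1 0) //= big1 ?addr0 => [|i ne_i].
    by rewrite mxE /= mul1r.
  by rewrite mxE /= eq_sym (negPf (ne_i : (i : nat) != 0%N)) mul0r.
have R0A : row 0 R *m A = a *: row 0 R.
  apply: (scalerI nz_c); rewrite scalemxAl -def_v vA def_v !scalerA.
  by rewrite mulrC.
pose M : 'M_(1 + n) := R *m A *m invmx R.
have M0 : row 0 M = a *: row 0 1%:M.
  by rewrite /M !row_mul R0A -scalemxAl -row_mul mulmxV.
have AX k : A ^+ k = invmx R *m M ^+ k *m R.
  elim: k => [|k IHk]; first by rewrite !expr0 mulmx1 mulVmx.
  rewrite !exprS IHk -[A * _]/(A *m _) -[M * _]/(M *m _) /M !mulmxA.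
  by rewrite mulVmx // mul1mx.
have detM : \det M = \det A.
  rewrite /M !det_mulmx det_inv mulrAC mulfV ?mul1r //.
  by rewrite -unitfE -unitmxE.
clearbody M.
have def_M : M = block_mx a%:M 0 (dlsubmx M) (drsubmx M).
  rewrite -{1}(submxK M); congr block_mx.
    rewrite [ulsubmx M]mx11_scalar !mxE; congr (_%:M).
    have := congr1 (fun r : 'rV_(1 + n) => r 0 0) M0; rewrite !mxE eqxx mulr1.
    by move=> <-; congr (M _ _); apply: val_inj.
  apply/rowP => j; rewrite !mxE.
  have := congr1 (fun r : 'rV_(1 + n) => r 0 (rshift 1 j)) M0; rewrite !mxE /= mulr0.
  by move=> <-; congr (M _ _); apply: val_inj.
set B := drsubmx M in def_M; have [s [trB detB]] := IHn B.
have MX k : exists L, M ^+ k = block_mx (a ^+ k)%:M 0 L (B ^+ k).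
  elim: k => [|k [L IHk]].
    by exists 0; rewrite !expr0 -scalar_mx_block.
  rewrite !exprS IHk {1}def_M -[_ * block_mx _ _ _ _]/(_ *m _) mulmx_block.
  rewrite !mul0mx !mulmx0 !addr0 add0r -scalar_mxM.
  by eexists; congr block_mx.
exists [tuple of a :: s]; split=> [k|].
  rewrite big_cons -trB AX mxtrace_mulC mulmxA mulmxV // mul1mx.
  have [L ->] := MX k; rewrite mxtrace_block.
  by rewrite mxtrace_scalar mulr1n.
rewrite big_cons -detB.
by rewrite -detM def_M det_lblock det_scalar expr1.
Qed.

Section HasseWitt.

(** For [N] = p this is the Hasse-Witt (Cartier-Manin) matrix; the powers of p as values of [N] link
    it to point counts over the extensions. *)
Definition hwmx (R : comNzRingType) (f : {poly R}) (g N : nat) : 'M[R]_g :=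
  \matrix_(i, j) (f ^+ N.-1./2)`_(N * i.+1 - j.+1).

Lemma map_hwmx (R S : comNzRingType) (phi : {rmorphism R -> S}) f g N :
  map_mx phi (hwmx f g N) = hwmx (map_poly phi f) g N.
Proof. by apply/matrixP=> i j; rewrite !mxE -rmorphXn /= coef_map. Qed.

Lemma expr_pchar_comp (F : fieldType) (p r : nat) (G : {poly F}) : p \in [pchar F] ->
  G ^+ (p ^ r) = map_poly (fun x => x ^+ (p ^ r)) G \Po 'X^(p ^ r).
Proof.
move=> pF; have pr_p := pcharf_prime pF.
have N_gt0 : (0 < p ^ r)%N by rewrite expn_gt0 prime_gt0.
have pP : [pchar {poly F}].-nat (p ^ r)%N.
  by rewrite (eq_pnat _ (fun x => pchar_poly F x)) (eq_pnat _ (pcharf_eq pF)) pnatX pnat_id.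
pose phi (x : F) := x ^+ (p ^ r).
have phi0 : phi 0 = 0 by rewrite /phi expr0n gtn_eqF.
elim/poly_ind: G => [|G c IHG].
  by rewrite expr0n gtn_eqF // map_poly0 comp_poly0.
rewrite exprDn_pchar // exprMn IHG -rmorphXn /=.
have -> : map_poly phi (G * 'X + c%:P) = map_poly phi G * 'X + (phi c)%:P.
  apply/polyP=> i; rewrite coef_map_id0 // !coefD !coefMX !coefC coef_map_id0 //.
  by case: i => [|i] /=; rewrite ?add0r ?addr0 // coef_map_id0.
by rewrite comp_polyD comp_polyM comp_polyX comp_polyC.
Qed.

Variables (K : finFieldType) (p g : nat) (f : {poly K}).
Hypotheses (pK : p \in [pchar K]) (p_odd : odd p) (lt_gp : (g < p)%N).
Hypothesis sf : (size f <= 2 * g + 3)%N.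

Let pr_p : prime p := pcharf_prime pK.
Let p_gt0 : (0 < p)%N := prime_gt0 pr_p.

Lemma half_predM m n : odd m -> odd n ->
  ((m * n).-1./2 = m.-1./2 + m * n.-1./2)%N.
Proof.
move=> om on; have [m' ->] : exists m', m = m'.*2.+1.
  by exists m./2; rewrite -[LHS]odd_double_half om.
have [n' ->] : exists n', n = n'.*2.+1.
  by exists n./2; rewrite -[LHS]odd_double_half on.
by rewrite /= !doubleK; lia.
Qed.

(** With N = p^r and M = p^s, the exponent (NM - 1) / 2 is (N - 1) / 2 + N (M - 1) / 2, and an N-th
    power is a polynomial in X^N. The coefficient of the product is thus a convolution over the
    multiples of N, and the degree of [F] leaves only [g] of its terms. *)
Lemma hwmx_comp r s : (0 < r)%N -> (0 < s)%N ->
  hwmx f g (p ^ (r + s)) =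
  map_mx (fun x => x ^+ (p ^ r)) (hwmx f g (p ^ s)) *m hwmx f g (p ^ r).
Proof.
move=> r_gt0 s_gt0; apply/matrixP=> i j; rewrite !mxE.
set N := (p ^ r)%N; set M := (p ^ s)%N.
have N_gt0 : (0 < N)%N by rewrite expn_gt0 p_gt0.
have oN : odd N by rewrite oddX p_odd orbT.
have oM : odd M by rewrite oddX p_odd orbT.
have le_g k : (0 < k)%N -> (g <= p ^ k)%N.
  by move=> k_gt0; rewrite (leq_trans (ltnW lt_gp)) // -[p in (p <= _)%N]expn1 leq_pexp2l.
have le_gM := le_g s s_gt0; have le_gN := le_g r r_gt0.
rewrite expnD -/N -/M half_predM // exprD (mulnC N M.-1./2) exprM.
set F := f ^+ N.-1./2; set G := f ^+ M.-1./2.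
have sF : (size F <= g.+1 * N.-1 + 1)%N.
  rewrite (leq_trans (size_poly_exp_leq _ _)) //.
  have : (N = (N.-1./2).*2.+1)%N by rewrite -[LHS]odd_double_half oN; lia.
  by nia.
pose H := map_poly (fun x => x ^+ N) G.
pose T m := H`_m * (if (N * M * i.+1 - j.+1 < N * m)%N then 0
                    else F`_(N * M * i.+1 - j.+1 - N * m)).
have HE m : H`_m = G`_m ^+ N by rewrite coef_map_id0 // expr0n gtn_eqF.
have lt_i := ltn_ord i; have lt_j := ltn_ord j.
transitivity (\sum_(0 <= m < M * i.+1) T m).
  transitivity (\sum_(0 <= m < maxn (size H) (M * i.+1)) T m).
    rewrite (expr_pchar_comp r G pK) comp_polyE mulr_sumr coef_sum.
    rewrite (@big_cat_nat _ _ _ (size H)) ?leq_maxl //=.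
    rewrite [X in _ = _ + X]big1_seq ?addr0 => [|m]; last first.
      rewrite mem_index_iota => /and3P[_ le_m _].
      by rewrite /T nth_default // mul0r.
    rewrite big_mkord; apply: eq_bigr => m _.
    by rewrite -scalerAr coefZ -exprM [F * _]mulrC coefXnM; congr (_ * _).

  rewrite (@big_cat_nat _ _ _ (M * i.+1)) ?leq_maxr //=.
  rewrite [X in _ + X]big1_seq ?addr0 // => m.
  rewrite mem_index_iota => /and3P[_ le_m _]; rewrite /T ifT ?mulr0 //.
  by rewrite -mulnA ltn_subLR; nia.
have idx k : (k < M * i.+1)%N ->
    (N * M * i.+1 - j.+1 - N * (M * i.+1 - k.+1) = N * k.+1 - j.+1)%N.
  move=> lt_k; have : (N * k.+1 <= N * (M * i.+1))%N by rewrite leq_mul2l lt_k orbT.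
  by rewrite mulnBr -mulnA; lia.
(* Reversal puts m = M (i + 1) - (k + 1), so that the index in [F] becomes N (k + 1) - (j + 1); for
   k >= g it exceeds the degree of [F]. *)
rewrite big_nat_rev add0n (@big_cat_nat _ _ _ g) //=; last first.
  by rewrite (leq_trans le_gM) // leq_pmulr.
rewrite [X in _ + X]big1_seq ?addr0 => [|k]; last first.
  rewrite mem_index_iota => /and3P[_ le_gk lt_k]; rewrite /T idx //.
  rewrite [F`_ _]nth_default ?if_same ?mulr0 //.
  apply: leq_trans sF _.
  have : (N * g.+1 <= N * k.+1)%N by rewrite leq_mul2l ltnS le_gk orbT.
  have : (N * g.+1 = g.+1 * N.-1 + g.+1)%N by rewrite mulnC -{1}(prednK N_gt0) mulnS addnC.
  by lia.
rewrite big_mkord; apply: eq_bigr => k _; have lt_k := ltn_ord k.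
have lt_kM : (k < M * i.+1)%N.
  by rewrite (leq_trans lt_k) // (leq_trans le_gM) // leq_pmulr.
rewrite !mxE /T HE idx // ifF //; apply/negbTE; rewrite -leqNgt.
rewrite mulnBr -mulnA; have : (N * k.+1 <= N * (M * i.+1))%N by rewrite leq_mul2l lt_kM orbT.
have : (N <= N * k.+1)%N by rewrite leq_pmulr.
by lia.
Qed.

(** By [hwmx_comp] the matrix for p^(s+1) is a product of Frobenius twists of the one for p, and a
    twist preserves nonvanishing of the determinant. *)
Lemma det_hwmx s : (\det (hwmx f g (p ^ s.+1)) != 0) = (\det (hwmx f g p) != 0).
Proof.
elim: s => [|s IHs]; first by rewrite expn1.
rewrite -add1n hwmx_comp // expn1.
pose phi : {rmorphism K -> K} := pFrobenius_aut pK.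
have -> : map_mx (fun x => x ^+ p) (hwmx f g (p ^ s.+1)) =
    map_mx phi (hwmx f g (p ^ s.+1)).
  by apply/matrixP => i j; rewrite !mxE.
by rewrite det_mulmx det_map_mx mulf_eq0 negb_or fmorph_eq0 IHs andbb.
Qed.

Hypotheses (card_K : exists a, #|K| = (p ^ a.+1)%N).
Local Notation q := #|K|.

Lemma hwmx_pow n : hwmx f g (q ^ n.+1) = hwmx f g q ^+ n.+1.
Proof.
have [a card_q] := card_K; elim: n => [|n IHn]; first by rewrite expn1 expr1.
rewrite exprSr -IHn card_q -!expnM mulnS hwmx_comp ?muln_gt0 //.
congr (_ *m _); apply/matrixP => i j.
by rewrite mxE -card_q expf_card.
Qed.

End HasseWitt.

Lemma finField_card0 (E : finFieldType) : #|E|%:R = 0 :> E.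
Proof.
have [p pr_p pE] := finPcharP E; have := finNzRing_gt1 E.
rewrite (card_pprimeChar pE) natrX (pcharf0 pE) expr0n.
by case: (logn _ _).
Qed.

Lemma sum_powers (E : finFieldType) k :
  \sum_(x : E) x ^+ k = if (0 < k)%N && (#|E|.-1 %| k)%N then -1 else 0.
Proof.
case: k => [|k] /=; first by rewrite sumr_const finField_card0.
have [g [nz_g _ ord_g]] := finField_generator E.
case: ifPn => [Qk|nQk].
  rewrite (bigD1 0) //= expr0n add0r (eq_bigr (fun=> 1)) => [|x nz_x]; last first.
    case/dvdnP: Qk => m ->; rewrite mulnC exprM.
    have -> : x ^+ #|E|.-1 = 1; last by rewrite expr1n.
    apply: (mulfI nz_x); rewrite -exprS prednK ?expf_card ?mulr1 //.
    by rewrite ltnW ?finNzRing_gt1.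
  rewrite sumr_const (eq_card (B := predC1 0)) // cardC1.
  apply: (addIr 1); rewrite natr1 prednK ?finField_card0 ?addNr //.
  by rewrite ltnW ?finNzRing_gt1.
have : (g ^+ k.+1 - 1) * \sum_(x : E) x ^+ k.+1 = 0.
  rewrite mulrBl mul1r [X in _ - X](reindex_inj (mulfI nz_g)) mulr_sumr.
  by apply/eqP; rewrite subr_eq0; apply/eqP/eq_bigr => x _; rewrite exprMn.
by move/eqP; rewrite mulf_eq0 subr_eq0 ord_g (negPf nQk) => /eqP.
Qed.

Lemma sum_horner (E : finFieldType) (h : {poly E}) N :
  (size h <= N.+1 * #|E|.-1)%N ->
  \sum_(x : E) h.[x] = - \sum_(1 <= i < N.+1) h`_(i * #|E|.-1).
Proof.
set Q := #|E|.-1 => sh; have Q_gt0 : (0 < Q)%N.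
  by rewrite /Q; move: (finNzRing_gt1 E); case: #|_| => [|[|]].
pose M := (N.+1 * Q)%N; have M_gt0 : (0 < M)%N by rewrite muln_gt0.
transitivity (\sum_(0 <= j < M) h`_j * \sum_(x : E) x ^+ j).
  under eq_bigr => x _ do rewrite (horner_coef_wide x sh).
  by rewrite exchange_big big_mkord; apply: eq_bigr => j _; rewrite mulr_sumr.
rewrite big_ltn // sum_powers /= mulr0 add0r -sumrN.
transitivity (\sum_(1 <= j < M.-1.+1 | (Q %| j)%N) - h`_j).
  rewrite prednK // [RHS]big_mkcond; apply: eq_big_nat => j /andP[j_gt0 _].
  by rewrite sum_powers j_gt0 /=; case: ifP => _; rewrite ?mulr0 ?mulrN1.
rewrite (sum_multiples _ (fun j => - h`_j)) // prednK //.
have le_NM : (N.+1 <= M)%N by rewrite leq_pmulr.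
rewrite (@big_cat_nat _ _ _ N.+1) //= [X in _ + X]big1_seq ?addr0 => [|j]; last first.
  rewrite mem_index_iota => /and3P[_ lt_Nj _]; rewrite ifF //.
  apply/negbTE; rewrite -ltnNge -ltnS prednK // ltnS /M leq_mul2r lt_Nj orbT //.
apply: eq_big_nat => j /andP[_ le_jN]; rewrite ifT //.
by rewrite -ltnS prednK // /M ltn_mul2r Q_gt0.
Qed.

Lemma prod_one_sub_lead (C : idomainType) (s : seq C) :
  (size (\prod_(x <- s) (1 - x *: 'X))%R <= (size s).+1)%N /\
  (\prod_(x <- s) (1 - x *: 'X))`_(size s) = (-1) ^+ size s * \prod_(x <- s) x.
Proof.
elim: s => [|x s [IHs IHc]]; first by rewrite !big_nil size_poly1 coef1 mul1r.
rewrite !big_cons /=; set M := \prod_(y <- s) _ in IHs IHc *; split.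
  rewrite (leq_trans (size_polyMleq _ _)) //.
  have : (size (1 - x *: 'X : {poly C})%R <= 2)%N.
    rewrite (leq_trans (size_polyD _ _)) // geq_max size_poly1 size_polyN.
    by rewrite (leq_trans (size_scale_leq _ _)) // size_polyX.
  by move: (size M) IHs; lia.
rewrite mulrBl mul1r -scalerAl coefB coefZ coefXM nth_default // IHc exprS /=; ring.
Qed.

(** * Traces of the Hasse-Witt matrix and ordinarity *)

Section TraceFormula.

Variables (K : finFieldType) (p g d : nat) (f : {poly K}).
Hypotheses (pK : p \in [pchar K]) (p_odd : odd p) (lt_gp : (g < p)%N).
Hypotheses (fm : f \is monic) (sepf : coprimep f f^`()).
Hypotheses (sf : size f = d.+1) (hd : d = (2 * g + 1)%N \/ d = (2 * g + 2)%N).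

Local Notation q := #|K|.

Let pr_p : prime p := pcharf_prime pK.

Let K2 : (2%:R : K) != 0.
Proof.
rewrite -(dvdn_pcharf pK) gtnNdvd //.
by move: (prime_gt1 pr_p) p_odd; case: (p) => [|[|[|]]].
Qed.

Let card_K : exists a, q = (p ^ a.+1)%N.
Proof.
have := finNzRing_gt1 K; rewrite (card_pprimeChar pK).
by case: (logn _ _) => // a _; exists a.
Qed.

(** Summing f(x)^((Q-1)/2) over [E], with Q its cardinality, selects the coefficients at positive
    multiples of Q - 1. The first g of them are the diagonal of [hwmx]. For even [d] the one at (g +
    1) (Q - 1) is the leading coefficient 1, which cancels the second point at infinity. *)
Lemma lsum_trace n : (lsum f d n.+1)%:~R = - \tr (hwmx f g q ^+ n.+1) :> K.
Proof.
have [E [iota cardE]] := exists_ext_card K (ltn0Sn n).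
have E2 : (2%:R : E) != 0 by rewrite -(rmorph_nat iota) fmorph_eq0.
have Q_gt0 : (0 < #|E|)%N by rewrite ltnW ?finNzRing_gt1.
have oQ : odd #|E| := odd_card E2.
set fE := map_poly iota f; set h := fE ^+ #|E|.-1./2.
have fEm : fE \is monic by rewrite map_monic.
have sh : size h = (d * #|E|.-1./2).+1.
  by rewrite size_monicX // size_map_poly sf.
have QE := card_predE E2.
pose N := (g + ~~ odd d)%N.
have def_d : d = (2 * g + 1 + ~~ odd d)%N.
  have e2g : odd (2 * g) = false by rewrite mul2n odd_double.
  by case: hd => ->; rewrite oddD e2g /= ?addn0 // -addnA.
have sum_f : (\sum_(x : E) qchar fE.[x])%:~R = - \sum_(1 <= i < N.+1) h`_(i * #|E|.-1).
  rewrite rmorph_sum /= -sum_horner; last first.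
    rewrite sh QE /N; have := half_card_gt0 E2; move: (#|E|.-1./2) => m m_gt0.
    by move: def_d; case: (odd d) => /= ->; nia.
  by apply: eq_bigr => x _; rewrite qcharE // horner_exp.
have trE : iota (\tr (hwmx f g q ^+ n.+1)) = \sum_(1 <= i < g.+1) h`_(i * #|E|.-1).
  rewrite -(hwmx_pow pK p_odd lt_gp) // -?cardE; last by rewrite sf; lia.
  rewrite -[LHS]trace_map_mx map_hwmx /mxtrace big_add1 /= big_mkord.
  apply: eq_bigr => i _; rewrite mxE; congr (_`_ _).
  by rewrite -{1}(prednK Q_gt0) mulSn addnC addnK mulnC.
apply: (fmorph_inj iota); rewrite rmorph_int rmorphN /= trE /lsum rmorphD /=.
rewrite -(psum_points K2 fm sepf iota cardE) sum_f /N; case def_o: (odd d) => /=.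
  by rewrite addn0 addr0.
rewrite addn1 big_nat_recr //= rmorph1.
have -> : h`_(g.+1 * #|E|.-1) = 1.
  have := monicP (monic_exp (#|E|.-1./2) fEm); rewrite lead_coefE -/h sh /=.
  move=> <-; congr (_`_ _); rewrite [in LHS]QE def_d def_o /=; lia.
by rewrite opprD subrK.
Qed.

(** The [lcoef] and the coefficients of the product over the eigenvalues of the matrix satisfy the
    same Newton identities in characteristic p, hence agree up to degree g < p. *)
Lemma lcoef_mod : (lcoef f d g)%:~R = (-1) ^+ g * \det (hwmx f g q) :> K.
Proof.
have [C [jota _]] := countable_algebraic_closure K.
have [s [trs dets]] := closed_field_spectrum (map_mx jota (hwmx f g q)).
pose l n : C := (lcoef f d n)%:~R.
pose l' n : C := (\prod_(x <- s) (1 - x *: 'X))`_n.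
apply: (fmorph_inj jota); rewrite rmorph_int rmorphM rmorphXn rmorphN1 /=.
rewrite -det_map_mx dets; have := (prod_one_sub_lead s).2; rewrite size_tuple => <-.
apply: (@newton_eq C g l l' (fun k => \sum_(x <- s) x ^+ k)) => // [|n lt_ng|n _|n _].
- rewrite /l (lcoef0 K2 fm sepf sf) /l' -horner_coef0 horner_prod big1 // => x _.
  by rewrite !hornerE subr0.
- rewrite -(rmorph_nat jota) fmorph_eq0 -(dvdn_pcharf pK) gtnNdvd //; lia.
- have := lcoef_newton d K2 fm sepf n.+1; move/(congr1 (intr : int -> C)).
  rewrite big_add1 rmorphM rmorph_nat rmorph_sum -sumrN /= /l => ->.
  apply: eq_bigr => k _; rewrite subSS rmorphM /= -mulNr; congr (_ * _).
  rewrite -(rmorph_int jota) lsum_trace rmorphN /= -trs; congr (- _).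
  by rewrite -trace_map_mx; congr (\tr _); apply: rmorphXn.
- exact: newton_prod.
Qed.

Lemma ordinary_hwmx : (0 < g)%N -> ordinary_hyp f <-> \det (hwmx f g p) != 0.
Proof.
move=> g_gt0; have [a card_q] := card_K.
have ndvdE : (~~ (p %| lcoef f d g)%Z) = (\det (hwmx f g p) != 0).
  have sf3 : (size f <= 2 * g + 3)%N by rewrite sf; lia.
  rewrite -(det_hwmx pK p_odd lt_gp sf3 a) -card_q; congr (~~ _).
  have : ((lcoef f d g)%:~R == 0 :> K) = (\det (hwmx f g q) == 0).
    by rewrite lcoef_mod mulf_eq0 expf_eq0 oppr_eq0 oner_eq0 andbF.
  move <-; rewrite dvdzE absz_nat (dvdn_pcharf pK).
  by rewrite [in RHS](intEsign (lcoef f d g)) rmorphM rmorph_sign mulf_eq0 signr_eq0.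
have LE L : is_Lpoly f L ->
    (forall s, newton_slope q L s -> s = 0 \/ s = 1) <-> ~~ (p %| lcoef f d g)%Z.
  move=> isL; have L_l := Lpoly_unique K2 fm sepf sf hd isL.
  have L0 : L`_0 = 1 by rewrite L_l (lcoef0 K2 fm sepf sf).
  have L_eq0 n : (2 * g < n)%N -> L`_n = 0.
    by rewrite L_l; apply: lcoef_eq0 K2 fm sepf sf hd _.
  have L_top : L`_(2 * g) ^+ 2 = ((p ^ a.+1) ^ (2 * g))%:R.
    by rewrite L_l (lcoef_top_sqr K2 fm sepf sf hd) card_q.
  have L_sym n : (n <= 2 * g)%N ->
      L`_n * L`_(2 * g) = ((p ^ a.+1) ^ n)%:R * L`_(2 * g - n).
    by move=> le_n; rewrite !L_l (lcoef_sym K2 fm sepf sf hd) // card_q.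
  rewrite card_q -L_l; split.
    exact: (unit_of_slopes pr_p (ltn0Sn a) L0 L_eq0 L_top L_sym g_gt0).
  exact: (slopes_of_unit pr_p (ltn0Sn a) L0 L_eq0 L_top L_sym).
rewrite -ndvdE; split=> [[L isL slopes]|ndvd]; first exact/(LE L isL).
have [L isL] := Lpoly_exists K2 fm sepf sf hd.
by exists L => //; apply/(LE L isL).
Qed.

End TraceFormula.

(** * The Hasse-Witt determinant of the trinomial family *)

Section TrinomialCoefficients.

Variables (R : comNzRingType) (D : nat) (a : R).
Hypothesis D_gt0 : (0 < D)%N.

Local Notation binom := ('X^(D.+1) + a *: 'X : {poly R}).

Lemma coef_binomial_exp k n :
  (binom ^+ k)`_n =
  \sum_(e < k.+1) if (n == k + D * e)%N then a ^+ (k - e) *+ 'C(k, e) else 0.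
Proof.
rewrite addrC exprDn coef_sum; apply: eq_bigr => e _.
rewrite coefMn -exprM exprZn -scalerAl coefZ -exprD coefXn.
have -> : (k - e + D.+1 * e = k + D * e)%N.
  by have := ltn_ord e; rewrite ltnS => le_ek; rewrite mulSn addnA subnK.
by case: eqP => _; rewrite ?mulr1 // mulr0 mul0rn.
Qed.

Lemma coef_binomial_exp_eq0 k n :
  (forall e, n <> (k + D * e)%N) -> (binom ^+ k)`_n = 0.
Proof.
by move=> ne; rewrite coef_binomial_exp big1 // => e _; case: eqP => // /ne.
Qed.

Lemma coef_binomial_expE k A :
  (binom ^+ k)`_(k + D * A) = a ^+ (k - A) *+ 'C(k, A).
Proof.
rewrite coef_binomial_exp.
under eq_bigr do rewrite eqn_add2l eqn_pmul2l //.
have [lt_kA|le_Ak] := ltnP k A.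
  rewrite bin_small // mulr0n big1 // => e _; case: eqP => // def_A.
  by have := ltn_ord e; rewrite ltnS leqNgt -def_A lt_kA.
have lt_A : (A < k.+1)%N by [].
rewrite (bigD1 (Ordinal lt_A)) //= eqxx big1 ?addr0 // => e ne_e.
by case: eqP => // def_A; case/eqP: ne_e; apply: val_inj.
Qed.

Lemma coef_trinomial_exp m n c :
  ((trinomial D.+1 a%:P 'X ^+ m)`_n)`_c =
  if (c <= m)%N then (binom ^+ (m - c))`_n *+ 'C(m, c) else 0.
Proof.
have -> : trinomial D.+1 a%:P 'X = map_poly polyC binom + 'X%:P.
  by rewrite /trinomial rmorphD /= map_polyXn map_polyZ /= map_polyX.
rewrite exprDn !coef_sum.
pose T i := if i == c then (binom ^+ (m - i))`_n *+ 'C(m, i) else 0.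
transitivity (\sum_(i < m.+1) T i).
  apply: eq_bigr => i _; rewrite coefMn -!rmorphXn /= coefMC coef_map /=.
  rewrite coefMn coefCM coefXn /T eq_sym.
  by case: eqP => _; rewrite ?mulr1 // mulr0 mul0rn.
case: leqP => [le_cm|lt_mc].
  have lt_c : (c < m.+1)%N by [].
  rewrite (bigD1 (Ordinal lt_c)) //= {1}/T eqxx big1 ?addr0 // => i ne_i.
  by rewrite /T ifN.
by rewrite big1 // => i _; rewrite /T ifN // ltn_eqF // (leq_trans (ltn_ord i)).
Qed.

End TrinomialCoefficients.

(** * A determinant of products of linear factors *)

Section BinomialDeterminant.

Variables (F : fieldType) (g : nat) (mu nu : F).

(* Evaluating a vanishing combination of these polynomials at the least [j]
   that occurs kills all the other terms. *)
Definition kratt (j : nat) : {poly F} :=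
  \prod_(0 <= l < j) ('X - l%:R%:P) *
  \prod_(j.+1 <= l < g) (mu *: 'X + (nu + l%:R)%:P).

Lemma size_kratt j : (j < g)%N -> (size (kratt j) <= g)%N.
Proof.
move=> lt_jg; have lin l : (size (mu *: 'X + (nu + l%:R)%:P)%R <= 2)%N.
  rewrite (leq_trans (size_polyD _ _)) // geq_max (leq_trans (size_scale_leq _ _)) ?size_polyX //.
  by rewrite (leq_trans (size_polyC_leq1 _)).
have szprod (s : seq nat) (G : nat -> {poly F}) : (forall l, (size (G l) <= 2)%N) ->
    (size (\prod_(l <- s) G l)%R <= (size s).+1)%N.
  move=> szG; elim: s => [|l s IHs]; first by rewrite big_nil size_poly1.
  rewrite big_cons (leq_trans (size_polyMleq _ _)) //=.
  by move: (size _) IHs (size _) (szG l) => m le_m k le_k; lia.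
rewrite (leq_trans (size_polyMleq _ _)) //.
have := szprod (index_iota 0 j) (fun l => 'X - l%:R%:P) (fun l => eq_leq (size_XsubC _)).
have := szprod (index_iota j.+1 g) _ lin.
rewrite !size_iota; move: (size _) => m le_m; move: (size _) => k le_k; lia.
Qed.

Lemma kratt_nonsingular (x : 'I_g -> F) :
  injective x ->
  (forall j, (j < g)%N -> j`!%:R != 0 :> F) ->
  (forall j l, (j < l < g)%N -> mu * j%:R + nu + l%:R != 0) ->
  \det (\matrix_(i < g, j < g) (kratt (g - j.+1)).[x i]) != 0.
Proof.
move=> inj_x nz_fact nz_lin; rewrite -det_tr; apply/negP => /det0P[v nz_v vP].
pose Q : {poly F} := \sum_(j < g) v 0 j *: kratt (g - j.+1).
have rQ i : root Q (x i).
  have := congr1 (fun r : 'rV_g => r 0 i) vP; rewrite !mxE => e.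
  rewrite rootE; apply/eqP; rewrite -[RHS]e /Q horner_sum; apply: eq_bigr => j _.
  by rewrite hornerZ !mxE.
have Q0 : Q = 0.
  apply: (@roots_geq_poly_eq0 _ _ [seq x i | i <- enum 'I_g]).
  - by apply/allP => _ /mapP[i _ ->].
  - by rewrite map_inj_uniq ?enum_uniq.
  rewrite size_map size_enum_ord (leq_trans (size_sum _ _ _)) //.
  apply/bigmax_leqP => j _; rewrite (leq_trans (size_scale_leq _ _)) // size_kratt //.
  by have := ltn_ord j; lia.
have [j0 vj0] : exists j, v 0 j != 0.
  apply/existsP; apply: contraNT nz_v => /existsPn v0.
  by apply/eqP/rowP => j; rewrite mxE; apply/eqP; rewrite -[_ == _]negbK v0.
case: (@arg_maxnP _ j0 (fun j => v 0 j != 0) (fun j : 'I_g => j : nat) vj0) => j vj max_j.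
have lt_j := ltn_ord j.
have := congr1 (fun q : {poly F} => q.[(g - j.+1)%:R]) Q0; rewrite horner0.
rewrite /Q horner_sum (bigD1 j) //= [X in _ + X]big1 ?addr0 => [|k ne_kj]; last first.
  have [->|vk] := eqVneq (v 0 k) 0; first by rewrite scale0r horner0.
  have lt_kj : (k < j)%N by rewrite ltn_neqAle ne_kj; apply: max_j.
  rewrite hornerZ hornerM horner_prod (bigD1_seq (g - j.+1)%N) ?iota_uniq //=; last first.
    by rewrite mem_index_iota; lia.
  by rewrite hornerXsubC subrr !mul0r mulr0.
apply/eqP; rewrite hornerZ mulf_neq0 // hornerM mulf_neq0 //.
  rewrite horner_prod big_nat; set k := (g - j.+1)%N.
  have -> : \prod_(0 <= l < k | (0 <= l < k)%N) ('X - l%:R%:P).[k%:R] = k`!%:R :> F.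
    rewrite fact_prod natr_prod -big_nat.
    rewrite [RHS]big_add1 [LHS]big_nat_rev add0n /=.
    apply: eq_big_nat => l lt_lk; rewrite hornerXsubC -natrB; last by lia.
    by congr (_%:R); lia.
  by apply: nz_fact; rewrite /k; lia.
rewrite horner_prod prodf_seq_neq0; apply/allP => l.
rewrite mem_index_iota => lt_l /=.
by rewrite !hornerE nz_lin.
Qed.

End BinomialDeterminant.

Lemma det_scale (R : comNzRingType) n (u v : 'I_n -> R) (A : 'M[R]_n) :
  \det (\matrix_(i, j) (u i * A i j * v j)) = \prod_i u i * \det A * \prod_j v j.
Proof.
have -> : \matrix_(i, j) (u i * A i j * v j) =
    diag_mx (\row_i u i) *m A *m diag_mx (\row_j v j).
  by apply/matrixP=> i j; rewrite mul_mx_diag mul_diag_mx !mxE.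
rewrite !det_mulmx !det_diag; congr (_ * _ * _);
  by apply: eq_bigr => i _; rewrite mxE.
Qed.

Lemma bin_swap m c A :
  ('C(m, c) * 'C(m - c, A) = 'C(m, A) * 'C(m - A, c))%N.
Proof.
have [le_s|lt_s] := leqP (c + A) m; last first.
  have [le_cm|lt_mc] := leqP c m; last first.
    by rewrite bin_small // [X in (_ = _ * X)%N]bin_small ?muln0 //; lia.
  rewrite [X in (_ * X = _)%N]bin_small ?muln0; last by lia.
  have [le_Am|lt_mA] := leqP A m; last by rewrite bin_small.
  by rewrite [X in (_ = _ * X)%N]bin_small ?muln0 //; lia.
apply/eqP; rewrite -(@eqn_pmul2r (c`! * (A`! * (m - c - A)`!))) ?muln_gt0 ?fact_gt0 //.
rewrite mulnACA bin_fact; last by lia.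
rewrite -mulnA bin_fact; last by lia.
rewrite [(c`! * _)%N]mulnCA subnAC mulnACA bin_fact; last by lia.
by rewrite -mulnA bin_fact //; lia.
Qed.

Section FallingFactorials.

Variable R : comNzRingType.

Lemma natr_ffact n m : (n ^_ m)%:R = \prod_(0 <= s < m) (n%:R - s%:R) :> R.
Proof.
elim: m => [|m IHm]; first by rewrite big_geq.
rewrite ffactnSr natrM IHm big_nat_recr //=.
have [le_mn|lt_nm] := leqP m n; first by rewrite natrB.
by rewrite -IHm ffact_small // !mul0r.
Qed.

(** k! C(M, k - j) is a product of two falling factorials, the second over j < l <= k. Changing this
    range to j < l < g adds factors on the left if k < g and leaves surplus ones on the right if k
    >= g; both depend on the row only. *)
Lemma binomial_kratt (M k j g : nat) : (j < g)%N ->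
  k`!%:R * (if (j <= k)%N then 'C(M, k - j) else 0%N)%:R *
    \prod_(k.+1 <= l < g) (M%:R - k%:R + l%:R) =
  \prod_(0 <= l < j) (k%:R - l%:R) * \prod_(j.+1 <= l < g) (M%:R - k%:R + l%:R) *
    \prod_(g <= l < k.+1) (M%:R - k%:R + l%:R) :> R.
Proof.
move=> lt_jg; case: leqP => [le_jk|lt_kj]; last first.
  rewrite mulr0 mul0r (bigD1_seq k) ?iota_uniq ?mem_index_iota //=.
  by rewrite subrr !mul0r.
pose T l : R := M%:R - k%:R + l%:R.
have ffactE : k`!%:R * 'C(M, k - j)%:R =
    \prod_(0 <= l < j) (k%:R - l%:R) * \prod_(j.+1 <= l < k.+1) T l :> R.
  rewrite -natrM -(ffact_fact le_jk) -mulnA [X in (_ * X)%N]mulnC bin_ffact.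
  rewrite natrM !natr_ffact; congr (_ * _).
  rewrite [RHS]big_nat_rev -[X in _ = \prod_(X <= _ < _) _]add0n big_addn subSS.
  apply: eq_big_nat => s lt_s; rewrite /T.
  have -> : (j.+1 + k.+1 - (s + j.+1).+1 = k - s)%N by lia.
  by rewrite natrB; [ring | lia].
rewrite ffactE -!mulrA; congr (_ * _).
have [lt_kg|le_gk] := ltnP k g.
  rewrite [X in _ = _ * X]big_geq ?mulr1; last by lia.
  by rewrite -big_cat_nat //=; lia.
rewrite [X in _ * X = _]big_geq ?mulr1; last by lia.
by rewrite -big_cat_nat //=; lia.
Qed.

End FallingFactorials.

(** * Integers prime to p above the bound *)

Section Arithmetic.

Variables (g d p : nat).
Hypotheses (hg : (2 <= g)%N) (hd : d = (2 * g + 1)%N \/ d = (2 * g + 2)%N).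
Hypotheses (pr_p : prime p) (hpP : (Pplus d < p)%N).

(** In terms of g, P^+(d) is 4g(g - 1) - 1 for odd [d] and g(2g + 1) for even [d]. *)
Lemma Pplus_bound : if odd d then (4 * g * (g - 1) <= p)%N else (g * (2 * g + 1) < p)%N.
Proof.
have e2g : odd (2 * g) = false by rewrite mul2n odd_double.
move: hpP; rewrite /Pplus; case: hd => ->; rewrite oddD e2g /=.
  by rewrite expnS expn1 mulnBr; nia.
rewrite ltn_divLR // expnS expn1; nia.
Qed.

Lemma Pplus_lt_bounds : [/\ (2 * d - 3 <= p)%N, (g < p)%N & (d < p)%N].
Proof.
have := Pplus_bound; have e2g : odd (2 * g) = false by rewrite mul2n odd_double.
by case: hd => ->; rewrite oddD e2g /= => le_p; split; nia.
Qed.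

Lemma ndvd_range x : (0 < x < p)%N -> ~~ (p %| x)%N.
Proof. by case/andP=> x_gt0 lt_xp; apply/negP => /(dvdn_leq x_gt0); rewrite leqNgt lt_xp. Qed.

Lemma odd_char : odd p.
Proof.
case: (even_prime pr_p) => // p2; have [] := Pplus_lt_bounds; rewrite p2; case: hd; lia.
Qed.

Lemma ndvd_double x : ~~ (p %| x)%N -> ~~ (p %| 2 * x)%N.
Proof.
move=> npx; rewrite Euclid_dvdM // negb_or npx andbT ndvd_range //.
have := odd_char; have := prime_gt1 pr_p; case: (p) => [|[|[|]]] //.
Qed.

(** The integer is 2(d - 1) times the factor mu j + nu + l of [kratt]. For odd [d] its maximum, at j
    = 0 and l = g - 1, is exactly P^+(d). *)
Lemma ndvd_linear j l : (j < l < g)%N ->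
  ~~ (p %| 2 * d.-1 * (l - j) + 2 * (g - j) - d)%N.
Proof.
move=> /andP[lt_jl lt_lg]; have := Pplus_bound.
have e2g : odd (2 * g) = false by rewrite mul2n odd_double.
have [u [def_u u_gt0 le_u]] : exists u, [/\ (l - j = u)%N, (0 < u)%N & (u <= g - 1 - j)%N].
  by exists (l - j)%N; split=> //; lia.
case: hd => ->; rewrite oddD e2g /= => le_p; rewrite def_u.
  apply: ndvd_range; have -> : ((2 * g + 1).-1 = 2 * g)%N by lia.
  have : (g * u <= g * (g - 1))%N by rewrite leq_mul2l; apply/orP; right; lia.
  have : (g <= g * u)%N by rewrite leq_pmulr.
  by lia.
have -> : (2 * (2 * g + 2).-1 * u + 2 * (g - j) - (2 * g + 2) =
   2 * ((2 * g + 1) * u - j.+1))%N.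
  have -> : ((2 * g + 2).-1 = 2 * g + 1)%N by lia.
  rewrite -mulnA mulnBr; lia.
apply: ndvd_double; apply: ndvd_range.
have : (g * u <= g * (g - 1))%N by rewrite leq_mul2l; apply/orP; right; lia.
have : (g <= g * u)%N by rewrite leq_pmulr.
by rewrite mulnDl mul1n; nia.
Qed.

(** The integer is -2(d - 1) times a surplus factor of [binomial_kratt], with s = k - l. All values
    but the largest are at most P^+(d), or twice that for even [d]. *)
Lemma ndvd_falling k s : (k < d.-1)%N -> (g + s <= k)%N ->
  ~~ (p %| 2 * d.-1 * s + 2 * k + d - 2 * g)%N.
Proof.
move=> lt_k le_s; have := Pplus_bound.
have e2g : odd (2 * g) = false by rewrite mul2n odd_double.
move: lt_k; case: hd => ->; rewrite oddD e2g /= => lt_k le_p.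
  have -> : ((2 * g + 1).-1 = 2 * g)%N by lia.
  have [le_sg|lt_gs] := leqP s (g - 2).
    apply: ndvd_range; have : (g * s <= g * (g - 2))%N by rewrite leq_mul2l le_sg orbT.
    by nia.
  (* The largest value exceeds the bound, but it factors into integers smaller than p. *)
  have -> : s = (g - 1)%N by lia.
  have -> : k = (2 * g - 1)%N by lia.
  have -> : (2 * (2 * g) * (g - 1) + 2 * (2 * g - 1) + (2 * g + 1) - 2 * g =
     (2 * g - 1) * (2 * g + 1))%N by nia.
  by rewrite Euclid_dvdM // negb_or !ndvd_range //; nia.
have -> : (2 * (2 * g + 2).-1 * s + 2 * k + (2 * g + 2) - 2 * g =
    2 * ((2 * g + 1) * s + k + 1))%N.
  have -> : ((2 * g + 2).-1 = 2 * g + 1)%N by lia.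
  by lia.
apply: ndvd_double; have [le_sg|lt_gs] := leqP s (g - 1).
  apply: ndvd_range; have : (g * s <= g * (g - 1))%N by rewrite leq_mul2l le_sg orbT.
  by nia.
have -> : s = g by lia.
have -> : k = (2 * g)%N by lia.
have -> : ((2 * g + 1) * g + 2 * g + 1 = (2 * g + 1) * (g + 1))%N by lia.
by rewrite Euclid_dvdM // negb_or !ndvd_range //; nia.
Qed.

End Arithmetic.

Section GenericHasseWitt.

Variables (F : fieldType) (g d p : nat) (a : F).
Hypotheses (hg : (2 <= g)%N) (hd : d = (2 * g + 1)%N \/ d = (2 * g + 2)%N).
Hypotheses (pF : p \in [pchar F]) (hpP : (Pplus d < p)%N) (nz_a : a != 0).

Let pr_p : prime p := pcharf_prime pF.
Let D := d.-1.
Let m := p.-1./2.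

Let dE : d = D.+1. Proof. by rewrite /D prednK //; lia. Qed.
Let pE : p = (2 * m + 1)%N.
Proof.
have := odd_char hg hd pr_p hpP; rewrite /m => op.
by rewrite -[LHS]odd_double_half op; case: (p) op => //= k; lia.
Qed.
Let nz_nat x : ~~ (p %| x)%N -> x%:R != 0 :> F.
Proof. by rewrite (dvdn_pcharf pF). Qed.

Let le_p : (2 * D - 1 <= p)%N /\ (g < p)%N /\ (d < p)%N.
Proof. by have [? ? ?] := Pplus_lt_bounds hg hd pr_p hpP; split; [rewrite /D; lia | split]. Qed.

Let D_gt0 : (0 < D)%N. Proof. by rewrite /D; lia. Qed.

(** The monomial t^c (x^d)^e (a x)^(m-c-e) has degree D e + m - c in x. So A_i is the number of
    factors x^d in the term of least t-degree, and k_i - (g - 1 - j) that t-degree. *)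
Lemma row_data (i : 'I_g) : exists Ak : nat * nat,
  [/\ (p * i.+1 + Ak.2 = D * Ak.1 + m + g)%N, (Ak.2 < D)%N & (Ak.1 <= m)%N].
Proof.
have [leD [ltg ltd]] := le_p.
have le_g : (m + g <= p * i.+1)%N by rewrite (leq_trans (_ : _ <= p)%N) ?leq_pmulr //; lia.
(* Adding D - 1 turns the division into one that rounds up. *)
pose B := (p * i.+1 - (m + g) + D.-1)%N; exists (B %/ D, D.-1 - B %% D)%N => /=.
have := ltn_pmod B D_gt0; have := divn_eq B D; rewrite mulnC.
move: (B %/ D)%N (B %% D)%N => A r BE lt_r.
have eqA : (p * i.+1 + (D.-1 - r) = D * A + m + g)%N by move: BE; rewrite /B; lia.
split=> //; first by lia.
rewrite -ltnS -(ltn_pmul2l D_gt0).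
have : (p * i.+1 <= p * g)%N by rewrite leq_mul2l ltn_ord orbT.
have : (2 * m * g <= D * m)%N by rewrite mulnAC leq_mul2r /D; apply/orP; right; lia.
move: eqA; rewrite mulnS [in (p * g)%N]pE mulnDl mul1n; lia.
Qed.

(* Every exponent of [t] in the entry [(i, j)] is congruent to
   [k i - (g - 1 - j)] modulo [D], and is at least that as [k i < D].  So scaling
   rows and columns by powers of [t] leaves, at [t = 0], a matrix of binomials. *)
Variables (A k : 'I_g -> nat).
Hypothesis Ak_eq : forall i : 'I_g, (p * i.+1 + k i = D * A i + m + g)%N.
Hypothesis k_lt : forall i, (k i < D)%N.
Hypothesis A_le : forall i, (A i <= m)%N.

Let p0 : (2 * m + 1)%:R = 0 :> F. Proof. by rewrite -pE pcharf0. Qed.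

Let nz2 : 2%:R != 0 :> F.
Proof. by apply/nz_nat/ndvd_range; have := prime_gt1 pr_p; rewrite pE; lia. Qed.

Let nzD : D%:R != 0 :> F.
Proof. by apply/nz_nat/ndvd_range; move: le_p; rewrite D_gt0 /D; lia. Qed.

Let mu : F := - (d%:R / D%:R).
Let nu : F := ((2 * g)%:R - d%:R) / (2 * D)%:R.

(** Clears the denominators of [mu] and [nu], to reach the integers of [ndvd_linear] and
    [ndvd_falling]. *)
Let scale_linear (x : F) l : (2 * D)%:R * (mu * x + nu + l%:R) =
  (2 * g)%:R - d%:R - (2 * d)%:R * x + (2 * D * l)%:R.
Proof.
have nz2D : (2 * D)%:R != 0 :> F by rewrite natrM mulf_neq0.
by rewrite 2!mulrDr /nu [X in _ + X + _]mulrC mulfVK // /mu !natrM; field.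
Qed.

Lemma ndvd_fact n : (n < p)%N -> ~~ (p %| n`!)%N.
Proof.
elim: n => [|n IHn] lt_np; first by rewrite fact0 ndvd_range ?prime_gt1.
by rewrite factS Euclid_dvdM // negb_or IHn ?ndvd_range // ltnW.
Qed.

(** Modulo p, m is -1/2 and [Ak_eq] reads D A_i = k_i - m - g; eliminating m and A_i produces [mu]
    and [nu]. *)
Lemma row_linear i : (m - A i)%:R - (k i)%:R = mu * (k i)%:R + nu :> F.
Proof.
apply: (mulfI (_ : (2 * D)%:R != 0)); first by rewrite natrM mulf_neq0.
have -> : (2 * D)%:R * (mu * (k i)%:R + nu) =
    - (2 * d * k i)%:R + (2 * g)%:R - d%:R :> F.
  by have := scale_linear (k i)%:R 0; rewrite muln0 !addr0 => ->; rewrite natrM; ring.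
have := congr1 (fun n => n%:R : F) (Ak_eq i).
rewrite natrB ?A_le // dE -natr1 !natrM !natrD natrM [in p%:R]pE p0 mul0r add0r => e.
have -> : (2%:R * D%:R) * (m%:R - (A i)%:R - (k i)%:R) =
  2%:R * m%:R * D%:R - 2%:R * (D%:R * (A i)%:R) - 2%:R * D%:R * (k i)%:R :> F by ring.
have -> : D%:R * (A i)%:R = (k i)%:R - m%:R - g%:R :> F by rewrite e; ring.
have p0' : 2%:R * m%:R = -1 :> F.
  by apply/eqP; rewrite -subr_eq0 opprK -natrM natr1 -addn1 p0.
have -> : 2%:R * ((k i)%:R - m%:R - g%:R) = 2%:R * (k i)%:R - (2%:R * m%:R) - 2%:R * g%:R :> F.
  by ring.
by rewrite p0' -!natr1; ring.
Qed.

(** As the k_i are below D < p, congruent ones are equal. Then [Ak_eq] shows that D divides p (i -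
    j), and D is prime to p and larger than g. *)
Lemma k_inj : injective (fun i => (k i)%:R : F).
Proof.
have [leD [ltg ltd]] := le_p.
suff main i j : (k i <= k j)%N -> (k i)%:R = (k j)%:R :> F -> i = j.
  by move=> i j e; case/orP: (leq_total (k i) (k j)) => le_k; [|apply: esym]; apply: main.
move=> le_k e; have : (p %| k j - k i)%N.
  by rewrite (dvdn_pcharf pF) natrB // e subrr.
have lt_kj := k_lt j; case: (posnP (k j - k i)) => [k0 _|k_gt0]; last first.
  by rewrite gtnNdvd //; lia.
have eq_k : k i = k j by lia.
have copDp : coprime D p.
  rewrite coprime_sym prime_coprime // gtnNdvd //.
  by move: ltd; rewrite dE; lia.
have gD : (g < D)%N by rewrite /D; case: hd => ->; lia.
have dvd_diff (u v : 'I_g) : (u <= v)%N -> k u = k v -> u = v.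
  move=> le_uv eq_uv; apply: val_inj => /=.
  have equ := Ak_eq u; have eqv := Ak_eq v; rewrite -eq_uv in eqv.
  have : (D %| p * (v - u))%N.
    apply/dvdnP; exists (A v - A u)%N; rewrite mulnBr [RHS]mulnC mulnBr.
    have : (p * u <= p * v)%N by rewrite leq_mul2l le_uv orbT.
    by move: equ eqv; rewrite !mulnS; lia.
  rewrite Gauss_dvdr //; have lt_v := ltn_ord v.
  case: (posnP (v - u)) => [? _|? ]; first by lia.
  by rewrite gtnNdvd //; lia.
case/orP: (leq_total i j) => [le_ij|le_ji]; first exact: dvd_diff.
by apply/esym/dvd_diff.
Qed.

Let j' (j : 'I_g) : nat := (g - j.+1)%N.
Let T i l : F := (m - A i)%:R - (k i)%:R + l%:R.

Let B i (j : 'I_g) : F :=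
  'C(m, A i)%:R * (if (j' j <= k i)%N then 'C(m - A i, k i - j' j) else 0%N)%:R.

Lemma det_B : \det (\matrix_(i, j) B i j) != 0.
Proof.
have [leD [ltg ltd]] := le_p.
(* The row factors on the two sides of [binomial_kratt]. It suffices that the [be i] be nonzero,
   since they stand on the side of the [kratt] determinant. *)
pose al i : F := (k i)`!%:R * \prod_((k i).+1 <= l < g) T i l.
pose be i : F := 'C(m, A i)%:R * \prod_(g <= l < (k i).+1) T i l.
have scaled : \matrix_(i, j) (al i * (\matrix_(i, j) B i j) i j * 1) =
    \matrix_(i, j) (be i * (\matrix_(i, j) (kratt g mu nu (j' j)).[(k i)%:R]) i j * 1).
  apply/matrixP=> i j; rewrite !mxE !mulr1 /al /be /B.
  have lt_j : (j' j < g)%N by rewrite /j'; have := ltn_ord j; lia.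
  have := binomial_kratt F (m - A i) (k i) lt_j; rewrite -/(T i _) => e.
  have -> : (kratt g mu nu (j' j)).[(k i)%:R] =
     \prod_(0 <= l < j' j) ((k i)%:R - l%:R) * \prod_((j' j).+1 <= l < g) T i l.
    rewrite hornerM !horner_prod; congr (_ * _).
      by apply: eq_bigr => l _; rewrite hornerXsubC.
    apply: eq_bigr => l _; rewrite hornerD hornerZ hornerX hornerC addrA.
    by rewrite -row_linear.
  set X := _%:R in e *; set Y := \prod_(_ <= l < g) _ in e *.
  rewrite -[RHS]mulrA [X in _ = _ * X]mulrC -e; ring.
have := congr1 determinant scaled; rewrite !det_scale !big1_eq !mulr1.
move=> e; have : \prod_i be i *
    \det (\matrix_(i < g, j < g) (kratt g mu nu (j' j)).[(k i)%:R]) != 0.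
  rewrite mulf_neq0 //; last first.
    apply: (kratt_nonsingular (x := fun i => (k i)%:R)) => [|j lt_j|j l lt_jl].
    - exact: k_inj.
    - by apply/nz_nat/ndvd_fact; lia.
    have := nz_nat (ndvd_linear hg hd pr_p hpP lt_jl); rewrite -/D; apply: contraNneq => e0.
    have := scale_linear j%:R l; rewrite e0 mulr0 => /esym e1.
    have lt_D : (D <= D * (l - j))%N by rewrite leq_pmulr //; lia.
    rewrite natrB; last by rewrite dE; lia.
    rewrite natrD 2!natrM natrM !natrB; try by lia.
    by apply/eqP; rewrite -[RHS]e1 !natrM dE -!natr1; ring.
  apply/prodf_neq0 => i _; rewrite mulf_neq0 //.
    have : ~~ (p %| m`!)%N by apply: ndvd_fact; rewrite [p in (_ < p)%N]pE; lia.
    move=> npm; apply/nz_nat; apply: contra npm => pC.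
    by rewrite -(bin_fact (A_le i)) dvdn_mulr.
  rewrite prodf_seq_neq0; apply/allP => l; rewrite mem_index_iota => lt_l.
  have := nz_nat (ndvd_falling (s := k i - l) hg hd pr_p hpP (k_lt i) _); rewrite -/D.
  move=> /(_ ltac:(lia)); apply: contraNneq => T0.
  have := scale_linear (k i)%:R l; rewrite -row_linear -/(T i l) T0 mulr0 => /esym e1.
  rewrite natrB; last by move: (2 * D * _)%N => y; lia.
  rewrite 2!natrD 3!natrM natrB; last by lia.
  by apply/eqP; rewrite -oppr0 -[in RHS]e1 !natrM dE -!natr1; ring.
by rewrite -e; apply: contraNneq => ->; rewrite mulr0.
Qed.

Let H := hwmx (trinomial d a%:P 'X) g p.

Let HE i j c : (H i j)`_c = if (c <= m)%N then
  (('X^(D.+1) + a *: 'X : {poly F}) ^+ (m - c))`_(p * i.+1 - j.+1) *+ 'C(m, c) else 0.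
Proof. by rewrite mxE dE coef_trinomial_exp. Qed.

Let index_eq (i j : 'I_g) : (p * i.+1 - j.+1 + k i = D * A i + m + j' j)%N.
Proof.
have := Ak_eq i; have := ltn_ord j; have : (p <= p * i.+1)%N by rewrite leq_pmulr.
by have [_ [ltg _]] := le_p; rewrite /j'; lia.
Qed.

Lemma hw_low_coef i j c : (c + j' j < k i)%N -> (H i j)`_c = 0.
Proof.
move=> lt_c; rewrite HE; case: leqP => // le_cm.
rewrite coef_binomial_exp_eq0 ?mul0rn // => e def_n.
have := index_eq i j; rewrite def_n; have := k_lt i => lt_k eqD.
have lt_eA : (D * e < D * A i)%N by lia.
rewrite ltn_pmul2l // in lt_eA.
have : (D * e.+1 <= D * A i)%N by rewrite leq_mul2l lt_eA orbT.
by rewrite mulnS; lia.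
Qed.

(** The exponent of [a] in this coefficient is m - c - A_i with c = k_i - j'. Multiplying by a^(k_i)
    makes it m - A_i + j', a row part plus a column part. *)
Lemma hw_lead_coef i j : (j' j <= k i)%N ->
  (H i j)`_(k i - j' j) * a ^+ k i = B i j * (a ^+ (m - A i) * a ^+ j' j).
Proof.
move=> le_jk; rewrite HE /B le_jk; set c := (k i - j' j)%N.
case: leqP => [le_cm|lt_mc]; last first.
  have -> : 'C(m - A i, c) = 0%N by apply: bin_small; have := A_le i; lia.
  by rewrite mulr0 !mul0r.
have -> : (p * i.+1 - j.+1 = m - c + D * A i)%N by have := index_eq i j; rewrite /c; lia.
rewrite coef_binomial_expE // -mulrnA [(_ * 'C(m, c))%N]mulnC bin_swap.
rewrite -[X in X * _ = _]mulr_natr natrM mulrAC.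
have [le_s|lt_s] := leqP (c + A i) m; last first.
  have -> : 'C(m - A i, c) = 0%N by apply: bin_small; have := A_le i; lia.
  by rewrite !(mulr0, mul0r).
rewrite [RHS]mulrC; congr (_ * _); rewrite -!exprD; congr (_ ^+ _).
by rewrite /c; lia.
Qed.

Lemma det_hwmx_trinomial : \det H != 0.
Proof.
pose Y i j : {poly F} := drop_poly (k i) ('X^(j' j) * H i j).
have XH i j : 'X^(j' j) * H i j = 'X^(k i) * Y i j.
  apply/polyP=> n; rewrite [RHS]coefXnM coef_drop_poly.
  case: ltnP => [lt_n|le_n]; last by rewrite subnK.
  by rewrite coefXnM; case: ltnP => // le_jn; rewrite hw_low_coef //; lia.
have detY : \prod_(j < g) 'X^(j' j) * \det H =
    \prod_(i < g) 'X^(k i) * \det (\matrix_(i, j) Y i j).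
  transitivity (\det (\matrix_(i, j) (1 * H i j * 'X^(j' j)))).
    by rewrite det_scale big1_eq mul1r mulrC.
  transitivity (\det (\matrix_(i, j) ('X^(k i) * (\matrix_(i, j) Y i j) i j * 1))).
    congr (\det _); apply/matrixP=> i j; rewrite [LHS]mxE [RHS]mxE.
    by rewrite mulr1 [X in _ = _ * X]mxE -XH mul1r mulrC.
  by rewrite det_scale big1_eq mulr1.
have nzY : \det (\matrix_(i, j) Y i j) != 0.
  suff : (\det (\matrix_(i, j) Y i j)).[0] != 0.
    by apply: contraNneq => ->; rewrite horner0.
  rewrite -horner_evalE -det_map_mx.
  set E := map_mx _ _.
  have : \matrix_(i, j) (a ^+ k i * E i j * 1) =
      \matrix_(i, j) (a ^+ (m - A i) * (\matrix_(i, j) B i j) i j * a ^+ j' j).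
    apply/matrixP=> i j; rewrite !mxE /= horner_evalE horner_coef0 coef_drop_poly add0n.
    (* If k_i < j', the entry vanishes at t = 0, in accordance with the zero in [B]. *)
    rewrite coefXnM mulr1; case: ltnP => [lt_kj|le_jk].
      by rewrite /B leqNgt lt_kj /= !mulr0 mul0r.
    by rewrite mulrC hw_lead_coef //; ring.
  move/(congr1 determinant); rewrite !det_scale big1_eq mulr1 => e.
  have : \prod_(i < g) a ^+ k i * \det E != 0.
    rewrite e !mulf_neq0 ?det_B //; apply/prodf_neq0 => i _; exact: expf_neq0.
  by apply: contraNneq => ->; rewrite mulr0.
have : \prod_(j < g) 'X^(j' j) * \det H != 0.
  rewrite detY mulf_neq0 //; apply/prodf_neq0 => i _.
  by rewrite -size_poly_gt0 size_polyXn.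
by apply: contraNneq => ->; rewrite mulr0.
Qed.

End GenericHasseWitt.

Lemma det_hwmx_trinomial_neq0 (F : fieldType) (g d p : nat) (a : F) :
  (2 <= g)%N -> d = (2 * g + 1)%N \/ d = (2 * g + 2)%N ->
  p \in [pchar F] -> (Pplus d < p)%N -> a != 0 ->
  \det (hwmx (trinomial d a%:P 'X) g p) != 0.
Proof.
move=> hg hd pF hpP nz_a; have /choice[Ak AkP] := row_data hg hd pF hpP nz_a.
by apply: (@det_hwmx_trinomial F g d p a hg hd pF hpP nz_a
  (fun i => (Ak i).1) (fun i => (Ak i).2)) => i; have [] := AkP i.
Qed.

(** * Rings of integers and their residue fields *)

Section IntegralElements.

Variable F : fieldExtType rat.

(** Gauss's lemma: an integer polynomial proportional to the minimal polynomial divides the monic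
    [r] over the integers, so its leading coefficient is 1 or -1. *)
Lemma int_minPoly (y : F) : integralOver (intr : int -> F) y ->
  exists2 q : {poly int}, q \is monic & map_poly (intr : int -> F) q = minPoly 1%AS y.
Proof.
case=> r mon_r root_r.
have [pr prE] : exists q, minPoly 1%AS y = map_poly (in_alg F) q.
  exact/polyOver1P/minPolyOver.
have intrE : (fun x : int => x%:~R : F) =1 in_alg F \o (intr : int -> rat).
  by move=> x; rewrite -(rmorph_int (in_alg F)).
have mapE (s : {poly int}) :
    map_poly (intr : int -> F) s = map_poly (in_alg F) (map_poly (intr : int -> rat) s).
  by rewrite -map_poly_comp; apply: eq_map_poly.
have : pr %| map_poly (intr : int -> rat) r.
  rewrite -(dvdp_map (in_alg F)) -prE -mapE.
  apply: minPoly_dvdp => //; rewrite mapE; apply/polyOver1P.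
  by exists (map_poly (intr : int -> rat) r).
case/dvdpP_rat_int=> q [a nz_a prq] [r' rq].
have mon_pr : pr \is monic.
  by rewrite -(map_monic (in_alg F)) -prE monic_minPoly.
have inj_int : injective (intr : int -> rat) by apply: intr_inj.
have lq : lead_coef q * lead_coef r' = 1.
  by rewrite -lead_coefM -rq; apply/eqP.
have [|] : lead_coef q = 1 \/ lead_coef q = -1.
    have : (lead_coef q %| (1 : int))%Z by rewrite -[X in (_ %| X)%Z]lq dvdz_mulr.
    by rewrite dvdz1; lia.
  move=> l1; exists q; first exact/monicP.
  rewrite prE prq mapE; congr (map_poly _ _).
  move/monicP: mon_pr; rewrite prq lead_coefZ lead_coef_map_inj // l1 mulr1 => ->.
  by rewrite scale1r.
move=> l1; exists (- q); first by rewrite monicE lead_coefN l1 opprK.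
rewrite prE prq mapE; congr (map_poly _ _); rewrite rmorphN.
move/monicP: mon_pr; rewrite prq lead_coefZ lead_coef_map_inj // l1.
by rewrite mulrN1 => /(canRL opprK) ->; rewrite scaleN1r.
Qed.

(** The basis of F is an eigenvector of the multiplication matrix for the eigenvalue [y]. So the
    minimal polynomial divides the characteristic one, of the same degree because [y] generates F;
    compare constant terms. *)
Lemma norm_minPoly (y : F) (q : {poly int}) :
  <<1%AS; y>>%VS = fullv -> map_poly (intr : int -> F) q = minPoly 1%AS y ->
  field_norm y = (q`_0)%:~R \/ field_norm y = - (q`_0)%:~R.
Proof.
move=> genF qE; rewrite /field_norm; set e := vbasis {:F}; set A := passmx.mxof _ _ _.
have e_basis : basis_of {:F} e := vbasisP _.
have eA i : \sum_j A i j *: e`_j = y * e`_i.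
  have <- : amull y e`_i = y * e`_i by rewrite lfunE.
  rewrite -(passmx.vecof_delta e i) -(passmx.rVofK e_basis (amull y _)).
  rewrite (passmx.rVof_app _ e_basis) (passmx.vecofK e_basis) -rowE /passmx.vecof.
  under [RHS]eq_bigr do rewrite mxE.
  by [].
clearbody A.
pose v := \row_i e`_i : 'rV[F]_(\dim {:F}).
have nz_v : v != 0.
  have lt0n : (0 < \dim {:F})%N by rewrite adim_gt0.
  apply/eqP=> /rowP/(_ (Ordinal lt0n)); rewrite !mxE /= => e0.
  have : e`_0 \in (e : seq F) by rewrite mem_nth // size_tuple.
  by move/(free_not0 (basis_free e_basis)); rewrite e0 eqxx.
have root_y : root (char_poly (map_mx (in_alg F) A)) y.
  rewrite /root /char_poly -horner_evalE -det_map_mx -det_tr.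
  apply/det0P; exists v => //; apply/rowP=> i; rewrite mxE [RHS]mxE.
  transitivity (\sum_(j < \dim {:F}) (e`_j * (y *+ (i == j)) - A i j *: e`_j)).
    apply: eq_bigr => j _; rewrite !mxE /= horner_evalE hornerD hornerN hornerC hornerMn hornerX.
    by rewrite mulrDr mulrN mulr_algr.
  rewrite big_split /= -[RHS](subrr (y * e`_i)); congr (_ + _).
    rewrite (bigD1 i) //= eqxx mulr1n big1 => [|j /negPf neq_ij].
      by rewrite addr0 mulrC.
    by rewrite eq_sym neq_ij mulr0n mulr0.
  by rewrite -eA -sumrN.
have cE : char_poly (map_mx (in_alg F) A) = minPoly 1%AS y.
  have dv : minPoly 1%AS y %| char_poly (map_mx (in_alg F) A).
    apply: minPoly_dvdp => //; rewrite -map_char_poly; apply/polyOver1P.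
    by exists (char_poly A).
  apply/eqP; rewrite -eqp_monic ?char_poly_monic ?monic_minPoly // eqp_sym.
  rewrite -dvdp_size_eqp // size_minPoly size_char_poly adjoin_degreeE genF.
  by rewrite dimv1 divn1.
have : in_alg F (char_poly A)`_0 = in_alg F (q`_0)%:~R.
  by rewrite rmorph_int -[LHS]coef_map map_char_poly cE -qE coef_map_id0.
move/fmorph_inj; rewrite char_poly_det => /esym ->.
rewrite -signr_odd; case: (odd _); last by left; rewrite expr0 mul1r.
by right; rewrite expr1 mulN1r opprK.
Qed.

End IntegralElements.

(** * Finiteness of the residue field *)

Section FiniteDomain.

Variable R : comNzRingType.
Hypothesis domR : forall x y : R, x * y = 0 -> (x == 0) || (y == 0).

Lemma domain_max_roots (f : {poly R}) (rs : seq R) :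
  f != 0 -> all (root f) rs -> uniq rs -> (size rs < size f)%N.
Proof.
elim: rs f => [|a rs IHrs] f nz_f /=; first by rewrite size_poly_gt0.
case/andP=> /factor_theorem[h fE] root_rs /andP[nin_a uniq_rs].
have nz_h : h != 0 by apply: contraNneq nz_f => h0; rewrite fE h0 mul0r.
rewrite fE size_Mmonic ?monicXsubC // size_XsubC addn2 ltnS.
apply: IHrs => //; apply/allP=> b rs_b.
have := allP root_rs b rs_b; rewrite fE rootE hornerM hornerXsubC => /eqP/domR.
rewrite subr_eq0 => /orP[//|/eqP ba]; by rewrite -ba rs_b in nin_a.
Qed.

(** Modulo p there are only finitely many monic integer polynomials of degree [N], and every element
    of [R] is a root of their product. *)
Lemma finite_of_integral (p N : nat) : (0 < p)%N -> p%:R = 0 :> R ->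
  (forall x : R, exists q : {poly int},
     [/\ q \is monic, (size q <= N.+1)%N & (map_poly (intr : int -> R) q).[x] = 0]) ->
  exists s : seq R, forall x, x \in s.
Proof.
move=> p_gt0 p0 intR; apply: contrapT => infR.
have seqs n : exists2 s : seq R, uniq s & size s = n.
  elim: n => [|n [s uniq_s szs]]; first by exists [::].
  have [x nin_x] : exists x, x \notin s.
    apply: contrapT => all_s; apply: infR; exists s => x.
    by apply: contrapT => nin; apply: all_s; exists x; apply/negP.
  by exists (x :: s); rewrite /= ?nin_x ?szs.
pose mp (c : {ffun 'I_N -> 'I_p}) : {poly R} := 'X^N + \sum_(i < N) (c i)%:R *: 'X^i.
have size_low (c : {ffun 'I_N -> 'I_p}) :
    (size (\sum_(i < N) (c i)%:R *: 'X^i : {poly R})%R < N.+1)%N.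
  rewrite ltnS; apply: leq_trans (size_sum _ _ _) _; apply/bigmax_leqP => i _.
  by rewrite (leq_trans (size_scale_leq _ _)) // size_polyXn.
have monic_mp c : mp c \is monic.
  by rewrite monicE lead_coefDl ?lead_coefXn // size_polyXn.
have [s uniq_s szs] := seqs (size (\prod_c mp c)%R).
suff : (size s < size (\prod_c mp c)%R)%N by rewrite szs ltnn.
apply: domain_max_roots uniq_s.
  by apply: monic_neq0; apply: monic_prod => c _.
apply/allP=> x _; have [q [mon_q szq qx]] := intR x.
(* Padding by a power of X brings the degree to exactly [N]. *)
pose r := 'X^(N.+1 - size q) * q.
have mon_r : r \is monic by rewrite monicMr ?monicXn.
have sz_r : size r = N.+1.
  rewrite size_monicM ?monicXn ?monic_neq0 // size_polyXn.
  by move: szq; generalize (size q) => z; lia.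
have modP (z : int) : exists i : 'I_p, (z%:~R : R) = (i : nat)%:R.
  have nzp : (p%:Z != 0) by rewrite eqz_nat -lt0n.
  have lt_z : (`|(z %% p)%Z| < p)%N.
    by have := modz_ge0 z nzp; have := ltz_pmod z (_ : 0 < p%:Z); rewrite ltz_nat p_gt0 => /(_ isT); lia.
  exists (Ordinal lt_z); rewrite /= [RHS]pmulrn gez0_abs ?modz_ge0 //.
  by rewrite {1}(divz_eq z p) intrD intrM -(pmulrn 1 p) p0 mulr0 add0r.
have /choice[c cP] : forall i : 'I_N, exists j : 'I_p, ((r`_i)%:~R : R) = (j : nat)%:R.
  by move=> i; apply: modP.
have rE : map_poly (intr : int -> R) r = mp (finfun c).
  rewrite -[LHS]coefK [size _]size_map_poly_id0 ?sz_r; last first.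
    by rewrite (monicP mon_r) oner_neq0.
  rewrite poly_def big_ord_recr /= addrC; congr (_ + _).
    rewrite coef_map_id0 //; move/monicP: mon_r; rewrite lead_coefE sz_r /= => ->.
    by rewrite scale1r.
  by apply: eq_bigr => i _; rewrite coef_map_id0 // cP ffunE.
rewrite (bigD1 (finfun c)) //= rootE hornerM -rE.
by rewrite rmorphM /= hornerM qx mulr0 mul0r.
Qed.

(** Multiplication by a nonzero x permutes the finite ring, hence reaches 1. [K] is [R] itself with
    the new structures. *)
Lemma finite_domain_field (s : seq R) : (forall x, x \in s) ->
  exists (K : finFieldType) (iota : {rmorphism R -> K}), injective iota.
Proof.
move=> s_all.
have invP (x : R) : exists y, if x == 0 then y = 0 else y * x = 1.
  case: eqP => [_|/eqP nz_x]; first by exists 0.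
  have : 1 \in map (fun y => y * x) (undup s).
    have uniq_m : uniq (map (fun y => y * x) (undup s)).
      rewrite map_inj_uniq ?undup_uniq // => y z yzx; apply/eqP.
      have /domR : (y - z) * x = 0 by rewrite mulrBl yzx subrr.
      by rewrite (negPf nz_x) orbF subr_eq0.
    have sub_m : {subset map (fun y => y * x) (undup s) <= undup s}.
      by move=> y _; rewrite mem_undup.
    have [|_ ->] := uniq_min_size uniq_m sub_m; first by rewrite size_map.
    by rewrite mem_undup.
  by case/mapP=> y _ ->; exists y.
have /choice[inv {}invP] := invP.
have mulVx (x : R) : x != 0 -> inv x * x = 1 by move/negPf => nz_x; have := invP x; rewrite nz_x.
have inv0 : inv 0 = 0 by have := invP 0; rewrite eqxx.
pose fieldF := GRing.ComNzRing_isField.Build R mulVx inv0.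
pose unp n := if (n < size s)%N then Some (nth 0 s n) else None.
have unpK : pcancel (index^~ s) unp by move=> x; rewrite /unp index_mem s_all nth_index.
pose countF := isCountable.Build R unpK.
have finA : Finite.axiom (undup s) by move=> x; rewrite count_uniq_mem ?undup_uniq // mem_undup s_all.
pose finF := isFinite.Build R finA.
pose K : finFieldType := HB.pack R fieldF countF finF.
by exists K, (idfun : {rmorphism R -> R}) => x y.
Qed.

End FiniteDomain.

Section ResidueField.

Variables (F : fieldExtType rat) (P : prime_idealr (ring_of_integers F)).

Local Notation O := (ring_of_integers F).
Local Notation Q := {ideal_quot P}.

Lemma roi_monic_root (x : O) : exists q : {poly int},
  [/\ q \is monic, map_poly (intr : int -> F) q = minPoly 1%AS (val x),
      (size q <= (\dim {:F}).+1)%N & (map_poly (intr : int -> O) q).[x] = 0].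
Proof.
have /asboolP int_x : integral_pred (val x) by apply: valP.
have [q mon_q qE] := int_minPoly int_x; exists q; split=> //.
  have -> : size q = size (map_poly (intr : int -> F) q).
    by rewrite size_map_poly_id0 // (monicP mon_q) oner_neq0.
  rewrite qE size_minPoly ltnS adjoin_degreeE dimv1 divn1; apply: dimvS; exact: subvf.
apply: val_inj; rewrite -horner_map -map_poly_comp [RHS]rmorph0.
rewrite (eq_map_poly (g := (intr : int -> F))) ?qE ?minPolyxx // => z.
exact: (rmorph_int (val : {rmorphism O -> F})).
Qed.

(** Write the minimal polynomial as r X + c: then alpha r(alpha) = -c, and c is the norm up to
    sign. *)
Lemma roi_mul_inv (p : nat) (alpha : O) :
  <<1%AS; val alpha>>%VS = fullv ->
  ~ (exists m : int, field_norm (val alpha) = (p%:Z * m)%:~R) ->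
  exists (beta : O) (n : int), alpha * beta = n%:~R /\ ~~ (p %| n)%Z.
Proof.
move=> genF normN; have [q [_ qE _ root_a]] := roi_monic_root alpha.
have := norm_minPoly genF qE; move: root_a; elim/poly_ind: q {qE} => [|r c _].
  by rewrite coef0 /= rmorph0 oppr0 => _ [] n0; case: normN; exists 0; rewrite n0 mulr0.
rewrite coefD coefMX coefC /= add0r rmorphD rmorphM /= map_polyX map_polyC /=.
rewrite hornerD hornerM hornerX hornerC => /eqP; rewrite addr_eq0 mulrC => /eqP e n_c.
exists (map_poly (intr : int -> O) r).[alpha], (- c); split; first by rewrite e rmorphN.
rewrite rpredN; apply/negP=> /dvdzP[m cE]; apply: normN.
by case: n_c => ->; [exists m | exists (- m)]; rewrite cE -?rmorphN mulrC ?mulrN.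
Qed.

Variable p : nat.
Hypotheses (pr_p : prime p) (pP : p%:R \in P).

Lemma natr_ideal_quot : p%:R = 0 :> Q.
Proof.
rewrite -(rmorph_nat (\pi_Q : {rmorphism O -> Q})) -(rmorph0 (\pi_Q : {rmorphism O -> Q})).
by apply/eqP; rewrite -Quotient.idealrBE subr0.
Qed.

Lemma pchar_ideal_quot (K : fieldType) (iota : {rmorphism Q -> K}) : p \in [pchar K].
Proof.
apply/andP; split=> //; apply/eqP.
by rewrite -(rmorph_nat iota) natr_ideal_quot rmorph0.
Qed.

Lemma residue_field : exists (K : finFieldType) (iota : {rmorphism Q -> K}), injective iota.
Proof.
have domQ : forall x y : Q, x * y = 0 -> (x == 0) || (y == 0).
  exact: Quotient.rquot_IdomainAxiom.
have [s s_all] : exists s : seq Q, forall x, x \in s.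
  apply: (finite_of_integral (N := \dim {:F}) domQ (prime_gt0 pr_p) natr_ideal_quot).
  elim/quotW=> x; have [q [mon_q _ szq root_q]] := roi_monic_root x.
  exists q; split=> //; move/(congr1 (\pi_Q : O -> Q)): root_q.
  rewrite -horner_map -map_poly_comp rmorph0 => e; rewrite -[RHS]e.
  by congr (_.[_]); apply: eq_map_poly => z /=; rewrite rmorph_int.
exact: finite_domain_field domQ s s_all.
Qed.

Lemma red_neq0 (alpha : O) (K : finFieldType) (iota : {rmorphism Q -> K}) :
  <<1%AS; val alpha>>%VS = fullv ->
  ~ (exists m : int, field_norm (val alpha) = (p%:Z * m)%:~R) ->
  red iota alpha != 0.
Proof.
move=> genF normN; have [beta [n [ab ndvd]]] := roi_mul_inv genF normN.
apply: contraNneq ndvd => a0.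
have : iota (\pi_Q (alpha * beta)) = 0 by rewrite !rmorphM /= -/(red iota alpha) a0 mul0r.
rewrite ab !rmorph_int => /eqP; rewrite dvdzE absz_nat (dvdn_pcharf (pchar_ideal_quot iota)).
by rewrite {1}[n]intEsign rmorphM rmorph_sign mulf_eq0 signr_eq0.
Qed.

End ResidueField.

(** * The ordinary locus *)

Section Trinomial.

Lemma map_trinomial (R S : comNzRingType) (phi : {rmorphism R -> S}) d a t :
  map_poly phi (trinomial d a t) = trinomial d (phi a) (phi t).
Proof. by rewrite /trinomial !rmorphD /= map_polyXn map_polyZ /= map_polyX map_polyC. Qed.

Lemma size_lead_trinomial (R : comNzRingType) d (a t : R) : (1 < d)%N ->
  size (trinomial d a t) = d.+1 /\ trinomial d a t \is monic.
Proof.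
move=> lt1d.
have lt_s : (size (a *: 'X + t%:P)%R < size ('X^d : {poly R})%R)%N.
  rewrite size_polyXn ltnS (leq_trans (size_polyD _ _)) // geq_max.
  rewrite (leq_trans (size_scale_leq _ _)) ?size_polyX //.
  by rewrite (leq_trans (size_polyC_leq1 _)) // ltnW.
by rewrite /trinomial -addrA monicE lead_coefDl // lead_coefXn size_polyDl // size_polyXn.
Qed.

(** Resultants commute with specialisation when both degrees are preserved; [nz_d] ensures this for
    the derivative. *)
Lemma map_disc_family (R : comNzRingType) (K : fieldType) (phi : {rmorphism R -> K})
    (d : nat) (a : R) (t0 : K) : (1 < d)%N -> (d%:R : K) != 0 ->
  (map_poly phi (disc_family d a)).[t0] = disc (trinomial d (phi a) t0).
Proof.
move=> lt1d nz_d; pose psi : {rmorphism {poly R} -> K} := horner_eval t0 \o map_poly phi.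
have psiE h : (map_poly phi h).[t0] = psi h by [].
set T := trinomial d a%:P 'X; have [szT monT] := size_lead_trinomial a%:P 'X lt1d.
have [szU monU] := size_lead_trinomial (phi a) t0 lt1d.
have mapT : map_poly psi T = trinomial d (phi a) t0.
  rewrite map_trinomial /psi /= !horner_evalE map_polyC map_polyX hornerC hornerX //.
have Td : T^`()`_d.-1 = d%:R.
  rewrite coef_deriv prednK; last exact: ltnW.
  by move/monicP: monT; rewrite lead_coefE szT /= => ->.
have psid : psi d%:R = d%:R by rewrite rmorph_nat.
have szT' : size T^`() = d.
  apply/eqP; rewrite eqn_leq -ltnS -szT lt_size_deriv ?monic_neq0 //=.
  rewrite -(prednK (ltnW lt1d)) ltnNge; apply: contra nz_d => /leq_sizeP/(_ _ (leqnn _)).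
  by rewrite -psid -Td => ->; rewrite rmorph0.
rewrite psiE /disc_family /disc rmorphM rmorph_sign -/T szT szU; congr (_ * _).
rewrite map_resultant; first by rewrite -mapT deriv_map.
  by rewrite (monicP monT) rmorph1 oner_neq0.
by rewrite lead_coefE szT' Td psid.
Qed.

Lemma disc_neq0 (K : fieldType) (f : {poly K}) : f != 0 ->
  (disc f != 0) = coprimep f f^`().
Proof.
move=> nz_f; rewrite mulf_eq0 signr_eq0 /= resultant_eq0 -leqNgt /coprimep eqn_leq.
by rewrite size_poly_gt0 gcdp_eq0 (negPf nz_f) andbT.
Qed.

(** For f = x^d + a x, d f - x f' is (d - 1) a x, so a common divisor of f and f' divides x, and
    then also a. *)
Lemma coprimep_trinomial0 (K : fieldType) (d : nat) (a : K) :
  (1 < d)%N -> (d.-1%:R : K) != 0 -> a != 0 ->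
  coprimep (trinomial d a 0) (trinomial d a 0)^`().
Proof.
move=> lt1d nz_d1 nz_a.
have derE : (trinomial d a 0)^`() = 'X^(d.-1) *+ d + a%:P.
  by rewrite /trinomial !derivD derivXn derivZ derivX derivC addr0 alg_polyC.
have eq_lin : (trinomial d a 0) *+ d - 'X * (trinomial d a 0)^`() = (a *+ d.-1) *: 'X.
  rewrite derE /trinomial addr0 -[d in 'X^d]prednK; last exact: ltnW.
  rewrite exprS mulrDr mulrnDl mulrnAr opprD addrACA subrr add0r.
  rewrite [_ * a%:P]mulrC mul_polyC -scalerMnl -[d in _ *+ d]prednK; last exact: ltnW.
  by rewrite mulrS [X in X - _]addrC addrK.
apply/coprimepP => e e_f e_f'.
have e_X : e %| 'X.
  have : e %| (a *+ d.-1) *: 'X.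
    by rewrite -eq_lin dvdp_sub ?dvdp_mull // -mulr_natl dvdp_mull.
  by rewrite dvdpZr // -mulr_natl mulf_neq0.
have : e %| a%:P.
  rewrite -[a%:P](addKr ('X^(d.-1) *+ d)) -derE dvdp_add // dvdpNr -mulr_natl dvdp_mull //.
  by rewrite -[d.-1]prednK ?exprS ?dvdp_mulr //; lia.
by rewrite -alg_polyC dvdpZr // dvdp1 -size_poly_eq1.
Qed.

End Trinomial.

Section GenericOrdinarity.

Variables (g d : nat) (F : fieldExtType rat) (alpha : ring_of_integers F) (p : nat).
Variable P : prime_idealr (ring_of_integers F).
Hypotheses (hg : (2 <= g)%N) (hd : d = (2 * g + 1)%N \/ d = (2 * g + 2)%N).
Hypotheses (pr_p : prime p) (hpP : (Pplus d < p)%N) (pP : p%:R \in P).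

Local Notation O := (ring_of_integers F).
Local Notation Q := {ideal_quot P}.

Let lt1d : (1 < d)%N. Proof. by lia. Qed.

Lemma in_base_coprimep (K : finFieldType) (iota : {rmorphism Q -> K}) (t0 : K) :
  in_base alpha d iota t0 <->
    coprimep (trinomial d (red iota alpha) t0) (trinomial d (red iota alpha) t0)^`().
Proof.
have pK := pchar_ideal_quot pr_p pP iota.
have [_ _ lt_dp] := Pplus_lt_bounds hg hd pr_p hpP.
have K2 : (2%:R : K) != 0.
  rewrite -(dvdn_pcharf pK); apply/negP=> /prime_nt_dvdP.
  by have := odd_char hg hd pr_p hpP; case: (p) pr_p => [|[|[|]]] // n _ _ /(_ isT isT).
have nz_d : (d%:R : K) != 0 by rewrite -(dvdn_pcharf pK) ndvd_range // ltnW.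
have [sf mf] := size_lead_trinomial (red iota alpha) t0 lt1d.
rewrite -disc_neq0 ?monic_neq0 // /in_base.
have -> : (map_poly (red iota) (disc_family d alpha)).[t0] = disc (trinomial d (red iota alpha) t0).
  exact: (map_disc_family (iota \o \pi_Q)).
by split=> [[]|].
Qed.

Lemma in_ordinary_locus_hwmx (K : finFieldType) (iota : {rmorphism Q -> K}) (t0 : K) :
  in_ordinary_locus alpha d iota t0 <-> in_base alpha d iota t0 /\
    \det (hwmx (trinomial d (red iota alpha) t0) g p) != 0.
Proof.
have pK := pchar_ideal_quot pr_p pP iota.
have [_ lt_gp _] := Pplus_lt_bounds hg hd pr_p hpP.
have [sf mf] := size_lead_trinomial (red iota alpha) t0 lt1d.
by split=> -[base ord]; split=> //; have cop := (in_base_coprimep iota t0).1 base;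
  apply/(ordinary_hwmx pK (odd_char hg hd pr_p hpP) lt_gp mf cop sf hd (ltnW hg)).
Qed.

Lemma map_det_hwmx (R S : comNzRingType) (phi : {rmorphism R -> S}) (a : R) (t0 : S) :
  (map_poly phi (\det (hwmx (trinomial d a%:P 'X) g p))).[t0] =
  \det (hwmx (trinomial d (phi a) t0) g p).
Proof.
pose psi : {rmorphism {poly R} -> S} := horner_eval t0 \o map_poly phi.
transitivity (psi (\det (hwmx (trinomial d a%:P 'X) g p))); first by [].
rewrite -det_map_mx map_hwmx map_trinomial.
by rewrite /psi /= !horner_evalE map_polyC map_polyX hornerC hornerX.
Qed.

End GenericOrdinarity.

(** A root of f X + 1 cannot be a root of f. *)
Lemma exists_nonroot (K : finFieldType) (f : {poly K}) : f != 0 ->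
  exists (E : finFieldType) (iota : {rmorphism K -> E}) (t0 : E),
    (map_poly iota f).[t0] != 0.
Proof.
move=> nz_f; have sz_f : (1 < size (f * 'X + 1%:P)%R)%N.
  by rewrite size_MXaddC (negPf nz_f) /= ltnS size_poly_gt0.
have [|E [iota [s fE]]] := @exists_splitting K (f * 'X + 1%:P).
  by rewrite -size_poly_gt0 ltnW.
have : (1 < size (\prod_(x <- s) ('X - x%:P))%R)%N.
  by rewrite -(eqp_size fE) size_map_poly.
rewrite size_prod_XsubC; case: s fE => // t0 s fE _.
exists E, iota, t0; have : root (map_poly iota (f * 'X + 1%:P)) t0.
  by rewrite (eqp_root fE) root_prod_XsubC mem_head.
rewrite rmorphD rmorphM /= map_polyX map_polyC rootE hornerD hornerMX hornerC.
by apply: contraTneq => ->; rewrite mul0r add0r fmorph_eq0 oner_neq0.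
Qed.

Theorem theorem1p3 (g d : nat) (hg : (2 <= g)%N)
  (hd : d = (2 * g + 1)%N \/ d = (2 * g + 2)%N)
  (F : fieldExtType rat) (alpha : ring_of_integers F)
  (halpha : alpha != 0)
  (hF : <<1%AS; val alpha>>%VS = fullv)
  (p : nat) (hp : prime p) (hpP : (Pplus d < p)%N)
  (hpN : ~ exists m : int, field_norm (val alpha) = (p%:Z * m)%:~R)
  (P : prime_idealr (ring_of_integers F))
  (hpP' : p%:R \in P) :
  generically_ordinary alpha d P.
Proof.
pose h : {poly {ideal_quot P}} := \det (hwmx (trinomial d (\pi_{ideal_quot P} alpha)%:P 'X) g p).
have lt1d : (1 < d)%N by lia.
have hE (K : finFieldType) (iota : {rmorphism {ideal_quot P} -> K}) (t0 : K) :
    (map_poly iota h).[t0] = \det (hwmx (trinomial d (red iota alpha) t0) g p).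
  exact: map_det_hwmx.
split; last first.
  exists h => K iota t0; rewrite hE.
  exact: (in_ordinary_locus_hwmx alpha hg hd hp hpP hpP').
(* The finite field [K0] receives the residue ring, so that finite extensions can be taken. *)
have [K0 [iota0 _]] := residue_field hp hpP'.
have pK0 := pchar_ideal_quot hp hpP' iota0.
have nz_a : red iota0 alpha != 0 := red_neq0 hp hpP' iota0 hF hpN.
have [le_dp _ lt_dp] := Pplus_lt_bounds hg hd hp hpP.
have nz_d : (d%:R : K0) != 0 by rewrite -(dvdn_pcharf pK0) ndvd_range // ltnW.
pose D : {poly K0} := disc_family d (red iota0 alpha).
have nz_D : D != 0.
  suff : D.[0] != 0 by apply: contraNneq => ->; rewrite horner0.
  have -> : D.[0] = (map_poly idfun D).[0] by rewrite map_poly_id.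
  rewrite (map_disc_family (idfun : {rmorphism K0 -> K0})) //.
  rewrite disc_neq0 ?monic_neq0 //; last by case: (size_lead_trinomial (red iota0 alpha) 0 lt1d).
  by apply: coprimep_trinomial0; rewrite // -(dvdn_pcharf pK0) ndvd_range //; lia.
pose H : {poly K0} := \det (hwmx (trinomial d (red iota0 alpha)%:P 'X) g p).
have nz_H : H != 0 by apply: det_hwmx_trinomial_neq0 hg hd pK0 hpP nz_a.
(* A point avoiding the zeros of both the discriminant and the Hasse-Witt determinant. *)
have [K [j [t0]]] := exists_nonroot (mulf_neq0 nz_D nz_H).
rewrite rmorphM hornerM mulf_eq0 negb_or => /andP[D_t0 H_t0].
pose iota : {rmorphism {ideal_quot P} -> K} := j \o iota0.
exists K, iota, t0; apply/(in_ordinary_locus_hwmx alpha hg hd hp hpP hpP').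
have nz_dK : (d%:R : K) != 0 by rewrite -(rmorph_nat j) fmorph_eq0.
move: D_t0 H_t0; rewrite /D /H map_disc_family // map_det_hwmx => D_t0 H_t0; split=> //.
apply/(in_base_coprimep alpha hg hd hp hpP hpP'); rewrite -disc_neq0 //.
by apply: monic_neq0; case: (size_lead_trinomial (red iota alpha) t0 lt1d).
Qed.
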